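(* Consider the quintic equation $$i\,du=\Delta u\circ dW_t+|u|^4u\,dt,\qquad u(t=0)=u_0$$ on $\mathbb{T}$. Suppose that the data to solution map $S$, sending $u_0$ to the solution $u$ of this equation, exists, and that it is continuous as an operator from a neighborhood of $0$ in $L^2(\mathbb{T})$ into $L^1(\Omega;C([0,T];L^2(\mathbb{T})))$ for $T>0$ sufficiently small. Then $S$ is not $C^5$ (as a map from a neighborhood of $0$ in $L^2(\mathbb{T})$ into $L^1(\Omega;C([0,T];L^2(\mathbb{T})))$).
   Context: $\mathbb{T}=\mathbb{R}/(2\pi\mathbb{Z})$. $(W_t)_{t\ge0}$ is a standard real Brownian motion on a probability space $(\Omega,\mathcal{F},\mathbb{P})$, and $\circ\,dW_t$ is the Stratonovich differential. The linear propagator $e^{-i(W_t-W_s)\Delta}$ is the Fourier multiplier on $\mathbb{T}$ with symbol $e^{ik^2(W_t-W_s)}$, $k\in\mathbb{Z}$. Solutions are understood in the mild (Duhamel) sense $$u(t)=e^{-iW_t\Delta}u_0-i\int_0^te^{-i(W_t-W_s)\Delta}\left(|u(s)|^4u(s)\right)ds.$$ $C^5$ means five times continuously differentiable between (real) Banach spaces. *)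

(* Defs.v *)
From HB Require Import structures.
From mathcomp Require Import all_boot all_order all_algebra.
From mathcomp Require Import all_classical all_reals all_analysis.
From mathcomp Require Import measurable_realfun complex.
From mathcomp Require Import ring lra.

Set Implicit Arguments.
Unset Strict Implicit.
Unset Printing Implicit Defensive.

Import Order.TTheory GRing.Theory Num.Theory.
Import numFieldNormedType.Exports.

Local Open Scope classical_set_scope.
Local Open Scope ring_scope.

Record seminormed (R : realType) (V : lmodType R) := Seminormed {
  dom : set V ;
  semi : V -> R ;
  dom0 : dom 0 ;
  domP : forall a x y, dom x -> dom y -> dom (a *: x + y) ;
  semiD : forall x y, dom x -> dom y -> semi (x + y) <= semi x + semi y ;
  semiZ : forall a x, dom x -> semi (a *: x) = `|a| * semi x }.

Section separation.
Context (R : realType) (V : lmodType R) (E : seminormed V).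
Implicit Types (x y z : V).

Lemma domZ a x : dom E x -> dom E (a *: x).
Proof. by move=> dx; rewrite -[_ *: _]addr0; apply: domP => //; exact: dom0. Qed.

Lemma domD x y : dom E x -> dom E y -> dom E (x + y).
Proof. by move=> dx dy; have := domP 1 dx dy; rewrite scale1r. Qed.

Lemma domN x : dom E x -> dom E (- x).
Proof. by move=> dx; rewrite -scaleN1r; exact: domZ. Qed.

Lemma domB x y : dom E x -> dom E y -> dom E (x - y).
Proof. by move=> dx dy; apply: domD => //; exact: domN. Qed.

Lemma semi0 : semi E 0 = 0.
Proof. by rewrite -(scale0r 0) semiZ ?normr0 ?mul0r //; exact: dom0. Qed.

Lemma semiN x : dom E x -> semi E (- x) = semi E x.
Proof. by move=> dx; rewrite -scaleN1r semiZ// normrN1 mul1r. Qed.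

Lemma semi_ge0 x : dom E x -> 0 <= semi E x.
Proof.
move=> dx; have := semiD dx (domN dx).
by rewrite subrr semi0 semiN// => ?; lra.
Qed.

(* The normed space obtained from [E] by identifying the elements at distance
   [0] from one another; its points are the equivalence classes. *)
Record sep := Sep {
  sep_class : set V ;
  _ : exists2 x, dom E x &
      sep_class = [set y | dom E y /\ semi E (y - x) = 0] }.

HB.instance Definition _ := gen_eqMixin sep.
HB.instance Definition _ := gen_choiceMixin sep.

Definition to_sep x (dx : dom E x) : sep := Sep (ex_intro2 _ _ x dx erefl).

Definition rep (c : sep) : V := xget 0 (sep_class c).

Lemma sep_ext (c c' : sep) : sep_class c = sep_class c' -> c = c'.
Proof.
case: c c' => [A Ap] [B Bp] /= AB; move: Ap Bp; rewrite AB => Ap Bp.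
by congr Sep; exact: Prop_irrelevance.
Qed.

Lemma rep_dom (c : sep) : dom E (rep c).
Proof.
case: c => A /= Ap; rewrite /rep /=; case: (Ap) => x dx AE.
have : A x by rewrite AE /= subrr semi0.
by move=> /(@xgetI _ 0 A); rewrite {1}AE => -[].
Qed.

Lemma semi_eq0_trans x y z : dom E x -> dom E y -> dom E z ->
  semi E (x - y) = 0 -> semi E (y - z) = 0 -> semi E (x - z) = 0.
Proof.
move=> dx dy dz xy yz; apply/eqP; rewrite eq_le semi_ge0 ?andbT; last exact: domB.
rewrite -(subrKA y) (le_trans (semiD (domB dx dy) (domB dy dz)))//.
by rewrite xy yz addr0.
Qed.

Lemma semi_eq0C x y : dom E x -> dom E y ->
  semi E (x - y) = 0 -> semi E (y - x) = 0.
Proof. by move=> dx dy; rewrite -opprB semiN//; exact: domB. Qed.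

Lemma to_sep_eq x y (dx : dom E x) (dy : dom E y) :
  to_sep dx = to_sep dy <-> semi E (x - y) = 0.
Proof.
split=> [/(congr1 sep_class)/= xy|xy].
  have : [set z | dom E z /\ semi E (z - x) = 0] x by rewrite /= subrr semi0.
  by rewrite xy => -[].
apply: sep_ext => /=; apply/seteqP; split => z /= [dz zx]; split=> //.
  exact: semi_eq0_trans xy.
by apply: (semi_eq0_trans dz dy dx) => //; exact: semi_eq0C.
Qed.

Lemma repK (c : sep) : to_sep (rep_dom c) = c.
Proof.
apply: sep_ext => /=; move: (rep_dom c); rewrite /rep; case: c => A /= Ap.
case: (Ap) => x dx AE dg.
have /(@xgetI _ 0 A) : A x by rewrite AE /= subrr semi0.
rewrite {1}AE => -[_ gx].
rewrite [RHS]AE; apply/seteqP; split => z /= [dz zx]; split=> //.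
  exact: semi_eq0_trans gx.
by apply: (semi_eq0_trans dz dx dg) => //; exact: semi_eq0C.
Qed.

Lemma to_sepK x (dx : dom E x) : semi E (rep (to_sep dx) - x) = 0.
Proof. by apply/(to_sep_eq (rep_dom _) dx); rewrite repK. Qed.

Lemma sep_eq (c c' : sep) : semi E (rep c - rep c') = 0 -> c = c'.
Proof. by move=> h; rewrite -(repK c) -(repK c'); apply/to_sep_eq. Qed.

Lemma semi_rep x (dx : dom E x) : semi E (rep (to_sep dx)) = semi E x.
Proof.
have e := to_sepK dx; have dr := rep_dom (to_sep dx).
apply/eqP; rewrite eq_le; apply/andP; split.
  rewrite -[leLHS](congr1 (semi E) (subrK x _)).
  by rewrite (le_trans (semiD (domB dr dx) dx))// e add0r.
rewrite -[leLHS](congr1 (semi E) (subrK (rep (to_sep dx)) _)).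
by rewrite (le_trans (semiD (domB dx dr) dr))// (semi_eq0C dr dx e) add0r.
Qed.

Definition sep_zero := to_sep (dom0 E).
Definition sep_opp c := to_sep (domN (rep_dom c)).
Definition sep_add c c' := to_sep (domD (rep_dom c) (rep_dom c')).
Definition sep_scale a c := to_sep (domZ a (rep_dom c)).

Lemma to_sep_ext x y (dx : dom E x) (dy : dom E y) : x = y -> to_sep dx = to_sep dy.
Proof. by move=> xy; apply/to_sep_eq; rewrite xy subrr semi0. Qed.

Lemma to_sepD x y (dx : dom E x) (dy : dom E y) :
  sep_add (to_sep dx) (to_sep dy) = to_sep (domD dx dy).
Proof.
apply/to_sep_eq; rewrite opprD addrACA.
have dbx := domB (rep_dom (to_sep dx)) dx.
have dby := domB (rep_dom (to_sep dy)) dy.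
apply/eqP; rewrite eq_le semi_ge0 ?andbT; last exact: domD.
by rewrite (le_trans (semiD dbx dby))// !to_sepK addr0.
Qed.

Lemma to_sepZ a x (dx : dom E x) : sep_scale a (to_sep dx) = to_sep (domZ a dx).
Proof.
apply/to_sep_eq; rewrite -scalerBr semiZ ?to_sepK ?mulr0//.
exact: (domB (rep_dom _) dx).
Qed.

Lemma sep_addA : associative sep_add.
Proof.
move=> a b c; rewrite -(repK a) -(repK b) -(repK c) !to_sepD.
by apply: to_sep_ext; rewrite addrA.
Qed.

Lemma sep_addC : commutative sep_add.
Proof. by move=> a b; apply: to_sep_ext; rewrite addrC. Qed.

Lemma sep_add0 : left_id sep_zero sep_add.
Proof.
move=> a; rewrite -(repK a) to_sepD.
by apply: to_sep_ext; rewrite add0r.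
Qed.

Lemma sep_addN : left_inverse sep_zero sep_opp sep_add.
Proof.
move=> a; rewrite -[X in sep_add _ X]repK to_sepD.
by apply: to_sep_ext; rewrite addNr.
Qed.

HB.instance Definition _ := GRing.isZmodule.Build sep
  sep_addA sep_addC sep_add0 sep_addN.

Lemma sep_scaleA a b c : sep_scale a (sep_scale b c) = sep_scale (a * b) c.
Proof. by rewrite to_sepZ; apply: to_sep_ext; rewrite scalerA. Qed.

Lemma sep_scale1 : left_id 1 sep_scale.
Proof. by move=> c; rewrite -[RHS]repK; apply: to_sep_ext; rewrite scale1r. Qed.

Lemma sep_scaleDr : right_distributive sep_scale +%R.
Proof.
move=> a b c; rewrite /GRing.add /= to_sepZ to_sepD.
by apply: to_sep_ext; rewrite scalerDr.
Qed.

Lemma sep_scaleDl c : {morph sep_scale^~ c : a b / a + b}.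
Proof.
move=> a b; rewrite [RHS]/GRing.add /= to_sepD.
by apply: to_sep_ext; rewrite scalerDl.
Qed.

HB.instance Definition _ := GRing.Zmodule_isLmodule.Build R sep
  sep_scaleA sep_scale1 sep_scaleDr sep_scaleDl.

Definition sep_norm (c : sep) : R := semi E (rep c).

Lemma sep_normD (c c' : sep) : sep_norm (c + c') <= sep_norm c + sep_norm c'.
Proof. by rewrite /sep_norm semi_rep; apply: semiD; exact: rep_dom. Qed.

Lemma sep_normZ a (c : sep) : sep_norm (a *: c) = `|a| * sep_norm c.
Proof. by rewrite /sep_norm semi_rep semiZ//; exact: rep_dom. Qed.

Lemma sep_norm0_eq0 (c : sep) : sep_norm c = 0 -> c = 0.
Proof.
by move=> c0; rewrite -(repK c); apply/to_sep_eq; rewrite subr0.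
Qed.

HB.instance Definition _ :=
  Lmodule_isNormed.Build R sep sep_normD sep_normZ sep_norm0_eq0.

End separation.

Lemma sep_normE (R : realType) (V : lmodType R) (E : seminormed V) (c : sep E) :
  `|c| = semi E (rep c).
Proof. by []. Qed.

Section continuous_functions.
Context (R : realType) (E : normedModType R) (T : R).

(* Functions are defined on the whole line; only their restriction to [0,T]
   matters, and the quotient forgets the other values. *)
Definition cont_dom : set (R -> E) := [set f | {within `[0, T], continuous f}].

Definition cont_semi (f : R -> E) : R := sup [set `|f t| | t in `[0, T]].

Lemma cont_dom0 : cont_dom 0.
Proof. by move=> x; exact: cvg_cst. Qed.

Lemma cont_domP a f g : cont_dom f -> cont_dom g -> cont_dom (a *: f + g).
Proof.
move=> cf cg x; apply: cvgD; last exact: cg.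
by apply: cvgZl_tmp; exact: cf.
Qed.

Lemma cont_semi_has_sup f : cont_dom f -> 0 <= T ->
  has_sup [set `|f t| | t in `[0, T]].
Proof.
move=> cf T0; split; first by exists `|f 0|, 0 => //=; rewrite in_itv/= lexx.
have cnf : {within `[0, T], continuous (fun t => `|f t|)}.
  by move=> x; apply: cvg_norm; exact: cf.
have /compact_bounded[M [Mr MP]] := continuous_compact cnf (@segment_compact R 0 T).
exists (M + 1) => _ [t t0T <-].
have := MP (M + 1); rewrite ltrDl ltr01 => /(_ isT `|f t|).
by rewrite /globally /= normr_id; apply; exists t.
Qed.

Lemma cont_semi_ub f t : cont_dom f -> 0 <= t <= T -> `|f t| <= cont_semi f.
Proof.
move=> cf t0T; apply: ub_le_sup; last by exists t => //=; rewrite in_itv.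
have T0 : 0 <= T by case/andP: t0T; exact: le_trans.
by have [] := cont_semi_has_sup cf T0.
Qed.

Lemma cont_semi_ge0 f : cont_dom f -> 0 <= cont_semi f.
Proof.
move=> cf; have [T0|T0] := leP 0 T.
  by apply: le_trans (normr_ge0 (f 0)) (cont_semi_ub cf _); rewrite lexx.
rewrite /cont_semi [X in sup X](_ : _ = set0) ?sup0//.
by rewrite -subset0 => y [t /=]; rewrite in_itv/= => /andP[? ?] _; lra.
Qed.

Lemma cont_semi_le f M : 0 <= M ->
  (forall t, 0 <= t <= T -> `|f t| <= M) -> cont_semi f <= M.
Proof.
move=> M0 fM; rewrite /cont_semi.
have [->|/set0P ne] := eqVneq [set `|f t| | t in `[0, T]] set0; first by rewrite sup0.
by apply: ge_sup => // _ [t /= t0T <-]; apply: fM; rewrite in_itv in t0T.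
Qed.

Lemma cont_semiD f g : cont_dom f -> cont_dom g ->
  cont_semi (f + g) <= cont_semi f + cont_semi g.
Proof.
move=> cf cg; apply: cont_semi_le => [|t t0T].
  by rewrite addr_ge0 ?cont_semi_ge0.
by rewrite (le_trans (ler_normD _ _))// lerD ?cont_semi_ub.
Qed.

Lemma cont_semiZ_le a f : cont_dom f -> cont_semi (a *: f) <= `|a| * cont_semi f.
Proof.
move=> cf; apply: cont_semi_le => [|t t0T].
  by rewrite mulr_ge0 ?cont_semi_ge0.
by rewrite normrZ ler_wpM2l ?cont_semi_ub.
Qed.

Lemma cont_semiZ a f : cont_dom f -> cont_semi (a *: f) = `|a| * cont_semi f.
Proof.
move=> cf; have cZ b : cont_dom (b *: f).
  by rewrite -[_ *: _]addr0; apply: cont_domP => //; exact: cont_dom0.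
apply/eqP; rewrite eq_le cont_semiZ_le//=.
have [->|a0] := eqVneq a 0; first by rewrite normr0 mul0r cont_semi_ge0.
rewrite -ler_pdivlMl ?normr_gt0// -normfV.
rewrite -[X in cont_semi X <= _](_ : a^-1 *: (a *: f) = f) ?cont_semiZ_le//.
by rewrite scalerA mulVf// scale1r.
Qed.

Definition cont_seminormed :=
  Seminormed cont_dom0 cont_domP cont_semiD cont_semiZ.

Definition cont_space := sep cont_seminormed.

End continuous_functions.

Section bounded_operators.
Context (R : realType) (V W : normedModType R).

Definition op_dom : set (V -> W) :=
  [set f | linear f /\ exists M, forall x, `|f x| <= M * `|x|].

Definition op_semi (f : V -> W) : R := sup [set `|f x| | x in [set x | `|x| <= 1]].

Lemma op_dom0 : op_dom 0.
Proof.
split; first by move=> a x y; rewrite /= scaler0 addr0.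
by exists 0 => x; rewrite normr0 mul0r.
Qed.

Lemma op_domP a f g : op_dom f -> op_dom g -> op_dom (a *: f + g).
Proof.
move=> [lf [M fM]] [lg [N gN]]; split=> [b x y|].
  rewrite !fctE lf lg !scalerDr !scalerA [b * a]mulrC.
  by rewrite addrACA.
exists (`|a| * M + N) => x; rewrite (le_trans (ler_normD _ _))// mulrDl lerD//.
by rewrite normrZ -mulrA ler_wpM2l.
Qed.

Lemma op_semi_has_sup f : op_dom f ->
  has_sup [set `|f x| | x in [set x | `|x| <= 1]].
Proof.
move=> [_ [M fM]]; split; first by exists `|f 0|, 0 => //=; rewrite normr0.
exists `|M| => _ [x /= x1 <-]; rewrite (le_trans (fM x))//.
rewrite (@le_trans _ _ (`|M| * `|x|))//; first by rewrite ler_wpM2r// ler_norm.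
by rewrite ler_piMr.
Qed.

Lemma op_semi_ub f x : op_dom f -> `|x| <= 1 -> `|f x| <= op_semi f.
Proof.
move=> df x1; apply: ub_le_sup; last by exists x.
by have [] := op_semi_has_sup df.
Qed.

Lemma op_semi_ge0 f : op_dom f -> 0 <= op_semi f.
Proof.
move=> df; apply: le_trans (normr_ge0 (f 0)) (op_semi_ub df _).
by rewrite normr0.
Qed.

Lemma op_semi_le f M : (forall x, `|x| <= 1 -> `|f x| <= M) -> op_semi f <= M.
Proof.
move=> fM; apply: ge_sup; first by exists `|f 0|, 0 => //=; rewrite normr0.
by move=> _ [x /= x1 <-]; exact: fM.
Qed.

Lemma op_semiD f g : op_dom f -> op_dom g ->
  op_semi (f + g) <= op_semi f + op_semi g.
Proof.
move=> df dg; apply: op_semi_le => x x1.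
by rewrite (le_trans (ler_normD _ _))// lerD ?op_semi_ub.
Qed.

Lemma op_semiZ_le a f : op_dom f -> op_semi (a *: f) <= `|a| * op_semi f.
Proof.
move=> df; apply: op_semi_le => x x1.
by rewrite normrZ ler_wpM2l ?op_semi_ub.
Qed.

Lemma op_semiZ a f : op_dom f -> op_semi (a *: f) = `|a| * op_semi f.
Proof.
move=> df; have dZ b : op_dom (b *: f).
  by rewrite -[_ *: _]addr0; apply: op_domP => //; exact: op_dom0.
apply/eqP; rewrite eq_le op_semiZ_le//=.
have [->|a0] := eqVneq a 0; first by rewrite normr0 mul0r op_semi_ge0.
rewrite -ler_pdivlMl ?normr_gt0// -normfV.
rewrite -[X in op_semi X <= _](_ : a^-1 *: (a *: f) = f) ?op_semiZ_le//.
by rewrite scalerA mulVf// scale1r.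
Qed.

Definition op_seminormed := Seminormed op_dom0 op_domP op_semiD op_semiZ.

(* The operator norm separates points, so the classes are singletons and
   [rep] returns the operator itself. *)
Definition op_space := sep op_seminormed.

End bounded_operators.

Fixpoint class_C (R : realType) (n : nat) (V W : normedModType R)
    (U : set V) (f : V -> W) : Prop :=
  match n with
  | 0 => forall x, U x -> {for x, continuous f}
  | m.+1 => exists df : V -> op_space V W,
      (forall x, U x -> is_diff x f (rep (df x))) /\ class_C m U df
  end.
Arguments class_C {R} n {V W} U f.

Section bochner.
Context (R : realType) (d : measure_display) (Omega : measurableType d).

Definition simple_map (E : Type) (s : Omega -> E) :=
  finite_set (range s) /\ forall e, measurable (s @^-1` [set e]).

Lemma simple_map_preimage (E : Type) (s : Omega -> E) (Y : set E) :
  simple_map s -> measurable (s @^-1` Y).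
Proof.
move=> [fs ms].
rewrite (_ : s @^-1` Y = \bigcup_(e in range s `&` Y) s @^-1` [set e]).
  by apply: fin_bigcup_measurable => [|e _]; [exact: finite_setIl|exact: ms].
apply/seteqP; split => [w Yw|w [e [_ Ye] /= ->//]].
by exists (s w) => //; split=> //; exists w.
Qed.

Lemma simple_map2 (E F G : Type) (s : Omega -> E) (t : Omega -> F)
    (g : E -> F -> G) :
  simple_map s -> simple_map t -> simple_map (fun w => g (s w) (t w)).
Proof.
move=> ss st; have [fs _] := ss; have [ft _] := st; split=> [|e].
  apply: (@sub_finite_set _ _ ((fun p => g p.1 p.2) @` (range s `*` range t))).
    by move=> _ [w _ <-]; exists (s w, t w) => //; split; exists w.
  by apply: finite_image; exact: finite_setX.
rewrite (_ : _ @^-1` _ =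
  \bigcup_(a in range s) (s @^-1` [set a] `&` t @^-1` [set b | g a b = e])).
  apply: fin_bigcup_measurable => // a _.
  by apply: measurableI; exact: simple_map_preimage.
apply/seteqP; split => [w /= we|w [a _ [/= -> //]]].
by exists (s w) => //; exists w.
Qed.

Lemma simple_map_measurable (s : Omega -> R) : simple_map s -> measurable_fun setT s.
Proof. by move=> ss _ Y mY; rewrite setTI; exact: simple_map_preimage. Qed.

Variable E : normedModType R.

Definition strongly_measurable (f : Omega -> E) :=
  exists s : nat -> Omega -> E,
    (forall n, simple_map (s n)) /\ forall w, s ^~ w @ \oo --> f w.

Lemma strongly_measurable0 : strongly_measurable 0.
Proof.
exists (fun _ => 0); split=> [_|w]; last exact: cvg_cst.
split=> [|e].
  by apply: (@sub_finite_set _ _ [set 0]) => // _ [w _ <-].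
have [->|e0] := pselect (e = 0).
  by rewrite (_ : _ @^-1` _ = setT) //; apply/seteqP.
rewrite (_ : _ @^-1` _ = set0) //; apply/seteqP; split=> // w /= h.
by apply: e0; rewrite -h.
Qed.

Lemma strongly_measurableP a f g : strongly_measurable f ->
  strongly_measurable g -> strongly_measurable (a *: f + g).
Proof.
move=> [s [ss sf]] [t [st tg]]; exists (fun n => a *: s n + t n); split=> [n|w].
  exact: (simple_map2 (fun x y => a *: x + y) (ss n) (st n)).
by apply: cvgD; [exact: cvgZl_tmp (sf w)|exact: tg].
Qed.

Lemma strongly_measurable_norm f : strongly_measurable f ->
  measurable_fun setT (fun w => `|f w|).
Proof.
move=> [s [ss sf]]; apply: (@measurable_fun_cvg _ _ _ _ (fun n w => `|s n w|)).
  move=> n; apply: simple_map_measurable.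
  exact: (simple_map2 (fun x _ => `|x|) (ss n) (ss n)).
by move=> w _; exact: cvg_norm (sf w).
Qed.

Variable P : probability Omega R.

Definition L1_dom : set (Omega -> E) := [set f | strongly_measurable f /\
  P.-integrable setT (fun w => (`|f w|)%:E)].

Definition L1_semi (f : Omega -> E) : R := \int[P]_w `|f w|.

Lemma L1_dom0 : L1_dom 0.
Proof.
split; first exact: strongly_measurable0.
apply: (eq_integrable _ (cst 0%E)) => //; last exact: integrable0.
by move=> w _; rewrite /= normr0.
Qed.

Lemma L1_domZ a f : L1_dom f -> L1_dom (a *: f).
Proof.
move=> [mf If]; split.
  rewrite -[_ *: _]addr0; apply: strongly_measurableP => //.
  exact: strongly_measurable0.
apply: (eq_integrable _ (fun w => (`|a|%:E * (`|f w|)%:E)%E)) => //.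
  by move=> w _; rewrite /= normrZ EFinM.
exact: integrableZl.
Qed.

Lemma L1_domP a f g : L1_dom f -> L1_dom g -> L1_dom (a *: f + g).
Proof.
move=> df [mg Ig]; have [maf Iaf] := L1_domZ a df.
have m : strongly_measurable (a *: f + g).
  by case: df => mf _; exact: strongly_measurableP.
split=> //.
apply: (le_integrable _ _ _ (integrableD _ Iaf Ig)) => //.
  by apply/measurable_EFinP; exact: strongly_measurable_norm.
move=> w _; rewrite -EFinD !abse_EFin lee_fin !ger0_norm// ?addr_ge0//.
exact: ler_normD.
Qed.

Lemma L1_semiD f g : L1_dom f -> L1_dom g ->
  L1_semi (f + g) <= L1_semi f + L1_semi g.
Proof.
move=> df dg; have dfg : L1_dom (f + g).
  by rewrite -[f]scale1r; exact: L1_domP.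
case: df dg dfg => [_ If] [_ Ig] [_ Ifg].
rewrite /L1_semi -RintegralD//; apply: le_Rintegral => //; last first.
  by move=> w _; exact: ler_normD.
exact: (integrableD measurableT If Ig).
Qed.

Lemma L1_semiZ a f : L1_dom f -> L1_semi (a *: f) = `|a| * L1_semi f.
Proof.
move=> [_ If]; rewrite /L1_semi -RintegralZl//.
by apply: eq_Rintegral => w _; rewrite normrZ.
Qed.

Definition L1_seminormed := Seminormed L1_dom0 L1_domP L1_semiD L1_semiZ.

Definition L1_space := sep L1_seminormed.

End bochner.

Section torus.
Context (R : realType).
Local Notation mu := (@lebesgue_measure R).
Local Notation C := (Rcomplex R).
Local Notation period := (`[0 : R, 2 * pi]%classic).

Definition cmeasurable (f : R -> C) :=
  measurable_fun setT (fun x => complex.Re (f x)) /\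
  measurable_fun setT (fun x => complex.Im (f x)).

Lemma Rcomplex_normE (z : C) :
  `|z| = Num.sqrt (complex.Re z ^+ 2 + complex.Im z ^+ 2).
Proof. by case: z. Qed.

Lemma cmeasurableP (a : R) f g :
  cmeasurable f -> cmeasurable g -> cmeasurable (a *: f + g).
Proof.
move=> [mf nf] [mg ng]; split.
  apply: (eq_measurable_fun (fun x => a * complex.Re (f x) + complex.Re (g x))).
    by move=> x _; rewrite !fctE; case: (f x) (g x) => ? ? [].
  by apply: measurable_funD => //; exact: measurable_funM.
apply: (eq_measurable_fun (fun x => a * complex.Im (f x) + complex.Im (g x))).
  by move=> x _; rewrite !fctE; case: (f x) (g x) => ? ? [].
by apply: measurable_funD => //; exact: measurable_funM.
Qed.

Lemma cmeasurable_norm f : cmeasurable f -> measurable_fun setT (fun x => `|f x|).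
Proof.
move=> [mf nf]; under eq_fun do rewrite Rcomplex_normE.
apply: measurableT_comp; first by apply: continuous_measurable_fun; exact: sqrt_continuous.
by apply: measurable_funD; exact: measurable_funX.
Qed.

(* Functions on the torus are the 2pi-periodic functions on the line. Values are
   taken in [Rcomplex], whose scalars are real: $L^2$ is a real normed space. *)
Definition L2_dom : set (R -> C) := [set f | [/\ forall x, f (x + 2 * pi) = f x,
  cmeasurable f & mu.-integrable period (fun x => (`|f x| ^+ 2)%:E)]].

Definition L2_semi (f : R -> C) : R :=
  Num.sqrt (\int[mu]_(x in period) (`|f x| ^+ 2)).

Lemma normZ2 (a : R) (z : C) : `|a *: z| ^+ 2 = a ^+ 2 * `|z| ^+ 2.
Proof.
rewrite !Rcomplex_normE !sqr_sqrtr ?addr_ge0 ?sqr_ge0//.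
by case: z => x y /=; ring.
Qed.

Lemma L2_dom0 : L2_dom 0.
Proof.
split=> //.
rewrite [X in _.-integrable _ X](_ : _ = cst 0%E); first exact: integrable0.
by apply/funext => x; rewrite normr0 expr0n.
Qed.

Lemma L2_domZ a f : L2_dom f -> L2_dom (a *: f).
Proof.
move=> [pf mf If]; split.
- by move=> x; rewrite !fctE pf.
- rewrite -[_ *: _]addr0; apply: cmeasurableP => //.
- rewrite [X in _.-integrable _ X](_ : _ =
      fun x => ((a ^+ 2)%:E * (`|f x| ^+ 2)%:E)%E); first exact: integrableZl.
  by apply/funext => x; rewrite normZ2 EFinM.
Qed.

Lemma sqnormD (e : R) (z w : C) : 0 < e ->
  `|z + w| ^+ 2 <= (1 + e) * `|z| ^+ 2 + (1 + e^-1) * `|w| ^+ 2.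
Proof.
move=> e0; apply: (@le_trans _ _ ((`|z| + `|w|) ^+ 2)).
  by rewrite ler_pXn2r// ?nnegrE ?addr_ge0// ler_normD.
rewrite -subr_ge0 (_ : _ - _ = e^-1 * (e * `|z| - `|w|) ^+ 2).
  by apply: mulr_ge0; [rewrite invr_ge0 ltW|exact: sqr_ge0].
by field; rewrite gt_eqF.
Qed.

Lemma L2_domD f g : L2_dom f -> L2_dom g -> L2_dom (f + g).
Proof.
move=> [pf mf If] [pg mg Ig].
have m : cmeasurable (f + g) by rewrite -[f]scale1r; exact: cmeasurableP.
split=> //; first by move=> x; rewrite !fctE pf pg.
have I2 : mu.-integrable period (fun x => (2%:E * (`|f x| ^+ 2)%:E +
    2%:E * (`|g x| ^+ 2)%:E)%E).
  by apply: integrableD => //; exact: integrableZl.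
apply: (le_integrable _ _ _ I2) => //.
  apply/measurable_EFinP; apply: measurable_funTS.
  by apply: measurable_funX; exact: cmeasurable_norm.
move=> x _; rewrite -!EFinM -EFinD !abse_EFin lee_fin.
rewrite [leLHS]ger0_norm ?sqr_ge0// (le_trans _ (ler_norm _))//.
by have := @sqnormD 1 (f x) (g x) ltr01; rewrite invr1.
Qed.

Lemma L2_domP a f g : L2_dom f -> L2_dom g -> L2_dom (a *: f + g).
Proof. by move=> df dg; apply: L2_domD => //; exact: L2_domZ. Qed.

Lemma L2_semiZ a f : L2_dom f -> L2_semi (a *: f) = `|a| * L2_semi f.
Proof.
move=> [_ _ If]; rewrite /L2_semi -sqrtr_sqr -sqrtrM ?sqr_ge0// -RintegralZl//.
by congr Num.sqrt; apply: eq_Rintegral => x _; exact: normZ2.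
Qed.

Lemma sqrt_minkowski (a b c : R) : 0 <= a -> 0 <= b ->
  (forall e, 0 < e -> c <= (1 + e) * a + (1 + e^-1) * b) ->
  Num.sqrt c <= Num.sqrt a + Num.sqrt b.
Proof.
move=> a0 b0 h; have [c0|c0] := leP c 0.
  by rewrite ler0_sqrtr// addr_ge0 ?sqrtr_ge0.
have sa := sqr_sqrtr a0; have sb := sqr_sqrtr b0.
move: (sqrtr_ge0 a) (sqrtr_ge0 b) sa sb.
set x := Num.sqrt a; set y := Num.sqrt b => x0 y0 sa sb.
suff cxy : c <= (x + y) ^+ 2.
  by rewrite -(ger0_norm (addr_ge0 x0 y0)) -sqrtr_sqr ler_wsqrtr.
apply/ler_addgt0Pr => e e0.
pose D := e / (x + y + 1).
have s0 : 0 < x + y + 1 by lra.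
have D0 : 0 < D by rewrite divr_gt0.
have xD : 0 < x + D by lra.
have yD : 0 < y + D by lra.
have := h ((y + D) / (x + D)) (divr_gt0 yD xD).
rewrite invf_div -sa -sb => /le_trans; apply.
have h1 : (y + D) / (x + D) * x ^+ 2 <= x * (y + D).
  rewrite mulrAC ler_pdivrMr// -subr_ge0 (_ : _ - _ = x * (y + D) * D); last by ring.
  by apply: mulr_ge0; [apply: mulr_ge0|]; lra.
have h2 : (x + D) / (y + D) * y ^+ 2 <= y * (x + D).
  rewrite mulrAC ler_pdivrMr// -subr_ge0 (_ : _ - _ = y * (x + D) * D); last by ring.
  by apply: mulr_ge0; [apply: mulr_ge0|]; lra.
have h3 : D * (x + y) <= e.
  by rewrite /D mulrAC ler_pdivrMr// ler_pM2l//; lra.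
rewrite !mulrDl !mul1r; nra.
Qed.

Lemma L2_semiD f g : L2_dom f -> L2_dom g ->
  L2_semi (f + g) <= L2_semi f + L2_semi g.
Proof.
move=> df dg; have [_ _ Ifg] := L2_domD df dg.
case: df dg => [_ _ If] [_ _ Ig].
have ge0 (h : R -> C) : 0 <= \int[mu]_(x in period) (`|h x| ^+ 2).
  by apply: fine_ge0; apply: integral_ge0 => x _; rewrite lee_fin sqr_ge0.
apply: sqrt_minkowski => // e e0.
have mp : measurable (period : set (measurableTypeR R)) by exact: measurable_itv.
have If' := integrableZl mp (1 + e) If.
have Ig' := integrableZl mp (1 + e^-1) Ig.
rewrite -!RintegralZl// -RintegralD//; apply: le_Rintegral => //.
  exact: (integrableD mp If' Ig').
by move=> x _; exact: sqnormD.
Qed.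

Definition L2_seminormed := Seminormed L2_dom0 L2_domP L2_semiD L2_semiZ.

Definition L2_torus := sep L2_seminormed.

End torus.

(* The second argument of [normal_prob] is the standard deviation. *)
Definition brownian_motion (R : realType) (d : measure_display)
    (Omega : measurableType d) (P : probability Omega R)
    (W : R -> Omega -> R) : Prop :=
  [/\ forall t, 0 <= t -> measurable_fun setT (W t),
      {ae P, forall w, W 0 w = 0},
      forall s t, 0 <= s -> s < t ->
        forall B : set (measurableTypeR R), measurable B ->
          P [set w | B (W t w - W s w)] = normal_prob 0 (Num.sqrt (t - s)) B,
      forall (n : nat) (t : nat -> R) (B : nat -> set (measurableTypeR R)),
        0 <= t 0%N -> (forall i, t i <= t i.+1) -> (forall i, measurable (B i)) ->
        P (\bigcap_(i in `I_n) [set w | B i (W (t i.+1) w - W (t i) w)]) =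
        (\prod_(i < n) P [set w | B i (W (t i.+1) w - W (t i) w)%R])%E &
      {ae P, forall w, {within `[0, +oo[, continuous (W ^~ w)}}].

Section equation.
Context (R : realType).
Local Notation mu := (@lebesgue_measure R).
Local Notation C := (Rcomplex R).
Local Notation seg a := (`[0%R, a%R]%classic).

Definition cintegral (D : set R) (f : R -> C) : C :=
  Complex (\int[mu]_(x in D) complex.Re (f x)) (\int[mu]_(x in D) complex.Im (f x)).

Definition cis (r : R) : C := Complex (cos r) (sin r).

Definition fourier_coef (f : R -> C) (k : int) : C :=
  (2 * pi)^-1 *: cintegral (seg (2 * pi)) (fun x => cis (- (k%:~R * x)) * f x).

(* The symbol of $e^{-ir\Delta}$, acting on Fourier coefficients. *)
Definition propagator (r : R) (k : int) : C := cis (k%:~R ^+ 2 * r).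

Definition quintic (z : C) : C := `|z| ^+ 4 *: z.

(* Duhamel's formula along one Brownian path [W], for a path [u] in
   $C([0,T];L^2)$. The integral is taken in the sense of distributions, that is
   Fourier coefficient by Fourier coefficient: since elements of $L^2$ need not
   have their fifth power integrable, the first clause asks that
   $|u|^4u \in L^1([0,T]\times\mathbb T)$, the least that gives every
   coefficient a meaning. *)
Definition mild_path (T : R) (W : R -> R) (u0 : L2_torus R)
    (u : R -> L2_torus R) : Prop :=
  (\int[mu]_(s in seg T) \int[mu]_(x in seg (2 * pi))
      (`|quintic (rep (u s) x)|)%:E < +oo)%E /\
  forall (t : R) (k : int), 0 <= t <= T ->
    fourier_coef (rep (u t)) k =
      propagator (W t) k * fourier_coef (rep u0) k
      - 'i%C * cintegral (seg t) (fun s =>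
          propagator (W t - W s) k * fourier_coef (quintic \o rep (u s)) k).

Context (d : measure_display) (Omega : measurableType d).
Variables (P : probability Omega R) (T : R).

Definition solution_space := L1_space (cont_space (L2_torus R) T) P.

Definition sample_path (u : solution_space) (w : Omega) : R -> L2_torus R := rep (rep u w).

Definition mild_solution (W : R -> Omega -> R) (u0 : L2_torus R)
    (u : solution_space) : Prop :=
  {ae P, forall w, mild_path T (W ^~ w) u0 (sample_path u w)}.

Definition bounded_process (u : solution_space) : Prop :=
  exists M : R, {ae P, forall w, forall t, 0 <= t <= T ->
    {ae mu, forall x, `|rep (sample_path u w t) x| <= M}}.

(* [S] is the data-to-solution map on [U]: existence of a mild solution, and
   uniqueness within a class [X] of processes. Nothing is asked of [X] except
   that bounded mild solutions belong to it; [X := setT] is unconditional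
   uniqueness. *)
Definition solution_map (W : R -> Omega -> R) (U : set (L2_torus R))
    (S : L2_torus R -> solution_space) : Prop :=
  exists X : set solution_space,
    (forall u0 u, U u0 -> mild_solution W u0 u -> bounded_process u -> X u) /\
    (forall u0, U u0 -> [/\ X (S u0), mild_solution W u0 (S u0) &
       forall u, X u -> mild_solution W u0 u -> u = S u0]).

End equation.

(* Main.v *)
From HB Require Import structures.
Require Import Defs.
From mathcomp Require Import all_boot all_order all_algebra.
From mathcomp Require Import all_classical all_reals all_analysis.
From mathcomp Require Import measurable_realfun complex.
From mathcomp Require Import ring lra zify.
Import Order.TTheory GRing.Theory Num.Theory.
Import numFieldNormedType.Exports.
Local Open Scope classical_set_scope.
Local Open Scope ring_scope.
Set Implicit Arguments.
Unset Strict Implicit.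
Unset Printing Implicit Defensive.

(** The map S fails to be of class C^5 because its fifth order behaviour at 0,
in the direction of the datum phi_n = sum_(k < n) e^(ikx), outgrows |phi_n|^5 as
n tends to infinity.

Fifth differences. If S is C^5 near 0, then the fifth difference of S at 0 with
step h, tested against any bounded linear functional l, is at most C |l| |h|^5
with C independent of l and h (fdiff_bound).

Solutions. For a trigonometric datum e phi_n with e small, depending on n, a
solution is obtained by Picard iteration for the l^1 norm of the Fourier
amplitudes. The propagator preserves that norm whatever the path is, so the
iteration runs path by path, uniformly over all continuous paths
(picard_bound). The limit depends on the path in a uniformly continuous way,
which gives measurability in omega (strongly_measurable_path). It is bounded, so
it lies in the uniqueness class and is S (e phi_n) (solution_map_profile).

The functional. Let U(y) = sum_(k < n) e^(i k^2 y) e^(ikx), so that e U(W_t) is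
the linear evolution of e phi_n. The final value u(T) is paired with U(W_T), and
minus the expectation of the imaginary part is taken (observation); this
functional has norm at most (n / (2 pi))^(1/2) (imag_pairing_bnd). Applied to
S (e phi_n) it loses the linear part, whose pairing is real, and keeps e^5 q_n
with
  q_n = E int_0^T (2 pi)^-1 int |U(W_s)|^6 dx ds,
up to an error O_n(e^9) (imag_pairing_expansion, observation_expansion). Its
fifth difference is therefore 120 e^5 q_n + O_n(e^9), and letting e tend to 0
gives 120 q_n <= C (n / (2 pi))^(1/2) |phi_n|^5 = C (2 pi)^2 n^3
(expected_sextic_bound).

Growth of q_n. For s in [T/2, T] the law of W_s has a density bounded below on
[0, 2 pi], so that the expectation at time s is at least a constant times the
integral of |U(y)|^6 over a full period in y and x. By orthogonality in both
variables this integral counts the solutions in [0, n)^6 of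
  a1 + a2 + a3 = b1 + b2 + b3,  a1^2 + a2^2 + a3^2 = b1^2 + b2^2 + b3^2
(sextic_integral, expected_path_sextic). There are of the order of n^3 log n of
them; that their number divided by n^3 is unbounded (resonances_unbounded)
contradicts the bound on q_n. *)

Lemma ler_eq (R : realType) (x y : R) : x = y -> x <= y.
Proof. by move=> ->. Qed.

(** * Finite differences of C^m maps *)

Section op_eval.
Context (R : realType) (V W : normedModType R).
Implicit Types (A B : op_space V W).

(** Equality in the space of operators gives equality of the representatives on
the unit ball, where the operator seminorm takes its supremum; linearity extends
it to the whole space. *)
Lemma op_repD A B x : rep (A + B) x = rep A x + rep B x.
Proof.
have dA := rep_dom A; have dB := rep_dom B; have dAB := rep_dom (A + B).
have d : dom (op_seminormed V W) (rep (A + B) - (rep A + rep B)).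
  by apply: domB => //; apply: domD.
have e : semi (op_seminormed V W) (rep (A + B) - (rep A + rep B)) = 0.
  exact: to_sepK.
have z y : `|y| <= 1 -> rep (A + B) y = rep A y + rep B y.
  move=> y1; apply/eqP; rewrite -subr_eq0 -normr_le0 -[leRHS]e.
  exact: (op_semi_ub d).
have [x0|x0] := eqVneq x 0.
  by apply: z; rewrite x0 normr0.
have lin (f : V -> W) : dom (op_seminormed V W) f ->
    f x = `|x| *: f (`|x|^-1 *: x).
  move=> [lf _]; have := lf `|x| (`|x|^-1 *: x) 0.
  have f0 : f 0 = 0.
    by have := lf (-1) 0 0; rewrite scaler0 addr0 scaleN1r addNr.
  by rewrite !addr0 f0 addr0 scalerA divff ?scale1r// normr_eq0.
rewrite (lin _ dA) (lin _ dB) (lin _ dAB) -scalerDr z//.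
by rewrite normrZ normfV normr_id mulVf// normr_eq0.
Qed.

Lemma op_rep_linear A a x y : rep A (a *: x + y) = a *: rep A x + rep A y.
Proof. by have [lA _] := rep_dom A; rewrite lA. Qed.

Lemma op_rep0 A : rep A 0 = 0.
Proof. by have := op_rep_linear A (-1) 0 0; rewrite scaler0 addr0 scaleN1r addNr. Qed.

Lemma op_repZ a A x : rep (a *: A) x = a *: rep A x.
Proof.
have dA := rep_dom A; have daA := rep_dom (a *: A).
have d : dom (op_seminormed V W) (rep (a *: A) - a *: rep A).
  by apply: domB => //; apply: domZ.
have e : semi (op_seminormed V W) (rep (a *: A) - a *: rep A) = 0.
  exact: to_sepK.
have z y : `|y| <= 1 -> rep (a *: A) y = a *: rep A y.
  move=> y1; apply/eqP; rewrite -subr_eq0 -normr_le0 -[leRHS]e.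
  exact: (op_semi_ub d).
have [x0|x0] := eqVneq x 0.
  by apply: z; rewrite x0 normr0.
have xE : x = `|x| *: (`|x|^-1 *: x) + 0.
  by rewrite addr0 scalerA divff ?scale1r// normr_eq0.
rewrite xE !op_rep_linear z; last first.
  by rewrite normrZ normfV normr_id mulVf// normr_eq0.
by rewrite !op_rep0 scalerDr !scalerA scaler0 mulrC.
Qed.

Lemma op_repN A x : rep (- A) x = - rep A x.
Proof. by rewrite -[- A]scaleN1r op_repZ scaleN1r. Qed.

Lemma op_rep_le A x : `|rep A x| <= `|A| * `|x|.
Proof.
have [->|x0] := eqVneq x 0; first by rewrite op_rep0 !normr0 mulr0.
have xE : x = `|x| *: (`|x|^-1 *: x) + 0.
  by rewrite addr0 scalerA divff ?scale1r// normr_eq0.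
rewrite {1}xE op_rep_linear op_rep0 addr0 normrZ normr_id mulrC.
rewrite ler_wpM2r// sep_normE; apply: (op_semi_ub (rep_dom A)).
by rewrite normrZ normfV normr_id mulVf// normr_eq0.
Qed.

End op_eval.

Section finite_differences.
Context (R : realType).

Fixpoint fdiff (V W : lmodType R) (m : nat) (h : V) (f : V -> W) (x : V) : W :=
  if m is m'.+1 then fdiff m' h f (x + h) - fdiff m' h f x else f x.

(** Composition with a bounded functional reduces the differentiability of f along
a line to that of a real function, for which the mean value theorem holds. *)
Lemma is_derive_line (V W : normedModType R) (f D : V -> W) (l : W -> R)
    (L : R) (x k : V) (t : R) :
  linear_for *%R l ->
  (forall y, `|l y| <= L * `|y|) ->
  is_diff (x + t *: k) f D ->
  is_derive t (1 : R) (fun s : R => l (f (x + s *: k)) : R) (l (D k)).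
Proof.
move=> lin lb df.
pose ll : {linear W -> R^o} := HB.pack l (GRing.isLinear.Build R W R^o *:%R l lin).
have cl : continuous ll.
  apply/bounded_linear_continuous/bounded_funP => r.
  exists (`|L| * `|r|) => y yr /=; rewrite (le_trans (lb _))//.
  rewrite (le_trans (ler_norm _))// normrM ler_wpM2l// normr_id.
  by rewrite (le_trans yr)// ler_norm.
have dl : is_diff (f (x + t *: k)) ll ll.
  apply: DiffDef; first exact: linear_differentiable.
  exact: diff_lin.
have ds : is_diff t (fun s : R => x + s *: k) (fun s : R => s *: k).
  rewrite -[X in is_diff _ _ X]add0r; apply: is_diffD.
have df' : is_diff ((fun s : R => x + s *: k) t) f D by [].
have d1 := is_diff_comp ds df'.
have d2 := @is_diff_comp _ _ _ _ _ _ ll ll t d1 dl.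
case: d2 => d2 v2; apply: DeriveDef; first exact: diff_derivable.
by rewrite deriveE// v2 /=; rewrite scale1r.
Qed.

Lemma is_derive_fdiff (V W : normedModType R) (f : V -> W)
    (df : V -> op_space V W) (l : W -> R) (L : R) m (x h k : V) (t : R) :
  linear_for *%R l ->
  (forall y, `|l y| <= L * `|y|) ->
  (forall j, (j <= m)%N ->
    is_diff (x + t *: k + h *+ j) f (rep (df (x + t *: k + h *+ j)))) ->
  is_derive t (1 : R) (fun s : R => l (fdiff m h f (x + s *: k)) : R)
    (l (rep (fdiff m h df (x + t *: k)) k)).
Proof.
move=> lin lb; elim: m x => [|m IH] x dfx.
  apply: (is_derive_line lin lb).
  by have := dfx 0 (leqnn _); rewrite mulr0n addr0.
have lB y z : l (y - z) = l y - l z.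
  by rewrite addrC -scaleN1r lin mulN1r addrC.
have E (s : R) : x + s *: k + h = (x + h) + s *: k by rewrite addrAC.
rewrite /= op_repD op_repN lB.
under eq_fun do rewrite lB E.
rewrite E; apply: is_deriveB; apply: IH => j jm.
  by have := dfx j.+1 jm; rewrite mulrS addrA E.
by apply: dfx; exact: leqW.
Qed.

(** Induction on m. The mean value theorem, applied along the segment from x to
x + h to l of an m-th difference of f, turns one more difference of f into an
m-th difference of the derivative of f, evaluated at h. The derivative has one
order of regularity less, and A |-> l (A h) is a bounded functional on operators
with norm multiplied by |h|: this is why the functional l is quantified after the
constant C. *)
Lemma fdiff_bound (V W : normedModType R) m (U : set V) (f : V -> W) :
  open U -> U 0 -> class_C m U f ->
  exists r C : R, [/\ 0 < r, 0 <= C & forall (l : W -> R) (L : R),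
    linear_for *%R l -> 0 <= L -> (forall y, `|l y| <= L * `|y|) ->
    forall x h, `|x| < r -> `|h| < r ->
      `|l (fdiff m h f x)| <= C * L * `|h| ^+ m].
Proof.
move=> oU U0; elim: m W f => [|m IH] W f Cf.
  have /cvgrPdist_lt /(_ _ ltr01) /nbhs_normP [r /= r0 fr] := Cf 0 U0.
  exists r, (`|f 0| + 1); split=> // l L lin L0 lb x h xr _ /=.
  rewrite expr0 mulr1 (le_trans (lb _))// mulrC ler_wpM2r//.
  have := fr x; rewrite /= sub0r normrN => /(_ xr) fx.
  rewrite -[f x](subKr (f 0)) (le_trans (ler_normB _ _))// lerD2l.
  exact: ltW.
case: Cf => df [dfx /IH [r [C [r0 C0 IHr]]]].
have /nbhs_normP [r' /= r'0 Ur'] := open_nbhs_nbhs (conj oU U0).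
(* the points x + t h + j h, for j <= m and t in [0, 1], stay within distance
   min r r' of 0 *)
pose s := Num.min r r' / m.+2%:R.
have sr : s * m.+2%:R = Num.min r r' by rewrite divfK.
have s0 : 0 < s by rewrite divr_gt0// lt_min r0 r'0.
exists s, C; split=> // l L lin L0 lb x h xs hs.
pose G (t : R) := l (fdiff m h f (x + t *: h)).
pose dG (t : R) := l (rep (fdiff m h df (x + t *: h)) h).
have xt (t : R) (j : nat) : t \in `[0, 1] -> (j <= m)%N ->
    `|x + t *: h + h *+ j| < Num.min r r'.
  rewrite in_itv/= => /andP[t0 t1] jm; rewrite -sr.
  rewrite (le_lt_trans (ler_normD _ _))//.
  apply: (@lt_le_trans _ _ ((s + s) + s * m%:R)); last first.
    by rewrite -addn2 natrD; lra.
  apply: ltr_leD.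
    apply: (le_lt_trans (ler_normD _ _)); apply: ltr_leD => //.
    rewrite normrZ (ger0_norm t0) (@le_trans _ _ (1 * `|h|)) ?ler_wpM2r//.
    by rewrite mul1r ltW.
  rewrite normrMn -[leLHS]mulr_natr.
  apply: ler_pM => //; first exact: ltW.
  by rewrite ler_nat.
have dGt (t : R) : t \in `[0, 1] -> is_derive t (1 : R) (G : R -> R) (dG t).
  move=> t01; apply: (is_derive_fdiff lin lb) => j jm; apply: dfx.
  apply: Ur'; rewrite /= sub0r normrN.
  by rewrite (lt_le_trans (xt _ _ t01 jm))// ge_min lexx orbT.
have h1 : forall t : R, t \in `]0, 1[ -> is_derive t (1 : R) (G : R -> R) (dG t).
  by move=> t t01; apply: dGt; move: t01; rewrite !in_itv/= => /andP[/ltW -> /ltW ->].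
have h2 : {within `[0, 1], continuous (G : R -> R)}.
  apply: derivable_within_continuous => u u01.
  by have [] := dGt u u01.
have [c c01] := MVT_segment ler01 h1 h2.
rewrite subr0 mulr1 => E.
have -> : l (fdiff m.+1 h f x) = G 1 - G 0.
  rewrite /G scale1r scale0r addr0 /=.
  by rewrite addrC -scaleN1r lin mulN1r addrC.
rewrite E /dG; set z := x + _.
have := IHr (fun A => l (rep A h)) (L * `|h|).
rewrite exprSr mulrA => /(_ _ _ _ z h); rewrite !mulrA => H.
rewrite (le_trans (H _ _ _ _ _))//.
- move=> a A B /=; rewrite op_repD op_repZ. exact: lin.
- by rewrite mulr_ge0.
- move=> A; rewrite (le_trans (lb _))// -mulrA ler_wpM2l// mulrC.
  exact: op_rep_le.
- have := xt c 0%N c01 (leq0n _); rewrite mulr0n addr0 => /lt_le_trans; apply.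
  by rewrite ge_min lexx.
- rewrite (lt_le_trans hs)// (@le_trans _ _ (Num.min r r'))//.
    by rewrite -sr ler_peMr ?ltW// ltr1n.
  by rewrite ge_min lexx.
by apply: ler_eq; ring.
Qed.

End finite_differences.

(** * Resonances: sextuples with equal sums and equal sums of squares *)

Section counting.
Local Open Scope set_scope.
Local Open Scope nat_scope.

Definition sum3 n (a : 'I_n * 'I_n * 'I_n) : nat := a.1.1 + a.1.2 + a.2.
Definition sqsum3 n (a : 'I_n * 'I_n * 'I_n) : nat := a.1.1 ^ 2 + a.1.2 ^ 2 + a.2 ^ 2.

Definition resonances n :=
  [set ab : ('I_n * 'I_n * 'I_n) * ('I_n * 'I_n * 'I_n) |
    (sum3 ab.1 == sum3 ab.2) && (sqsum3 ab.1 == sqsum3 ab.2)].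

(** Truncation of Gauss's identity: gcd (x, z) is the sum of the totients of its
divisors, that is, of the common divisors of x and z. *)
Lemma gcd_sum_totient (x z m : nat) : 0 < x -> 0 < z -> 
  gcdn x z >= \sum_(1 <= d < m.+1 | (d %| x) && (d %| z)) totient d.
Proof.
move=> x0 z0; have g0 : 0 < gcdn x z by rewrite gcdn_gt0 x0.
rewrite -[leqRHS]cyclic.sum_totient_dvd -(big_mkord (fun d => d %| gcdn x z)).
under eq_bigl do rewrite -dvdn_gcd.
rewrite [leqRHS]big_mkcond [leqLHS]big_mkcond /=.
rewrite [leqRHS]big_ltn//= -[leqLHS]add0n leq_add//.
have [mg|gm] := leqP m (gcdn x z).
  by rewrite [leqRHS](big_cat_nat _ (n := m.+1))//= leq_addr.
rewrite [leqLHS](big_cat_nat _ (n := (gcdn x z).+1))//=; last by rewrite ltnS ltnW.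
rewrite [X in _ + X]big_nat_cond [X in _ + X]big1 ?addn0//.
move=> i; rewrite andbT => /andP[gi _]; case: ifP => // /(dvdn_leq g0).
by rewrite leqNgt gi.
Qed.

(** Exchange of summations: when d divides M, exactly M / d of the integers from 1
to M are multiples of d. *)
Lemma card_gcd_pairs M m : (forall d, 0 < d <= m -> d %| M) ->
  \sum_(x < M) \sum_(z < M) gcdn x.+1 z.+1 >=
  \sum_(1 <= d < m.+1) totient d * (M %/ d) ^ 2.
Proof.
move=> dM.
have cnt d : 0 < d -> \sum_(x < M | d %| x.+1) 1 = M %/ d.
  move=> d0; rewrite -(big_mkord (fun x => d %| x.+1) (fun=> 1)).
  elim: {dM} M => [|M IH]; first by rewrite big_geq// div0n.
  rewrite big_mkcond big_nat_recr//= -big_mkcond IH.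
  rewrite divnS//. by case: (d %| _); rewrite ?addn0 ?addn1 //=.
apply: (@leq_trans (\sum_(x < M) \sum_(z < M)
   \sum_(1 <= d < m.+1 | (d %| x.+1) && (d %| z.+1)) totient d)); last first.
  by apply: leq_sum => x _; apply: leq_sum => z _; exact: gcd_sum_totient.
under [leqRHS]eq_bigr do (under eq_bigr do rewrite big_mkcond; rewrite exchange_big).
rewrite exchange_big /= big_nat_cond [leqRHS]big_nat_cond leq_sum// => d.
rewrite andbT => /andP[d0 _].
rewrite -(cnt d d0) expnS expn1.
rewrite big_distrlr/= big_distrr/=.
rewrite [X in X <= _]big_mkcond /=; apply: leq_sum => x _.
have [dx|] := boolP (d %| x.+1); last by rewrite leq0n.
rewrite big_distrr/= big_mkcond /=; apply: leq_sum => z _.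
by case: (d %| z.+1) => /=; rewrite ?muln1.
Qed.

Lemma sub_inj M b r x z b' r' x' z' : r <= x -> x <= M -> z <= M -> 2 * M <= b ->
  r' <= x' -> x' <= M -> z' <= M ->
  b - r = b' - r' -> b - x - z = b' - x' - z' -> b - r - z = b' - r' - z' ->
  b = b' -> [/\ z = z', x = x' & r = r'].
Proof. by move=> *; split; lia. Qed.

(** An explicit family of resonances: the triples (b + p - z, b - r, b - x - z) and
(b + p - x - z, b - r - z, b) have equal sums, and their sums of squares differ
by 2 (x p - z r). For x, z in [1, M] with gcd g, the pairs
(p, r) = (j z / g, j x / g) with 1 <= j <= g satisfy x p = z r. Letting b range
over [2 M, 3 M) keeps the six entries in [0, 4 M), and (b, x, z, j) can be read
off from them. *)
Lemma resonances_ge M : 0 < M ->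
  #|resonances (4 * M)| >= M * \sum_(x < M) \sum_(z < M) gcdn x.+1 z.+1.
Proof.
move=> M0.
pose A := [set t : 'I_M * 'I_M * 'I_M * 'I_M |
   t.2 < gcdn t.1.1.2.+1 t.1.2.+1].
have cA : #|A| = M * \sum_(x < M) \sum_(z < M) gcdn x.+1 z.+1.
  rewrite -sum1_card.
  rewrite (eq_bigl (fun t : 'I_M * 'I_M * 'I_M * 'I_M => t.2 < gcdn t.1.1.2.+1 t.1.2.+1)); last by move=> t; rewrite inE.
  rewrite -(pair_big_dep xpredT (fun (t : 'I_M * 'I_M * 'I_M) (j : 'I_M) => j < gcdn t.1.2.+1 t.2.+1) (fun _ _ => 1)) /=.
  rewrite -(pair_big xpredT xpredT (fun (t : 'I_M * 'I_M) (z : 'I_M) => \sum_(j < M | j < gcdn t.2.+1 z.+1) 1)) /=.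
  rewrite -(pair_big xpredT xpredT (fun (b : 'I_M) (x : 'I_M) => \sum_(z < M) \sum_(j < M | j < gcdn x.+1 z.+1) 1)) /=.
  rewrite sum_nat_const card_ord; congr (_ * _).
  apply: eq_bigr => x _; apply: eq_bigr => z _.
  have gM : gcdn x.+1 z.+1 <= M.
    by apply: leq_trans (ltn_ord x); apply: dvdn_leq => //; exact: dvdn_gcdl.
  by rewrite (big_ord_narrow gM) sum1_card card_ord.
rewrite -cA.
(* the entries of F are all less than 4 M, the range where insubd is faithful *)
have N0 : 0 < 4 * M by lia.
pose o (k : nat) : 'I_(4 * M) := insubd (Ordinal N0) k.
pose F (t : 'I_M * 'I_M * 'I_M * 'I_M) :=
  let b := 2 * M + t.1.1.1 in let x := t.1.1.2.+1 in let z := t.1.2.+1 in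
  let g := gcdn x z in
  let p := t.2.+1 * (z %/ g) in let r := t.2.+1 * (x %/ g) in
  ((o (b + p - z), o (b - r), o (b - x - z)),
   (o (b + p - x - z), o (b - r - z), o b)).
have key t : t \in A ->
  let b := 2 * M + t.1.1.1 in let x := t.1.1.2.+1 in let z := t.1.2.+1 in
  let g := gcdn x z in
  let p := t.2.+1 * (z %/ g) in let r := t.2.+1 * (x %/ g) in
  [/\ x * p = z * r, 0 < r <= x, 0 < p <= z & [/\ 2 * M <= b < 3 * M, x <= M, z <= M & 0 < x %/ g]].
  rewrite inE => jg b x z g p r.
  have g0 : 0 < g by rewrite gcdn_gt0.
  have gx : g %| x := dvdn_gcdl x z.
  have gz : g %| z := dvdn_gcdr x z.
  have xg : 0 < x %/ g by rewrite divn_gt0// dvdn_leq.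
  have zg : 0 < z %/ g by rewrite divn_gt0// dvdn_leq.
  have b3 := ltn_ord t.1.1.1; have x3 := ltn_ord t.1.1.2; have z3 := ltn_ord t.1.2.
  split.
  - by rewrite /p /r -{1}(divnK gx) -{2}(divnK gz); ring.
  - rewrite muln_gt0 xg/=; apply: (@leq_trans (g * (x %/ g))).
      by rewrite leq_mul2r; apply/orP; right.
    by rewrite mulnC divnK.
  - rewrite muln_gt0 zg/=; apply: (@leq_trans (g * (z %/ g))).
      by rewrite leq_mul2r; apply/orP; right.
    by rewrite mulnC divnK.
  - by split=> //; rewrite /b; lia.
have oK k : k < 4 * M -> val (o k) = k by move=> kM; rewrite val_insubd kM.
rewrite -(card_in_imset (f := F)).
  apply/subset_leq_card/fintype.subsetP => _ /imsetP[t tA ->].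
  have := key t tA; rewrite /F inE /sum3 /sqsum3 /=.
  set b := 2 * M + _; set x := (t.1.1.2).+1; set z := (t.1.2).+1.
  set p := _ * (z %/ _); set r := _ * (x %/ _).
  case=> xp /andP[r0 rx] /andP[p0 pz] [hb hx hz _].
  case/andP: hb hx hz => b0 b1 xM zM.
  clearbody r p z x b.
  have [c cE] : exists c, b = c + x + z by exists (b - x - z); lia.
  have [e eE] : exists e, b = e + r + z by exists (b - r - z); lia.
  have -> : val (o (b + p - z)) = c + p + x by rewrite oK; lia.
  have -> : val (o (b - r)) = e + z by rewrite oK; lia.
  have -> : val (o (b - x - z)) = c by rewrite oK; lia.
  have -> : val (o (b + p - x - z)) = c + p by rewrite oK; lia.
  have -> : val (o (b - r - z)) = e by rewrite oK; lia.
  have -> : val (o b) = c + x + z by rewrite oK; lia.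
  have er : e + r = c + x by lia.
  have zer : z * e + z * r = z * c + z * x by rewrite -!mulnDr er.
  apply/andP; split; first by apply/eqP; lia.
  by apply/eqP; rewrite -!mulnn; clear - zer xp; nia.
move=> t t' tA t'A; have := key t tA; have := key t' t'A; rewrite /F /=.
set b' := 2 * M + t'.1.1.1; set x' := (t'.1.1.2).+1; set z' := (t'.1.2).+1.
set p' := _ * (z' %/ _); set r' := _ * (x' %/ _).
set b := 2 * M + t.1.1.1; set x := (t.1.1.2).+1; set z := (t.1.2).+1.
set p := _ * (z %/ _); set r := _ * (x %/ _).
case=> _ /andP[r0' rx'] /andP[p0' pz'] [hb' hx' hz' _].
case/andP: hb' hx' hz' => b0' b1' xM' zM'.
case=> _ /andP[r0 rx] /andP[p0 pz] [hb hx hz xg].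
case/andP: hb hx hz => b0 b1 xM zM.
move=> /(congr1 (fun u => (val u.1.1.2, val u.1.2, val u.2.1.2, val u.2.2)))/= [].
have lb : b < 4 * M by rewrite (leq_trans b1)// leq_mul2r orbT.
have lb' : b' < 4 * M by rewrite (leq_trans b1')// leq_mul2r orbT.
have le2 (u v y : nat) : u < 4 * M -> u - v - y < 4 * M.
  by apply: leq_ltn_trans; rewrite -subnDA leq_subr.
have le1 (u v : nat) : u < 4 * M -> u - v < 4 * M.
  by apply: leq_ltn_trans; rewrite leq_subr.
rewrite !(oK _ (le1 _ _ lb)) !(oK _ (le1 _ _ lb')) !(oK _ (le2 _ _ _ lb)).
rewrite !(oK _ (le2 _ _ _ lb')) (oK _ lb) (oK _ lb') => e1 e2 e3 e4.
have [zE xE rE] := sub_inj rx xM zM b0 rx' xM' zM' e1 e2 e3 e4.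
have jE : t.2 = t'.2 :> nat.
  by move: rE; rewrite /r /r' -xE -zE => /eqP; rewrite eqn_pmul2r// => /eqP[].
have bE : t.1.1.1 = t'.1.1.1 :> nat by move: e4 => /addnI.
case: zE => zE; case: xE => xE.
clear - jE bE zE xE.
move: t t' jE bE zE xE => [[[t1 t2] t3] t4] [[[s1 s2] s3] s4] /= /val_inj -> /val_inj -> /val_inj -> /val_inj ->.
by [].
Qed.

End counting.

Section counting_divergence.
Variable R : realType.

Lemma harmonic_unbounded (K : R) : exists m : nat, K <= \sum_(1 <= k < m.+1) (k%:R)^-1.
Proof.
apply: contrapT => /forallNP h; apply: (@dvg_harmonic R).
apply: nondecreasing_is_cvgn.
  apply/nondecreasing_seqP => n; rewrite /series/= big_nat_recr//= lerDl.
  exact: harmonic_ge0.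
exists K => _ [m _ <-]; rewrite leNgt; apply/negP => Km; apply: (h m).
rewrite big_add1 /=; apply: le_trans (ltW Km) _.
by rewrite /series /= /harmonic.
Qed.

(** The sum of 1 / k^2 over k <= q is at most 2 - 2 / (q + 1) by telescoping; the
correction term makes the induction go through. *)
Lemma sum_inv_sq_multiples (d m : nat) : (0 < d)%N ->
  \sum_(1 <= n < m.+1 | (d %| n)%N) (n%:R ^- 2 : R) <=
  (2 - 2 / ((m %/ d)%N.+1)%:R) / d%:R ^+ 2.
Proof.
move=> d0; have dR : 0 < d%:R :> R by rewrite ltr0n.
elim: m => [|m IH]; first by rewrite big_geq// div0n divr1 subrr mul0r.
rewrite big_mkcond big_nat_recr//= -big_mkcond/= divnS//.
case: ifPn => [dm|_]; last by rewrite addr0 add0n.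
rewrite add1n.
have mE : (m.+1 = d * (m %/ d).+1)%N by rewrite mulnC -{1}(divnK dm) divnS// dm.
move: IH; rewrite mE; set q := (m %/ d)%N => IH.
apply: le_trans (lerD IH (lexx _)) _.
rewrite natrM exprMn.
have -> : (d%:R ^+ 2 * q.+1%:R ^+ 2)^-1 = q.+1%:R ^- 2 * (d%:R ^+ 2)^-1 :> R.
  by rewrite invfM mulrC.
rewrite -mulrDl ler_wpM2r//.
have q0 : 0 < q.+1%:R :> R by rewrite ltr0n.
have -> : q.+2%:R = q.+1%:R + 1 :> R by rewrite -[q.+2]addn1 natrD.
set x : R := q.+1%:R in q0 *.
rewrite -subr_ge0.
have x1 : 1 <= x by rewrite /x ler1n.
have -> : 2 - 2 / (x + 1) - (2 - 2 / x + (x ^+ 2)^-1) = (x - 1) / (x ^+ 2 * (x + 1)).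
  by field; rewrite !gt_eqF//; lra.
by apply: divr_ge0; [lra|apply: mulr_ge0; [exact: sqr_ge0|lra]].
Qed.

(** 1 / k is the sum of totient d / k^2 over the divisors d of k; summing first over
the multiples k of d costs at most 2 / d^2. *)
Lemma harmonic_le_totient (m : nat) :
  \sum_(1 <= n < m.+1) (n%:R)^-1 <=
  2 * \sum_(1 <= d < m.+1) (totient d)%:R / d%:R ^+ 2 :> R.
Proof.
apply: (@le_trans _ _ (\sum_(1 <= n < m.+1)
    \sum_(1 <= d < m.+1 | (d %| n)%N) (totient d)%:R * n%:R ^- 2)).
  rewrite big_nat_cond [leRHS]big_nat_cond; apply: ler_sum => n.
  rewrite andbT => /andP[n0 nm]; rewrite -mulr_suml -natr_sum.
  have -> : (\sum_(1 <= d < m.+1 | d %| n) totient d = n)%N.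
    rewrite -[RHS]cyclic.sum_totient_dvd -(big_mkord (fun d => d %| n)%N).
    rewrite [LHS](big_cat_nat _ (n := n.+1))//= [X in (_ + X)%N]big_nat_cond.
    rewrite [X in (_ + X)%N]big1 ?addn0.
      by rewrite big_mkcond [RHS]big_mkcond [RHS]big_ltn//= if_same add0n.
    by move=> i; rewrite -andbA => /and3P[ni _ /(dvdn_leq n0)]; rewrite leqNgt ni.
  by rewrite expr2 invfM mulrA mulfV ?mul1r// pnatr_eq0 -lt0n.
under eq_bigr do rewrite big_mkcond.
rewrite exchange_big /= mulr_sumr big_nat_cond [leRHS]big_nat_cond.
apply: ler_sum => d; rewrite andbT => /andP[d0 dm].
rewrite -big_mkcond -mulr_sumr mulrCA ler_wpM2l//.
apply: (le_trans (sum_inv_sq_multiples m d0)).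
by rewrite ler_wpM2r ?invr_ge0 ?exprn_ge0// gerBl divr_ge0.
Qed.

(** For M = m! every d <= m divides M, so the lower bound given by the explicit
resonances is M^3 times the sum of totient d / d^2 over d <= m, which is at least
half a harmonic sum. With n = 4 M one has n^3 = 64 M^3, whence the factor 128. *)
Lemma resonances_unbounded (K : R) :
  exists2 n, (0 < n)%N & K * n%:R ^+ 3 <= #|resonances n|%:R.
Proof.
have [m Hm] := harmonic_unbounded (128 * K).
have M0 : (0 < m`!)%N := fact_gt0 m.
exists (4 * m`!)%N; first by rewrite muln_gt0.
have dM d : (0 < d <= m)%N -> (d %| m`!)%N by move=> dm; exact: dvdn_fact.
apply: (@le_trans _ _ (m`! * \sum_(1 <= d < m.+1) totient d * (m`! %/ d) ^ 2)%N%:R); last first.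
  rewrite ler_nat; apply: leq_trans (resonances_ge M0).
  by rewrite leq_mul2l card_gcd_pairs ?orbT.
have MR : 0 < m`!%:R :> R by rewrite ltr0n.
have -> : (m`! * \sum_(1 <= d < m.+1) totient d * (m`! %/ d) ^ 2)%N%:R =
    m`!%:R ^+ 3 * \sum_(1 <= d < m.+1) (totient d)%:R / d%:R ^+ 2 :> R.
  rewrite natrM natr_sum exprS -mulrA; congr (_ * _); rewrite mulr_sumr.
  rewrite big_nat_cond [RHS]big_nat_cond; apply: eq_bigr => d.
  rewrite andbT ltnS => dm; have /andP[d0 _] := dm.
  have dR : d%:R != 0 :> R by rewrite pnatr_eq0 -lt0n.
  by rewrite natrM natrX natr_div ?dM// ?unitfE//; field.
have := le_trans Hm (harmonic_le_totient m).
rewrite natrM exprMn; set s := \sum_(1 <= d < m.+1) _ => h.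
have M3 : 0 < m`!%:R ^+ 3 :> R by rewrite exprn_gt0.
rewrite mulrA [leLHS]mulrC ler_pM2l//; lra.
Qed.

End counting_divergence.

(** * Complex numbers and complex integrals *)

Section complex_numbers.
Context {R : realType}.
Local Notation C := (Rcomplex R).
Implicit Types (z w : C) (x y : R).

Lemma ReD z w : complex.Re (z + w) = complex.Re z + complex.Re w.
Proof. by case: z; case: w. Qed.
Lemma ImD z w : complex.Im (z + w) = complex.Im z + complex.Im w.
Proof. by case: z; case: w. Qed.
Lemma ReN z : complex.Re (- z) = - complex.Re z.
Proof. by case: z. Qed.
Lemma ImN z : complex.Im (- z) = - complex.Im z.
Proof. by case: z. Qed.
Lemma ReM z w : complex.Re (z * w) =
  complex.Re z * complex.Re w - complex.Im z * complex.Im w.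
Proof. by case: z; case: w. Qed.
Lemma ImM z w : complex.Im (z * w) =
  complex.Re z * complex.Im w + complex.Im z * complex.Re w.
Proof. by case: z; case: w. Qed.
Lemma ReZ x z : complex.Re (x *: z) = x * complex.Re z.
Proof. by case: z. Qed.
Lemma ImZ x z : complex.Im (x *: z) = x * complex.Im z.
Proof. by case: z. Qed.

Lemma complex_eq z w : complex.Re z = complex.Re w ->
  complex.Im z = complex.Im w -> z = w.
Proof. by case: z w => a b [c d] /= -> ->. Qed.

Lemma Re_sum I (r : seq I) (P : pred I) (F : I -> C) :
  complex.Re (\sum_(i <- r | P i) F i) = \sum_(i <- r | P i) complex.Re (F i).
Proof. by apply: (big_morph _ ReD). Qed.

Lemma Im_sum I (r : seq I) (P : pred I) (F : I -> C) :
  complex.Im (\sum_(i <- r | P i) F i) = \sum_(i <- r | P i) complex.Im (F i).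
Proof. by apply: (big_morph _ ImD). Qed.

Definition conjC z : C := Complex (complex.Re z) (- complex.Im z).

Lemma norm_conjC z : `|conjC z| = `|z|.
Proof. by rewrite !Rcomplex_normE /= sqrrN. Qed.

Lemma conjCB z w : conjC (z - w) = conjC z - conjC w.
Proof. by apply: complex_eq; rewrite ?ReD ?ImD /= ?ReD ?ImD ?ReN ?ImN ?opprD. Qed.

Lemma conjC_sum I (r : seq I) (P : pred I) (F : I -> C) :
  conjC (\sum_(i <- r | P i) F i) = \sum_(i <- r | P i) conjC (F i).
Proof.
apply: complex_eq; rewrite ?Re_sum ?Im_sum /= ?Re_sum ?Im_sum //.
by rewrite sumrN.
Qed.

Lemma conjCM z w : conjC (z * w) = conjC z * conjC w.
Proof.
by apply: complex_eq; rewrite ?ReM ?ImM /= ?ReM ?ImM; ring.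
Qed.

Lemma normM z w : `|(z * w : C)| = `|z| * `|w|.
Proof. exact: Normc.normcM. Qed.

Lemma normsq z : `|z| ^+ 2 = complex.Re z ^+ 2 + complex.Im z ^+ 2.
Proof. by rewrite Rcomplex_normE sqr_sqrtr// addr_ge0// sqr_ge0. Qed.

Lemma mul_conjC z : z * conjC z = `|z| ^+ 2 *: (1 : C).
Proof.
by apply: complex_eq; rewrite ?ReM ?ImM ?ReZ ?ImZ normsq /=; ring.
Qed.

Lemma normZ x z : `|(x *: z : C)| = `|x| * `|z|.
Proof.
apply/eqP; rewrite -(@eqrXn2 _ 2)// ?mulr_ge0//; apply/eqP.
by rewrite exprMn !normsq ReZ ImZ -normrX ger0_norm ?sqr_ge0//; ring.
Qed.

Lemma norm_Re z : `|complex.Re z| <= `|z|.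
Proof.
rewrite -(@ler_pXn2r _ 2)// ?nnegrE// normsq -normrX ger0_norm ?sqr_ge0//.
by rewrite lerDl sqr_ge0.
Qed.

Lemma norm_Im z : `|complex.Im z| <= `|z|.
Proof.
rewrite -(@ler_pXn2r _ 2)// ?nnegrE// normsq -normrX ger0_norm ?sqr_ge0//.
by rewrite lerDr sqr_ge0.
Qed.

Lemma norm_le_ReIm z : `|z| <= `|complex.Re z| + `|complex.Im z|.
Proof.
rewrite -(@ler_pXn2r _ 2)// ?nnegrE ?addr_ge0// normsq sqrrD.
rewrite -!normrX !(@ger0_norm _ (_ ^+ 2)) ?sqr_ge0// addrAC lerDl.
by rewrite mulrn_wge0// mulr_ge0.
Qed.

Lemma norm_cis x : `|(cis x : C)| = 1.
Proof. by rewrite Rcomplex_normE /= cos2Dsin2 sqrtr1. Qed.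

Lemma cisD x y : cis (x + y) = cis x * cis y.
Proof. by apply: complex_eq; rewrite ?ReM ?ImM /= ?cosD ?sinD // addrC; congr (_ + _); rewrite mulrC. Qed.

Lemma cis0 : cis 0 = 1 :> C.
Proof. by rewrite /cis cos0 sin0. Qed.

Lemma conj_cis x : conjC (cis x) = cis (- x).
Proof. by rewrite /conjC /cis /= cosN sinN. Qed.

Lemma quinticE z : quintic z = z * conjC z * (z * conjC z) * z.
Proof.
rewrite /quintic (exprM _ 2 2) normsq.
by apply: complex_eq; rewrite ?ReZ ?ImZ !(ReM, ImM) /=; ring.
Qed.

Lemma norm_quintic z : `|quintic z| = `|z| ^+ 5.
Proof. by rewrite /quintic normZ normrX normr_id -exprSr. Qed.

Lemma quinticZ (a : R) z : quintic (a *: z) = a ^+ 5 *: quintic z.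
Proof.
rewrite /quintic normZ exprMn -normrX ger0_norm; last first.
  by rewrite (exprM a 2 2) sqr_ge0.
by rewrite !scalerA; congr (_ *: _); ring.
Qed.

(** The constant 2 adds up the real and the imaginary part. *)
Lemma cis_lip x y : `|(cis x - cis y : C)| <= 2 * `|x - y|.
Proof.
have lip (f df : R -> R) : (forall t : R, is_derive t (1 : R) f (df t)) ->
    (forall t, `|df t| <= 1) -> forall a b : R, `|f a - f b| <= `|a - b|.
  move=> fd d1 a b; wlog ab : a b / a <= b => [h|].
    have /orP[/h//|/h] := le_total a b; rewrite distrC => /le_trans; apply.
    by rewrite distrC.
  have fc : {within `[a, b], continuous f}.
    apply: derivable_within_continuous => u _.
    by have [] := fd u.
  have [c _] := MVT_segment ab (fun t _ => fd t) fc.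
  rewrite distrC => ->; rewrite normrM [in leRHS]distrC.
  by rewrite ler_piMl.
rewrite (le_trans (norm_le_ReIm _))// ReD ImD ReN ImN /=.
rewrite mulrDl mul1r lerD//.
  apply: (lip cos (fun t => - sin t)) => t.
  by rewrite normrN ler_norml sin_geN1 sin_le1.
apply: (lip sin cos) => t.
by rewrite ler_norml cos_geN1 cos_le1.
Qed.

(** Difference of two products of five factors: one factor is replaced at a time. *)
Lemma quintic_lip (M : R) z w : `|z| <= M -> `|w| <= M ->
  `|(quintic z - quintic w : C)| <= 5 * M ^+ 4 * `|(z - w : C)|.
Proof.
move=> zM wM; have M0 : 0 <= M := le_trans (normr_ge0 z) zM.
pose D := z - w; pose z' := conjC z; pose w' := conjC w.
have -> : quintic z - quintic w =
    D * (z' * (z * z') * z) + w * (conjC D * (z * z') * z) +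
    w * w' * (D * z') * z + w * w' * w * conjC D * z + w * w' * w * w' * D.
  by rewrite !quinticE /D conjCB -/z' -/w'; ring.
have b1 (a b c d e : C) : `|a| <= M -> `|b| <= M -> `|c| <= M -> `|d| <= M ->
    forall x, x = `|a| * `|b| * (`|c| * `|d|) * `|e| -> x <= M ^+ 4 * `|e|.
  move=> aM bM cM dM x ->; rewrite ler_wpM2r//.
  rewrite (_ : M ^+ 4 = M * M * (M * M)); last by ring.
  by apply: ler_pM; rewrite ?mulr_ge0//; apply: ler_pM.
have z'M : `|z'| <= M by rewrite norm_conjC.
have w'M : `|w'| <= M by rewrite norm_conjC.
have -> : 5 * M ^+ 4 * `|(z - w : C)| = M ^+ 4 * `|D| + M ^+ 4 * `|D| + M ^+ 4 * `|D| + M ^+ 4 * `|D| + M ^+ 4 * `|D|.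
  by rewrite /D; ring.
have tri (a b : C) (u v : R) : `|a| <= u -> `|b| <= v -> `|(a + b : C)| <= u + v.
  by move=> au bv; apply: (le_trans (ler_normD _ _)); exact: lerD.
apply: (tri); [apply: (tri); [apply: (tri); [apply: (tri)|]|]|]; rewrite !normM ?norm_conjC.
- by apply: (b1 z' z z' z D) => //; rewrite ?norm_conjC; ring.
- by apply: (b1 w z z' z D) => //; rewrite ?norm_conjC; ring.
- by apply: (b1 w w' z' z D) => //; rewrite ?norm_conjC; ring.
- by apply: (b1 w w' w z D) => //; rewrite ?norm_conjC; ring.
- by apply: (b1 w w' w w' D) => //; rewrite ?norm_conjC; ring.
Qed.

End complex_numbers.

Section complex_integral.
Context {R : realType}.
Local Notation C := (Rcomplex R).
Local Notation mu := (@lebesgue_measure R).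
Local Notation seg a := (`[0%R, a%R]%classic).

Definition ccont (A : set R) (f : R -> C) :=
  {within A, continuous (fun x => complex.Re (f x))} /\
  {within A, continuous (fun x => complex.Im (f x))}.

Lemma ccontP (A : set R) (f : R -> C) :
  (forall x e : R, A x -> 0 < e -> exists2 r : R, 0 < r &
     forall y, A y -> `|x - y| < r -> `|(f x - f y : C)| < e) -> ccont A f.
Proof.
move=> h; have aux (g : C -> R) : (forall z w, `|g z - g w| <= `|(z - w : C)|) ->
    {within A, continuous (fun x => g (f x))}.
  move=> gl; apply/subspace_continuousP => x Ax; apply/cvgrPdist_lt => e e0.
  have [r r0 hr] := h x e Ax e0.
  rewrite /= near_withinE; apply/nbhs_normP; exists r => //= y xy Ay.
  exact: (le_lt_trans (gl _ _) (hr y Ay xy)).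
split; apply: aux => z w.
- by rewrite -ReN -ReD norm_Re.
- by rewrite -ImN -ImD norm_Im.
Qed.

Lemma ccont_dist (A : set R) (f : R -> C) : ccont A f ->
  forall x e : R, A x -> 0 < e -> exists2 r : R, 0 < r &
     forall y, A y -> `|x - y| < r -> `|(f x - f y : C)| < e.
Proof.
move=> [cr ci] x e Ax e0.
have e2 : 0 < e / 2 by rewrite divr_gt0.
have aux (g : R -> R) : {within A, continuous g} -> exists2 r : R, 0 < r &
    forall y, A y -> `|x - y| < r -> `|g x - g y| < e / 2.
  move=> /subspace_continuousP /(_ x Ax) /cvgrPdist_lt /(_ _ e2).
  rewrite /= near_withinE => /nbhs_normP[r /= r0 hr]; exists r => // y Ay xy.
  exact: hr.
have [r r0 hr] := aux _ cr; have [s s0 hs] := aux _ ci.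
exists (Num.min r s); first by rewrite lt_min r0.
move=> y Ay; rewrite lt_min => /andP[/(hr y Ay) h1 /(hs y Ay) h2].
rewrite (le_lt_trans (norm_le_ReIm _))// ReD ImD ReN ImN [e]splitr.
exact: ltrD.
Qed.

Lemma ccont_cst (A : set R) (c : C) : ccont A (fun=> c).
Proof. by split=> x; exact: cvg_cst. Qed.

Lemma ccontD (A : set R) f g : ccont A f -> ccont A g -> ccont A (fun x => f x + g x).
Proof.
move=> [fr fi] [gr gi]; split.
  by under eq_fun do rewrite ReD; move=> x; apply: cvgD; [exact: fr|exact: gr].
by under eq_fun do rewrite ImD; move=> x; apply: cvgD; [exact: fi|exact: gi].
Qed.

Lemma ccontN (A : set R) f : ccont A f -> ccont A (fun x => - f x).
Proof.
move=> [fr fi]; split.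
  by under eq_fun do rewrite ReN; move=> x; apply: cvgN; exact: fr.
by under eq_fun do rewrite ImN; move=> x; apply: cvgN; exact: fi.
Qed.

Lemma ccontM (A : set R) f g : ccont A f -> ccont A g -> ccont A (fun x => f x * g x).
Proof.
move=> [fr fi] [gr gi]; split.
  under eq_fun do rewrite ReM; move=> x; apply: cvgB; apply: cvgM;
  [exact: fr|exact: gr|exact: fi|exact: gi].
under eq_fun do rewrite ImM; move=> x; apply: cvgD; apply: cvgM;
  [exact: fr|exact: gi|exact: fi|exact: gr].
Qed.

Lemma ccont_conj (A : set R) f : ccont A f -> ccont A (fun x => conjC (f x)).
Proof. by move=> [fr fi]; split=> //= x; apply: cvgN; exact: fi. Qed.

Lemma ccont_sum (A : set R) I (r : seq I) (F : I -> R -> C) :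
  (forall i, ccont A (F i)) -> ccont A (fun x => \sum_(i <- r) F i x).
Proof.
move=> h; elim: r => [|i r IH].
  by under eq_fun do rewrite big_nil; exact: ccont_cst.
by under eq_fun do rewrite big_cons; exact: ccontD.
Qed.

Lemma ccont_cis (A : set R) (g : R -> R) : {within A, continuous g} ->
  ccont A (fun x => cis (g x)).
Proof.
move=> cg; split => x /=; apply: continuous_comp; first exact: cg.
- exact: continuous_cos.
- exact: cg.
- exact: continuous_sin.
Qed.

Lemma ccont_cisl (A : set R) (a : R) : ccont A (fun x => cis (a * x)).
Proof.
apply: ccont_cis; apply: continuous_subspaceT => x.
by apply: cvgM; [exact: cvg_cst|exact: cvg_id].
Qed.

Lemma ccont_quintic (A : set R) f : ccont A f -> ccont A (fun x => quintic (f x)).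
Proof.
move=> cf; under eq_fun do rewrite quinticE.
have cf' := ccont_conj cf; have cff := ccontM cf cf'.
exact: (ccontM (ccontM cff cff) cf).
Qed.

Lemma ccont_norm (A : set R) f : ccont A f -> {within A, continuous (fun x => `|f x|)}.
Proof.
move=> [cr ci]; under eq_fun do rewrite Rcomplex_normE.
move=> x; apply: continuous_comp; last exact: sqrt_continuous.
by apply: cvgD; apply: cvgM; (exact: cr || exact: ci).
Qed.

Definition cintegrable (D : set R) (f : R -> C) :=
  mu.-integrable D (fun x => (complex.Re (f x))%:E) /\
  mu.-integrable D (fun x => (complex.Im (f x))%:E).

Lemma within_integrable (a b : R) (f : R -> R) : {within `[a, b], continuous f} ->
  mu.-integrable `[a, b] (fun x => (f x)%:E).
Proof.
move=> cf; apply: continuous_compact_integrable => //; exact: segment_compact.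
Qed.

Lemma ccont_integrable (a : R) f : ccont (seg a) f -> cintegrable (seg a) f.
Proof. by move=> [cr ci]; split; exact: within_integrable. Qed.

Section linearity.
Variable D : set R.
Hypothesis mD : measurable (D : set (measurableTypeR R)).

Lemma cintegrableD f g : cintegrable D f -> cintegrable D g ->
  cintegrable D (fun x => f x + g x).
Proof.
move=> [fr fi] [gr gi]; split.
  under eq_fun do rewrite ReD EFinD.
  exact: (integrableD mD).
under eq_fun do rewrite ImD EFinD.
exact: (integrableD mD).
Qed.

Lemma cintegrableM (c : C) f : cintegrable D f -> cintegrable D (fun x => c * f x).
Proof.
move=> [fr fi]; split.
  under eq_fun do rewrite ReM EFinB 2!EFinM.
  by apply: (integrableB mD); exact: (integrableZl mD).
under eq_fun do rewrite ImM EFinD 2!EFinM.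
by apply: (integrableD mD); exact: (integrableZl mD).
Qed.

Lemma cintegralD f g : cintegrable D f -> cintegrable D g ->
  cintegral D (fun x => f x + g x) = cintegral D f + cintegral D g.
Proof.
move=> [fr fi] [gr gi]; apply: complex_eq; rewrite ?ReD ?ImD /=.
  by under eq_Rintegral do rewrite ReD; exact: RintegralD.
by under eq_Rintegral do rewrite ImD; exact: RintegralD.
Qed.

Lemma Rintegrable_scale (c : R) (g : R -> R) :
  mu.-integrable D (fun x => (g x)%:E) ->
  mu.-integrable D (EFin \o (fun x => c * g x)).
Proof.
move=> gi; rewrite (_ : _ \o _ = fun x => (c%:E * (g x)%:E)%E); last first.
  by apply/funext => x; rewrite -EFinM.
exact: (integrableZl mD).
Qed.

Lemma cintegralMl (c : C) f : cintegrable D f ->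
  cintegral D (fun x => c * f x) = c * cintegral D f.
Proof.
move=> [fr fi]; apply: complex_eq; rewrite ?ReM ?ImM /=.
  under eq_Rintegral do rewrite ReM.
  rewrite RintegralB//; [|exact: Rintegrable_scale|exact: Rintegrable_scale].
  by rewrite !RintegralZl.
under eq_Rintegral do rewrite ImM.
rewrite RintegralD//; [|exact: Rintegrable_scale|exact: Rintegrable_scale].
by rewrite !RintegralZl.
Qed.

Lemma cintegral0 : cintegral D (fun=> 0) = 0.
Proof.
by apply: complex_eq; rewrite /= (Rintegral_cst _ mD) mul0r.
Qed.

Lemma cintegrable0 : cintegrable D (fun=> 0).
Proof. by split; exact: integrable0. Qed.

Lemma cintegrable_sum I (r : seq I) (F : I -> R -> C) :
  (forall i, cintegrable D (F i)) -> cintegrable D (fun x => \sum_(i <- r) F i x).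
Proof.
move=> h; elim: r => [|i r IH].
  by under eq_fun do rewrite big_nil; exact: cintegrable0.
by under eq_fun do rewrite big_cons; exact: cintegrableD.
Qed.

Lemma cintegral_sum I (r : seq I) (F : I -> R -> C) :
  (forall i, cintegrable D (F i)) ->
  cintegral D (fun x => \sum_(i <- r) F i x) = \sum_(i <- r) cintegral D (F i).
Proof.
move=> h; elim: r => [|i r IH].
  by rewrite big_nil -[RHS]cintegral0; congr cintegral; apply/funext => x; rewrite big_nil.
rewrite big_cons -IH -cintegralD//; last exact: cintegrable_sum.
by congr cintegral; apply/funext => x; rewrite big_cons.
Qed.

Lemma cintegralB f g : cintegrable D f -> cintegrable D g ->
  cintegral D (fun x => f x - g x) = cintegral D f - cintegral D g.
Proof.
move=> cf cg; rewrite -[in RHS]mulN1r -cintegralMl// -cintegralD//.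
  by congr cintegral; apply/funext => x; rewrite mulN1r.
exact: cintegrableM.
Qed.

Lemma eq_cintegral f g : {in D, f =1 g} -> cintegral D f = cintegral D g.
Proof.
by move=> fg; apply: complex_eq => /=; apply: eq_Rintegral => x xD; rewrite fg.
Qed.

End linearity.

Lemma mu_seg (a : R) : 0 <= a -> mu (seg a) = a%:E.
Proof.
move=> a0; rewrite lebesgue_measure_itv/= lte_fin lt_neqAle a0 andbT.
by case: eqVneq => [<-|_] //=; rewrite oppr0 adde0.
Qed.

Lemma Rintegral_seg_cst (a M : R) : 0 <= a -> \int[mu]_(x in seg a) M = M * a.
Proof.
move=> a0; rewrite Rintegral_cst; last exact: measurable_itv.
congr (_ * _); exact: (congr1 fine (mu_seg a0)).
Qed.

Lemma norm_Rintegral_seg (a M : R) (f : R -> R) : 0 <= a ->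
  mu.-integrable (seg a) (fun x => (f x)%:E) ->
  (forall x, 0 <= x <= a -> `|f x| <= M) ->
  `|\int[mu]_(x in seg a) f x| <= M * a.
Proof.
move=> a0 fi fM; have mD : measurable (seg a : set (measurableTypeR R)).
  exact: measurable_itv.
apply: (le_trans (le_normr_Rintegral mD fi)).
rewrite -(Rintegral_seg_cst M a0).
apply: (le_Rintegral mD).
- exact: integrable_norm fi.
- by apply: within_integrable => x; exact: cvg_cst.
- by move=> x /=; rewrite in_itv/=; exact: fM.
Qed.

(** The factor 2 comes from bounding real and imaginary parts separately. *)
Lemma norm_cintegral_seg (a M : R) (f : R -> C) : 0 <= a ->
  cintegrable (seg a) f -> (forall x, 0 <= x <= a -> `|f x| <= M) ->
  `|cintegral (seg a) f| <= 2 * M * a.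
Proof.
move=> a0 [fr fi] fM; apply: (le_trans (norm_le_ReIm _)).
rewrite -mulrA mulrDl mul1r /=; apply: lerD; apply: norm_Rintegral_seg => // x xa.
  exact: le_trans (norm_Re _) (fM x xa).
exact: le_trans (norm_Im _) (fM x xa).
Qed.

Lemma ccont_cintegral (T : R) (f : R -> C) : 0 <= T -> ccont (seg T) f ->
  ccont (seg T) (fun t => cintegral (seg t) f).
Proof.
move=> T0 [cr ci]; split => /=;
by apply: parameterized_integral_continuous => //; exact: within_integrable.
Qed.

Lemma cos_sin_int (k : int) : cos (k%:~R * (2 * pi)) = 1 :> R /\ sin (k%:~R * (2 * pi)) = 0 :> R.
Proof.
have h (n : nat) : cos (n%:R * (2 * pi)) = 1 :> R /\ sin (n%:R * (2 * pi)) = 0 :> R.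
  elim: n => [|n [hc hs]]; first by rewrite mul0r cos0 sin0.
  rewrite -natr1 mulrDl mul1r cosD sinD hc hs mulr_natl cos2pi sin2pi.
  by split; ring.
case: k => n; first exact: h.
by have [hc hs] := h n.+1; rewrite NegzE mulrNz mulNr cosN sinN hc hs oppr0.
Qed.

Lemma cis_periodic (k : int) (x : R) : cis (k%:~R * (x + 2 * pi)) = cis (k%:~R * x).
Proof.
have [c s] := cos_sin_int k.
by rewrite mulrDr cisD /cis c s mulr1.
Qed.

Lemma cintegral_cis (k : int) :
  cintegral (seg (2 * pi)) (fun x => cis (k%:~R * x)) = ((2 * pi) *+ (k == 0)) *: (1 : C).
Proof.
have p0 : 0 < 2 * pi :> R by rewrite mulr_gt0// pi_gt0.
have mD : measurable (seg (2 * pi : R) : set (measurableTypeR R)).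
  exact: measurable_itv.
have [->|k0] := eqVneq k 0.
  apply: complex_eq; rewrite ?ReZ ?ImZ /=.
    under eq_Rintegral do rewrite mul0r cos0.
    by rewrite Rintegral_seg_cst ?ltW// mulr1 mul1r.
  under eq_Rintegral do rewrite mul0r sin0.
  by rewrite Rintegral_seg_cst ?ltW// mul0r mulr0.
have kR : k%:~R != 0 :> R by rewrite intr_eq0.
rewrite mulr0n scale0r.
have FTC (f F : R -> R) : continuous f -> (forall x : R, is_derive x (1 : R) F (f x)) ->
    \int[mu]_(x in seg (2 * pi)) f x = F (2 * pi) - F 0.
  move=> cf dF; rewrite /Rintegral (continuous_FTC2 p0 (F := F))//.
  - exact: continuous_subspaceT.
  - have cF : continuous F.
      by move=> x; apply: differentiable_continuous; apply/derivable1_diffP; case: (dF x).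
    split; first by move=> x _; case: (dF x).
    + exact: cvg_at_right_filter (cF 0).
    + exact: cvg_at_left_filter (cF _).
  - by move=> x _; rewrite derive1E; case: (dF x).
have [c s] := cos_sin_int k.
have dk (x : R) : is_derive x (1 : R) (fun y : R => k%:~R * y) k%:~R.
  by apply: is_derive_eq; rewrite /GRing.scale/= mulr1.
have d1 (x : R) : is_derive x (1 : R) (fun y : R => (k%:~R)^-1 * sin (k%:~R * y)) (cos (k%:~R * x)).
  have ds := is_derive1_comp (is_derive_sin (k%:~R * x)) (dk x).
  apply: is_derive_eq; rewrite /GRing.scale/=; by field.
have d2 (x : R) : is_derive x (1 : R) (fun y : R => - (k%:~R)^-1 * cos (k%:~R * y)) (sin (k%:~R * x)).
  have ds := is_derive1_comp (is_derive_cos (k%:~R * x)) (dk x).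
  apply: is_derive_eq; rewrite /GRing.scale/=; by field.
have ck : continuous (fun x : R => k%:~R * x).
  by move=> x; apply: cvgM; [exact: cvg_cst|exact: cvg_id].
apply: complex_eq => /=.
  rewrite (FTC (fun x => cos (k%:~R * x)) _ _ d1).
    by rewrite s !mulr0 sin0 mulr0 subrr.
  by move=> x; apply: continuous_comp; [exact: ck|exact: continuous_cos].
rewrite (FTC (fun x => sin (k%:~R * x)) _ _ d2).
  by rewrite c !mulr0 cos0 subrr.
by move=> x; apply: continuous_comp; [exact: ck|exact: continuous_sin].
Qed.

End complex_integral.

(** * Trigonometric polynomials driven by a path *)

Section trigonometric_terms.
Context {R : realType}.
Variables (T : R).
Hypothesis T0 : 0 <= T.
Local Notation C := (Rcomplex R).
Local Notation seg a := (`[0%R, a%R]%classic).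

Definition cont_path (w : R -> R) := {within seg T, continuous w}.

Definition close_path (e : R) (w w' : R -> R) :=
  forall t : R, 0 <= t <= T -> `|w t - w' t| <= e.

(** A Fourier mode of fixed frequency whose amplitude is a functional of the driving
path. The bounds hold for all continuous paths at once, and the dependence on the
path is Lipschitz for the uniform distance: this is what later makes the solution
a measurable function of omega. *)
Record term := Term {
  freq : int;
  amp : (R -> R) -> R -> C;
  bnd : R;
  amp_cont : forall w, cont_path w -> ccont (seg T) (amp w);
  amp_bnd : forall w t, cont_path w -> 0 <= t <= T -> `|amp w t| <= bnd;
  amp_lip : exists2 L : R, 0 <= L & forall w w' e, cont_path w -> cont_path w' ->
    close_path e w w' -> forall t : R, 0 <= t <= T ->
    `|(amp w t - amp w' t : C)| <= L * e }.

Implicit Types (a b : term) (l : seq term) (w : R -> R).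

Lemma cont_path0 : cont_path (fun=> 0).
Proof. by move=> x; exact: cvg_cst. Qed.

Lemma bnd_ge0 a : 0 <= bnd a.
Proof.
apply: le_trans (normr_ge0 _) (amp_bnd a cont_path0 (t := 0) _).
by rewrite lexx.
Qed.

Lemma tmul_cont a b w : cont_path w -> ccont (seg T) (fun t => amp a w t * amp b w t).
Proof. by move=> cw; apply: ccontM; exact: amp_cont. Qed.

Lemma tmul_bnd a b w t : cont_path w -> 0 <= t <= T ->
  `|(amp a w t * amp b w t : C)| <= bnd a * bnd b.
Proof. by move=> cw tT; rewrite normM; apply: ler_pM => //; exact: amp_bnd. Qed.

Lemma tmul_lip a b : exists2 L : R, 0 <= L & forall w w' e, cont_path w -> cont_path w' ->
  close_path e w w' -> forall t : R, 0 <= t <= T ->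
  `|(amp a w t * amp b w t - amp a w' t * amp b w' t : C)| <= L * e.
Proof.
have [L L0 hL] := amp_lip a; have [M M0 hM] := amp_lip b.
exists (L * bnd b + bnd a * M) => [|w w' e cw cw' ww' t tT].
  by rewrite addr_ge0// mulr_ge0// bnd_ge0.
have -> : amp a w t * amp b w t - amp a w' t * amp b w' t =
  (amp a w t - amp a w' t) * amp b w t + amp a w' t * (amp b w t - amp b w' t).
  by ring.
rewrite (le_trans (ler_normD _ _))// [leRHS]mulrDl !normM; apply: lerD.
  rewrite mulrAC; apply: ler_pM => //; first exact: (hL _ _ _ cw cw').
  exact: amp_bnd.
rewrite -mulrA; apply: ler_pM => //; first exact: amp_bnd.
exact: (hM _ _ _ cw cw').
Qed.

Definition tmul a b := Term (freq a + freq b) (tmul_cont a b) (tmul_bnd a b) (tmul_lip a b).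

Lemma tconj_cont a w : cont_path w -> ccont (seg T) (fun t => conjC (amp a w t)).
Proof. by move=> cw; apply: ccont_conj; exact: amp_cont. Qed.

Lemma tconj_bnd a w t : cont_path w -> 0 <= t <= T -> `|conjC (amp a w t)| <= bnd a.
Proof. by move=> cw tT; rewrite norm_conjC; exact: amp_bnd. Qed.

Lemma tconj_lip a : exists2 L : R, 0 <= L & forall w w' e, cont_path w -> cont_path w' ->
  close_path e w w' -> forall t : R, 0 <= t <= T ->
  `|(conjC (amp a w t) - conjC (amp a w' t) : C)| <= L * e.
Proof.
have [L L0 hL] := amp_lip a; exists L => // w w' e cw cw' ww' t tT.
by rewrite -conjCB norm_conjC; exact: hL.
Qed.

Definition tconj a := Term (- freq a) (tconj_cont a) (tconj_bnd a) (tconj_lip a).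

Lemma propagatorB (x y : R) (k : int) :
  propagator (x - y) k = cis (k%:~R ^+ 2 * x) * cis (- (k%:~R ^+ 2 * y)) :> C.
Proof. by rewrite /propagator mulrBr cisD. Qed.

Lemma norm_propagator (x : R) k : `|propagator x k| = 1.
Proof. exact: norm_cis. Qed.

Lemma norm_i : `|('i%C : C)| = 1.
Proof. by rewrite Rcomplex_normE /= expr0n expr1n add0r sqrtr1. Qed.

Lemma ccont_path_cis (a : R) w : cont_path w -> ccont (seg T) (fun t => cis (a * w t)).
Proof.
by move=> cw; apply: ccont_cis => x; apply: cvgM; [exact: cvg_cst|exact: cw].
Qed.

Lemma ccont_path_cisN (a : R) w : cont_path w -> ccont (seg T) (fun t => cis (- (a * w t))).
Proof.
move=> cw; apply: ccont_cis => x; apply: cvgN.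
by apply: cvgM; [exact: cvg_cst|exact: cw].
Qed.

(** The k-th Fourier coefficient of the Duhamel integral of a function whose k-th
coefficient at time s is f s. *)
Definition duhamel w (k : int) (f : R -> C) (t : R) : C :=
  - 'i%C * cintegral (seg t) (fun s => propagator (w t - w s) k * f s).

Lemma ccont_propagator w k t : cont_path w -> ccont (seg T) (fun s => propagator (w t - w s) k).
Proof.
move=> cw; rewrite (_ : (fun s => _) =
    fun s => cis (k%:~R ^+ 2 * w t) * cis (- (k%:~R ^+ 2 * w s))); last first.
  by apply/funext => s; exact: propagatorB.
apply: ccontM; first exact: ccont_cst.
exact: ccont_path_cisN.
Qed.

Lemma ccont_sub (A B : set R) (f : R -> C) : A `<=` B -> ccont B f -> ccont A f.
Proof. by move=> AB [cr ci]; split; apply: continuous_subspaceW; eassumption. Qed.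

Lemma seg_sub t : t <= T -> seg t `<=` seg T.
Proof. by move=> tT x /=; rewrite !in_itv/= => /andP[-> /le_trans -> //]. Qed.

Lemma measurable_seg (t : R) : measurable (seg t : set (measurableTypeR R)).
Proof. exact: measurable_itv. Qed.

Lemma duhamel_integrable w k f t : cont_path w -> ccont (seg T) f -> t <= T ->
  cintegrable (seg t) (fun s => propagator (w t - w s) k * f s).
Proof.
move=> cw cf tT; apply: ccont_integrable; apply: (ccont_sub (seg_sub tT)).
by apply: ccontM => //; exact: ccont_propagator.
Qed.

Lemma duhamel_cont w k f : cont_path w -> ccont (seg T) f ->
  ccont (seg T) (duhamel w k f).
Proof.
move=> cw cf; apply: ccontM; first exact: ccont_cst.
have ck : ccont (seg T) (fun s => cis (- (k%:~R ^+ 2 * w s)) * f s).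
  apply: ccontM => //; exact: ccont_path_cisN.
have cc := ccontM (ccont_path_cis (k%:~R ^+ 2) cw) (ccont_cintegral T0 ck).
have E t : t \in seg T -> cis (k%:~R ^+ 2 * w t) *
     cintegral (seg t) (fun s : R => cis (- (k%:~R ^+ 2 * w s)) * f s) =
   cintegral (seg t) (fun s : R => propagator (w t - w s) k * f s) :> C.
  rewrite inE/= in_itv/= => /andP[t0 tT].
  rewrite -cintegralMl; first last.
  - by apply: ccont_integrable; exact: (ccont_sub (seg_sub tT)).
  - exact: measurable_seg.
  by congr cintegral; apply/funext => s; rewrite propagatorB mulrA.
apply: ccontP => t e tT e0; have [r r0 hr] := ccont_dist cc tT e0.
exists r => // s sT ts; rewrite -!E ?inE//; exact: hr.
Qed.

Lemma duhamel_bnd w k f M t : cont_path w -> ccont (seg T) f ->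
  (forall s : R, 0 <= s <= T -> `|f s| <= M) -> 0 <= t <= T ->
  `|duhamel w k f t| <= 2 * T * M.
Proof.
move=> cw cf fM /andP[t0 tT]; rewrite /duhamel normM normrN norm_i mul1r.
apply: (@le_trans _ _ (2 * M * t)).
  apply: norm_cintegral_seg => //; first exact: duhamel_integrable.
  move=> s /andP[s0 st]; rewrite normM norm_propagator mul1r fM// s0.
  exact: le_trans st tT.
rewrite mulrAC ler_wpM2r ?ler_pM2l//.
by apply: le_trans (normr_ge0 _) (fM 0 _); rewrite lexx.
Qed.

Lemma duhamelB w k f g t : cont_path w -> ccont (seg T) f -> ccont (seg T) g -> t <= T ->
  duhamel w k (fun s => f s - g s) t = duhamel w k f t - duhamel w k g t.
Proof.
move=> cw cf cg tT; rewrite /duhamel -mulrBr -cintegralB.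
- by congr (_ * cintegral _ _); apply/funext => s; rewrite mulrBr.
- exact: measurable_seg.
- exact: duhamel_integrable.
- exact: duhamel_integrable.
Qed.

Lemma duhamel_sum w k I (r : seq I) (F : I -> R -> C) t : cont_path w ->
  (forall i, ccont (seg T) (F i)) -> t <= T ->
  duhamel w k (fun s => \sum_(i <- r) F i s) t = \sum_(i <- r) duhamel w k (F i) t.
Proof.
move=> cw cF tT; rewrite /duhamel -mulr_sumr -cintegral_sum.
- by congr (_ * cintegral _ _); apply/funext => s; rewrite mulr_sumr.
- exact: measurable_seg.
- by move=> i; exact: duhamel_integrable.
Qed.

Lemma propagator_lip (x y : R) k :
  `|(propagator x k - propagator y k : C)| <= 2 * k%:~R ^+ 2 * `|x - y|.
Proof.
apply: (le_trans (cis_lip _ _)); rewrite -mulrBr normrM.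
by rewrite (@ger0_norm _ (k%:~R ^+ 2)) ?sqr_ge0// mulrA.
Qed.

(** The propagator at frequency k is Lipschitz in the path with a constant of order
k^2: every trigonometric polynomial depends on the path in a Lipschitz way, with a
constant that is not controlled by the l^1 norm. *)
Lemma duhamel_lip w w' k f g M L e t : cont_path w -> cont_path w' ->
  ccont (seg T) f -> ccont (seg T) g ->
  (forall s : R, 0 <= s <= T -> `|f s| <= M) ->
  close_path e w w' ->
  (forall s : R, 0 <= s <= T -> `|(f s - g s : C)| <= L * e) -> 0 <= t <= T ->
  `|(duhamel w k f t - duhamel w' k g t : C)| <=
  2 * T * (4 * k%:~R ^+ 2 * M + L) * e.
Proof.
move=> cw cw' cf cg fM ww' fg tT; have /andP[t0 tleT] := tT.
have i1 := duhamel_integrable k cw cf tleT.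
have i2 := duhamel_integrable k cw' cg tleT.
have M0 : 0 <= M by apply: le_trans (normr_ge0 _) (fM 0 _); rewrite lexx.
have e0 : 0 <= e by apply: le_trans (normr_ge0 _) (ww' 0 _); rewrite lexx.
have mt := measurable_seg t.
rewrite /duhamel -mulrBr -cintegralB// normM normrN norm_i mul1r.
pose K := 4 * k%:~R ^+ 2 * M + L.
have bd s : 0 <= s <= t -> `|(propagator (w t - w s) k * f s -
    propagator (w' t - w' s) k * g s : C)| <= K * e.
  move=> /andP[s0 st]; have sT : 0 <= s <= T by rewrite s0 (le_trans st).
  have -> : propagator (w t - w s) k * f s - propagator (w' t - w' s) k * g s =
      (propagator (w t - w s) k - propagator (w' t - w' s) k) * f s +
      propagator (w' t - w' s) k * (f s - g s) by ring.
  rewrite (le_trans (ler_normD _ _))// !normM norm_propagator mul1r [leRHS]mulrDl.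
  apply: lerD; last exact: fg.
  rewrite mulrAC; apply: ler_pM => //; last exact: fM.
  apply: (le_trans (propagator_lip _ _ _)).
  rewrite (_ : 4 * k%:~R ^+ 2 * e = 2 * k%:~R ^+ 2 * (e + e)); last by ring.
  apply: ler_wpM2l; first by rewrite mulr_ge0// sqr_ge0.
  rewrite (_ : w t - w s - (w' t - w' s) = (w t - w' t) - (w s - w' s)); last by ring.
  by rewrite (le_trans (ler_normB _ _))// lerD// ww'.
have i12 : cintegrable (seg t) (fun s => propagator (w t - w s) k * f s -
    propagator (w' t - w' s) k * g s).
  apply: ccont_integrable; apply: (ccont_sub (seg_sub tleT)).
  by apply: ccontD; [|apply: ccontN]; apply: ccontM => //; exact: ccont_propagator.
apply: (le_trans (norm_cintegral_seg t0 i12 bd)).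
rewrite -/K (_ : 2 * T * K * e = 2 * (K * e) * T); last by ring.
apply: ler_wpM2l => //; rewrite mulr_ge0//.
apply: le_trans (normr_ge0 _) (bd 0 _); by rewrite lexx.
Qed.

Lemma tduh_cont a w : cont_path w -> ccont (seg T) (duhamel w (freq a) (amp a w)).
Proof. by move=> cw; apply: duhamel_cont => //; exact: amp_cont. Qed.

Lemma tduh_bnd a w t : cont_path w -> 0 <= t <= T ->
  `|duhamel w (freq a) (amp a w) t| <= 2 * T * bnd a.
Proof.
move=> cw; apply: duhamel_bnd => //; first exact: amp_cont.
by move=> s; exact: amp_bnd.
Qed.

Lemma tduh_lip a : exists2 L : R, 0 <= L & forall w w' e, cont_path w -> cont_path w' ->
  close_path e w w' -> forall t : R, 0 <= t <= T ->
  `|(duhamel w (freq a) (amp a w) t - duhamel w' (freq a) (amp a w') t : C)| <= L * e.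
Proof.
have [L L0 hL] := amp_lip a.
exists (2 * T * (4 * (freq a)%:~R ^+ 2 * bnd a + L)).
  apply: mulr_ge0; first exact: mulr_ge0.
  apply: addr_ge0 => //; apply: mulr_ge0; last exact: bnd_ge0.
  by apply: mulr_ge0 => //; exact: sqr_ge0.
move=> w w' e cw cw' ww' t tT.
apply: duhamel_lip => //; do ?exact: amp_cont.
  by move=> s; exact: amp_bnd.
exact: hL.
Qed.

Definition tduh a := Term (freq a) (tduh_cont a) (tduh_bnd a) (tduh_lip a).

Definition eval l w (t x : R) : C :=
  \sum_(a <- l) amp a w t * cis ((freq a)%:~R * x).

(** An upper bound, uniform in path and time, for the norm of the Wiener algebra:
terms with equal frequencies are not merged, which keeps the norm of a
concatenation additive and that of a product multiplicative. *)
Definition lnorm l : R := \sum_(a <- l) bnd a.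

Definition lmul l l' := [seq tmul a b | a <- l, b <- l'].

Lemma eval_cat l l' w t x : eval (l ++ l') w t x = eval l w t x + eval l' w t x.
Proof. by rewrite /eval big_cat. Qed.

Lemma lnorm_cat l l' : lnorm (l ++ l') = lnorm l + lnorm l'.
Proof. by rewrite /lnorm big_cat. Qed.

Lemma lnorm_ge0 l : 0 <= lnorm l.
Proof. by apply: sumr_ge0 => a _; exact: bnd_ge0. Qed.

Lemma eval_mul l l' w t x : eval (lmul l l') w t x = eval l w t x * eval l' w t x.
Proof.
rewrite /eval /lmul big_allpairs_dep big_distrlr/=; apply: eq_bigr => a _.
by apply: eq_bigr => b _; rewrite intrD mulrDl cisD; ring.
Qed.

Lemma lnorm_mul l l' : lnorm (lmul l l') = lnorm l * lnorm l'.
Proof. by rewrite /lnorm /lmul big_allpairs_dep big_distrlr. Qed.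

Definition lconj l := map tconj l.

Lemma eval_conj l w t x : eval (lconj l) w t x = conjC (eval l w t x).
Proof.
rewrite /eval big_map conjC_sum; apply: eq_bigr => a _.
by rewrite conjCM conj_cis /= rmorphN mulNr.
Qed.

Lemma lnorm_conj l : lnorm (lconj l) = lnorm l.
Proof. by rewrite /lnorm big_map. Qed.

Definition lduh l := map tduh l.

Lemma lnorm_duh l : lnorm (lduh l) = 2 * T * lnorm l.
Proof. by rewrite /lnorm big_map mulr_sumr. Qed.

Lemma eval_bnd l w t x : cont_path w -> 0 <= t <= T -> `|eval l w t x| <= lnorm l.
Proof.
move=> cw tT; rewrite /eval /lnorm; elim: l => [|a l IH].
  by rewrite !big_nil normr0.
rewrite !big_cons (le_trans (ler_normD _ _))// lerD// normM norm_cis mulr1.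
exact: amp_bnd.
Qed.

Lemma eval_periodic l w t x : eval l w t (x + 2 * pi) = eval l w t x.
Proof. by apply: eq_bigr => a _; rewrite cis_periodic. Qed.

Lemma eval_contx (A : set R) l w t : ccont A (eval l w t).
Proof.
apply: ccont_sum => a; apply: ccontM; first exact: ccont_cst.
exact: ccont_cisl.
Qed.

Lemma eval_contt l w t e : cont_path w -> 0 <= t <= T -> 0 < e ->
  exists2 r : R, 0 < r & forall s x : R, 0 <= s <= T -> `|t - s| < r ->
    `|(eval l w t x - eval l w s x : C)| <= e.
Proof.
move=> cw tT; elim: l e => [|a l IH] e e0.
  by exists 1 => // s x _ _; rewrite /eval !big_nil subrr normr0 ltW.
have e2 : 0 < e / 2 by rewrite divr_gt0.
have [r r0 hr] := IH _ e2.
have tT' : seg T t by rewrite /= in_itv.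
have [r' r'0 hr'] := ccont_dist (amp_cont a cw) tT' e2.
exists (Num.min r r'); first by rewrite lt_min r0.
move=> s x sT; rewrite lt_min => /andP[tr tr'].
rewrite /eval !big_cons -/(eval l w t x) -/(eval l w s x) opprD addrACA -mulrBl.
rewrite (le_trans (ler_normD _ _))// [e]splitr lerD ?hr// normM norm_cis mulr1.
by apply/ltW/hr' => //=; rewrite in_itv.
Qed.

Lemma eval_lip l : exists2 L : R, 0 <= L & forall w w' e, cont_path w -> cont_path w' ->
  close_path e w w' -> forall t x : R, 0 <= t <= T ->
  `|(eval l w t x - eval l w' t x : C)| <= L * e.
Proof.
elim: l => [|a l [L L0 hL]].
  by exists 0 => // w w' e _ _ _ t x _; rewrite /eval !big_nil subrr normr0 mul0r.
have [M M0 hM] := amp_lip a; exists (M + L); first exact: addr_ge0.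
move=> w w' e cw cw' ww' t x tT.
rewrite /eval !big_cons -/(eval l w t x) -/(eval l w' t x) opprD addrACA -mulrBl.
rewrite (le_trans (ler_normD _ _))// [leRHS]mulrDl lerD//; last exact: hL.
by rewrite normM norm_cis mulr1; exact: hM.
Qed.

End trigonometric_terms.

(** * Fourier coefficients and limits *)

Section fourier_coefficients.
Context {R : realType}.
Local Notation C := (Rcomplex R).
Local Notation seg a := (`[0%R, a%R]%classic).
Implicit Types (f g : R -> C) (k : int).

Lemma twopi_gt0 : 0 < 2 * pi :> R.
Proof. by rewrite mulr_gt0// pi_gt0. Qed.

Lemma ccont_fourier f k : ccont (seg (2 * pi)) f ->
  ccont (seg (2 * pi)) (fun x => cis (- (k%:~R * x)) * f x).
Proof.
move=> cf; apply: ccontM => //; apply: ccont_cis; apply: continuous_subspaceT => x.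
by apply: cvgN; apply: cvgM; [exact: cvg_cst|exact: cvg_id].
Qed.

Lemma fourier_coefB f g k : ccont (seg (2 * pi)) f -> ccont (seg (2 * pi)) g ->
  fourier_coef (fun x => f x - g x) k = fourier_coef f k - fourier_coef g k.
Proof.
move=> cf cg; rewrite /fourier_coef -scalerBr -cintegralB.
- by congr (_ *: cintegral _ _); apply/funext => x; rewrite mulrBr.
- exact: measurable_seg.
- by apply: ccont_integrable; exact: ccont_fourier.
- by apply: ccont_integrable; exact: ccont_fourier.
Qed.

Lemma fourier_coefD f g k : ccont (seg (2 * pi)) f -> ccont (seg (2 * pi)) g ->
  fourier_coef (fun x => f x + g x) k = fourier_coef f k + fourier_coef g k.
Proof.
move=> cf cg; rewrite /fourier_coef -scalerDr -cintegralD.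
- by congr (_ *: cintegral _ _); apply/funext => x; rewrite mulrDr.
- exact: measurable_seg.
- by apply: ccont_integrable; exact: ccont_fourier.
- by apply: ccont_integrable; exact: ccont_fourier.
Qed.

Lemma norm_fourier_coef f k M : ccont (seg (2 * pi)) f ->
  (forall x : R, 0 <= x <= 2 * pi -> `|f x| <= M) -> `|fourier_coef f k| <= 2 * M.
Proof.
move=> cf fM; have p0 := twopi_gt0; rewrite /fourier_coef normZ ger0_norm ?invr_ge0; last exact: ltW.
rewrite ler_pdivrMl // [leRHS]mulrC.
apply: norm_cintegral_seg; first exact: ltW.
  by apply: ccont_integrable; exact: ccont_fourier.
by move=> x xp; rewrite normM norm_cis mul1r fM.
Qed.

Lemma fourier_coef_cis (c : C) (j k : int) :
  fourier_coef (fun x => c * cis (j%:~R * x)) k = if j == k then c else 0.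
Proof.
rewrite /fourier_coef (_ : (fun x => _) = fun x => c * cis ((j - k)%:~R * x)); last first.
  apply/funext => x; rewrite mulrCA -cisD; congr (_ * cis _).
  by rewrite rmorphB mulrBl addrC.
rewrite cintegralMl; first last.
- by apply: ccont_integrable; exact: ccont_cisl.
- exact: measurable_seg.
rewrite cintegral_cis subr_eq0; case: eqVneq => _; last first.
  by rewrite mulr0n scale0r mulr0 scaler0.
have p0 : 2 * pi != 0 :> R by rewrite gt_eqF// twopi_gt0.
rewrite mulr1n.
apply: complex_eq; rewrite ?ReZ ?ImZ ?ReM ?ImM ?ReZ ?ImZ /=.
  by rewrite mulr1 !mulr0 subr0 mulrCA mulVf ?mulr1.
by rewrite mulr1 !mulr0 add0r mulrCA mulVf ?mulr1.
Qed.

Lemma fourier_coef_eval T (l : seq (@term R T)) w t k :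
  fourier_coef (eval l w t) k = \sum_(a <- l) (if freq a == k then amp a w t else 0).
Proof.
elim: l => [|a l IH].
  rewrite big_nil (_ : eval _ w t = fun=> 0); last first.
    by apply/funext => x; rewrite /eval big_nil.
  rewrite /fourier_coef (_ : (fun x => _) = fun=> 0); last first.
    by apply/funext => x; rewrite mulr0.
  by rewrite cintegral0 ?scaler0//; exact: measurable_seg.
have -> : eval (a :: l) w t = fun x => amp a w t * cis ((freq a)%:~R * x) + eval l w t x.
  by apply/funext => x; rewrite /eval big_cons.
rewrite big_cons -IH fourier_coefD.
- by rewrite fourier_coef_cis.
- by apply: ccontM; [exact: ccont_cst|exact: ccont_cisl].
- exact: eval_contx.
Qed.

Lemma ccont_fourier_coef T (f : R -> R -> C) k :
  (forall t e : R, 0 <= t <= T -> 0 < e -> exists2 r : R, 0 < r &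
     forall s x : R, 0 <= s <= T -> `|t - s| < r -> `|(f t x - f s x : C)| <= e) ->
  (forall t : R, 0 <= t <= T -> ccont (seg (2 * pi)) (f t)) ->
  ccont (seg T) (fun t => fourier_coef (f t) k).
Proof.
move=> hf cf; apply: ccontP => t e tT e0.
have e4 : 0 < e / 4 by rewrite divr_gt0.
have tT' : 0 <= t <= T by move: tT; rewrite /= in_itv.
have [r r0 hr] := hf t _ tT' e4; exists r => // s sT ts.
have sT' : 0 <= s <= T by move: sT; rewrite /= in_itv.
rewrite -fourier_coefB; [|exact: cf|exact: cf].
apply: (@le_lt_trans _ _ (2 * (e / 4))); last by lra.
apply: norm_fourier_coef => [|x _]; last exact: hr.
by apply: ccontD; [exact: cf|apply: ccontN; exact: cf].
Qed.

End fourier_coefficients.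

Section limits.
Context {R : realType}.
Local Notation C := (Rcomplex R).

Lemma geometric_limit (x : nat -> R) (d : R) : 0 <= d ->
  (forall n, `|x n.+1 - x n| <= d / 2 ^+ n) ->
  forall n, `|lim (x @ \oo) - x n| <= 2 * d / 2 ^+ n.
Proof.
move=> d0 h.
have p2 n : 0 < 2 ^+ n :> R by rewrite exprn_gt0.
have hm n m : `|x (m + n)%N - x n| <= 2 * d / 2 ^+ n - 2 * d / 2 ^+ (m + n).
  elim: m => [|m IH]; first by rewrite add0n !subrr normr0.
  have -> : x (m.+1 + n)%N - x n = (x (m.+1 + n)%N - x (m + n)%N) + (x (m + n)%N - x n).
    by ring.
  apply: (le_trans (ler_normD _ _)); have := lerD (h (m + n)%N) IH.
  move=> /le_trans; apply.
  rewrite addSn exprS; move: (p2 (m + n)%N) => p.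
  apply: ler_eq; field.
  by rewrite !gt_eqF.
have hm' n m : `|x (m + n)%N - x n| <= 2 * d / 2 ^+ n.
  apply: (le_trans (hm n m)); rewrite gerBl.
  by apply: divr_ge0; [exact: mulr_ge0|exact: ltW].
have cx : cvgn x.
  apply/cauchy_cvgP/cauchy_ballP => e e0.
  have [k hk] : exists k, 2 * d / 2 ^+ k < e / 2.
    have := @cvg_geometric R (2 * d) (2^-1).
    have -> : `|2^-1 : R| < 1 by rewrite ger0_norm ?invr_ge0// invf_lt1// ltr1n.
    move=> /(_ isT) /cvgrPdist_lt /(_ (e / 2)).
    rewrite divr_gt0// => /(_ isT) [n _ /(_ n (leqnn n))] /=.
    rewrite sub0r normrN ger0_norm; last first.
      by rewrite !mulr_ge0// exprn_ge0// invr_ge0.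
    by rewrite exprVn; exists n.
  exists ([set y | ball (x k) (e / 2) y], [set y | ball (x k) (e / 2) y]).
    split; exists k => // m /= km; rewrite -(subnK km) /ball /= distrC;
    exact: le_lt_trans (hm' k _) hk.
  move=> [a b] /= [ha hb].
  rewrite /ball/= (_ : a - b = - (x k - a) + (x k - b)); last by ring.
  by rewrite (le_lt_trans (ler_normD _ _))// normrN [e]splitr ltrD.
move=> n; apply/ler_addgt0Pr => e e0.
have /cvgrPdist_lt /(_ e e0) [m _ hlim] := cx.
have /hlim /= h1 : (m <= m + n)%N by rewrite leq_addr.
rewrite (_ : _ - x n = (lim (x @ \oo) - x (m + n)%N) + (x (m + n)%N - x n)); last by ring.
rewrite (le_trans (ler_normD _ _))// [leRHS]addrC lerD//.
exact: ltW.
Qed.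

Definition climit (z : nat -> C) : C :=
  Complex (lim ((fun n => complex.Re (z n)) @ \oo)) (lim ((fun n => complex.Im (z n)) @ \oo)).

(** Completeness, with a rate, for sequences with geometric increments. *)
Lemma climitP (z : nat -> C) (d : R) : 0 <= d ->
  (forall n, `|(z n.+1 - z n : C)| <= d / 2 ^+ n) ->
  forall n, `|(climit z - z n : C)| <= 4 * d / 2 ^+ n.
Proof.
move=> d0 h n; apply: (le_trans (norm_le_ReIm _)); rewrite ReD ImD ReN ImN /=.
rewrite (_ : 4 * d / 2 ^+ n = 2 * d / 2 ^+ n + 2 * d / 2 ^+ n); last first.
  by rewrite -mulrDl; congr (_ / _); ring.
apply: lerD; apply: (geometric_limit (x := fun n => _ (z n))) => // m.
  by rewrite -ReN -ReD; exact: le_trans (norm_Re _) (h m).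
by rewrite -ImN -ImD; exact: le_trans (norm_Im _) (h m).
Qed.

End limits.

(** * Solutions by Picard iteration *)

Section picard.
Context {R : realType}.
Variables (T : R).
Hypothesis T0 : 0 <= T.
Local Notation C := (Rcomplex R).
Local Notation seg a := (`[0%R, a%R]%classic).
Local Notation poly := (seq (@term R T)).
Implicit Types (a u v D : poly) (w : R -> R).

Definition mul5 a b c d e : poly :=
  lmul T0 a (lmul T0 (lconj b) (lmul T0 c (lmul T0 (lconj d) e))).

Lemma eval_mul5 (a b c d e : poly) w t x : eval (mul5 a b c d e) w t x =
  eval a w t x * (conjC (eval b w t x) * (eval c w t x *
    (conjC (eval d w t x) * eval e w t x))).
Proof. by rewrite !eval_mul !eval_conj. Qed.

Lemma lnorm_mul5 (a b c d e : poly) : lnorm (mul5 a b c d e) =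
  lnorm a * (lnorm b * (lnorm c * (lnorm d * lnorm e))).
Proof. by rewrite !lnorm_mul !lnorm_conj. Qed.

Lemma lnorm_mul5_le (M N : R) (a b c d e : poly) : lnorm a <= M -> lnorm b <= M ->
  lnorm c <= M -> lnorm d <= M -> lnorm e <= N ->
  lnorm a * (lnorm b * (lnorm c * (lnorm d * lnorm e))) <= M ^+ 4 * N.
Proof.
move=> aM bM cM dM eN; rewrite (_ : M ^+ 4 * N = M * (M * (M * (M * N)))); last by ring.
by do 4![apply: ler_pM => //; rewrite ?mulr_ge0 ?lnorm_ge0//].
Qed.

(** The quintic nonlinearity at u + D minus its value at u, expanded so that each of
the five terms has one factor D. *)
Definition quintic_increment u D : poly :=
  let v := u ++ D in
  mul5 D v v v v ++ mul5 u D v v v ++ mul5 u u D v v ++ mul5 u u u D v ++ mul5 u u u u D.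

Lemma eval_quintic_increment u D w t x : eval (quintic_increment u D) w t x =
  quintic (eval (u ++ D) w t x) - quintic (eval u w t x).
Proof.
rewrite /quintic_increment !eval_cat !eval_mul5 !quinticE !eval_cat.
set z := eval u w t x; set y := eval D w t x.
have -> : conjC (z + y) = conjC z + conjC y.
  by apply: complex_eq; rewrite ?ReD ?ImD /= ?ReD ?ImD ?opprD.
ring.
Qed.

Lemma lnorm_quintic_increment u D (M : R) : lnorm u + lnorm D <= M ->
  lnorm (quintic_increment u D) <= 5 * (M ^+ 4 * lnorm D).
Proof.
move=> h; have u0 := lnorm_ge0 T0 u; have D0 := lnorm_ge0 T0 D.
have uM : lnorm u <= M by apply: le_trans h; rewrite lerDl.
have vM : lnorm (u ++ D) <= M by rewrite lnorm_cat.
have b (p q r s : poly) : lnorm p <= M -> lnorm q <= M -> lnorm r <= M -> lnorm s <= M ->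
    forall x, x = lnorm p * (lnorm q * (lnorm r * (lnorm s * lnorm D))) -> x <= M ^+ 4 * lnorm D.
  by move=> pM qM rM sM x ->; exact: lnorm_mul5_le.
rewrite /quintic_increment !lnorm_cat -!lnorm_cat in vM *.
rewrite !(lnorm_cat _ (mul5 _ _ _ _ _ ++ _), lnorm_cat (mul5 _ _ _ _ _)) !lnorm_mul5.
rewrite (_ : 5 * (M ^+ 4 * lnorm D) = M ^+ 4 * lnorm D + (M ^+ 4 * lnorm D + (M ^+ 4 * lnorm D
   + (M ^+ 4 * lnorm D + M ^+ 4 * lnorm D)))); last by ring.
set v := u ++ D in vM *.
apply: lerD; first by apply: (b v v v v) => //; ring.
apply: lerD; first by apply: (b u v v v) => //; ring.
apply: lerD; first by apply: (b u u v v) => //; ring.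
apply: lerD; first by apply: (b u u u v) => //; ring.
by apply: (b u u u u) => //; ring.
Qed.

Lemma fourier_coef_duh a w t k : cont_path T w -> 0 <= t <= T ->
  fourier_coef (eval (lduh T0 a) w t) k =
  duhamel w k (fun s => fourier_coef (eval a w s) k) t.
Proof.
move=> cw /andP[t0 tT]; rewrite fourier_coef_eval big_map.
rewrite (_ : (fun s => _) = fun s => \sum_(i <- a) (if freq i == k then amp i w s else 0)); last first.
  by apply/funext => s; rewrite fourier_coef_eval.
rewrite (duhamel_sum (T := T))//; last first.
  by move=> i; case: (freq i == k); [exact: amp_cont|exact: ccont_cst].
apply: eq_bigr => i _ /=; case: (eqVneq (freq i) k) => [->//|_].
rewrite /duhamel (_ : (fun s => _) = fun=> 0); last by apply/funext => s; rewrite mulr0.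
by rewrite cintegral0 ?mulr0//; exact: measurable_seg.
Qed.

Lemma eq_fourier_coef (f g : R -> C) k : f =1 g -> fourier_coef f k = fourier_coef g k.
Proof. by move=> fg; have -> : f = g by exact/funext. Qed.

Lemma eq_duhamel w k (f g : R -> C) t : f =1 g -> duhamel w k f t = duhamel w k g t.
Proof. by move=> fg; have -> : f = g by exact/funext. Qed.

Variable u0 : poly.

(** An iterate paired with the increment that leads to the next one. The increment
has to be carried along: cancellations between the lists of terms of two
successive iterates would not be seen by lnorm. *)
Fixpoint picard n : poly * poly :=
  if n is n'.+1 then
    let (u, D) := picard n' in (u ++ D, lduh T0 (quintic_increment u D))
  else (u0, lduh T0 (mul5 u0 u0 u0 u0 u0)).

Definition iterate n := (picard n).1.
Definition increment n := (picard n).2.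

Lemma iterate0 : iterate 0 = u0. Proof. by []. Qed.

Lemma increment0 : increment 0 = lduh T0 (mul5 u0 u0 u0 u0 u0). Proof. by []. Qed.

Lemma iterateS n : iterate n.+1 = iterate n ++ increment n.
Proof. by rewrite /iterate /increment /=; case: (picard n). Qed.

Lemma incrementS n : increment n.+1 = lduh T0 (quintic_increment (iterate n) (increment n)).
Proof. by rewrite /iterate /increment /=; case: (picard n). Qed.

Lemma fourier_coef_contt (l : poly) w k : cont_path T w ->
  ccont (seg T) (fun s => fourier_coef (eval l w s : R -> C) k).
Proof.
move=> cw; rewrite (_ : (fun s => _) = fun s => \sum_(i <- (l : poly)) (if freq i == k then amp i w s else 0)); last first.
  by apply/funext => s; rewrite fourier_coef_eval.
by apply: ccont_sum => i; case: (freq i == k); [exact: amp_cont|exact: ccont_cst].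
Qed.

Lemma quintic_eval_list (l : poly) w s : (fun x => quintic (eval l w s x : C)) = eval (mul5 l l l l l) w s.
Proof. by apply/funext => x; rewrite eval_mul5 quinticE; ring. Qed.

Lemma quintic_evalE (l : poly) w s x : quintic (eval l w s x) = eval (mul5 l l l l l) w s x.
Proof. by rewrite eval_mul5 quinticE; ring. Qed.

Lemma quintic_fourier_coef_contt (l : poly) w k : cont_path T w ->
  ccont (seg T) (fun s => fourier_coef (fun x => quintic (eval l w s x)) k).
Proof.
move=> cw; have -> : (fun s => fourier_coef (fun x => quintic (eval l w s x)) k) =
    fun s => fourier_coef (eval (mul5 l l l l l) w s) k.
  by apply/funext => s; apply: eq_fourier_coef => x; exact: quintic_evalE.
exact: fourier_coef_contt.
Qed.

Lemma addr_sub_eq (c x y z : C) : y = z - x -> c + (x + y) = c + z.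
Proof. by move=> ->; rewrite [x + _]addrC subrK. Qed.

(** The Duhamel integrals of the successive increments telescope. *)
Lemma iterate_mild n w t k : cont_path T w -> 0 <= t <= T ->
  fourier_coef (eval (iterate n.+1) w t) k = fourier_coef (eval u0 w t) k +
    duhamel w k (fun s => fourier_coef (fun x => quintic (eval (iterate n) w s x)) k) t.
Proof.
move=> cw tT; have tleT : t <= T by case/andP: tT.
have catE (l l' : poly) : fourier_coef (eval (l ++ l') w t) k =
    fourier_coef (eval l w t) k + fourier_coef (eval l' w t) k.
  rewrite -fourier_coefD; [|exact: eval_contx|exact: eval_contx].
  by apply: eq_fourier_coef => x; rewrite eval_cat.
elim: n => [|n IH].
  rewrite iterateS catE iterate0 increment0 (fourier_coef_duh _ _ cw tT).
  have E s : fourier_coef (eval (mul5 u0 u0 u0 u0 u0) w s) k =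
      fourier_coef (fun x => quintic (eval u0 w s x)) k.
    by apply: eq_fourier_coef => x; rewrite quintic_evalE.
  by rewrite (eq_duhamel _ _ _ E).
rewrite iterateS catE IH incrementS (fourier_coef_duh _ _ cw tT) -addrA.
set f := fun s => fourier_coef (fun x => quintic (eval (iterate n) w s x)) k.
set g := fun s => fourier_coef (eval (quintic_increment _ _) w s) k.
set h := fun s => fourier_coef (fun x => quintic (eval (iterate n.+1) w s x)) k.
have gE s : g s = h s - f s.
  rewrite /g /h /f -fourier_coefB; first last.
  - by rewrite quintic_eval_list; exact: eval_contx.
  - by rewrite quintic_eval_list; exact: eval_contx.
  by apply: eq_fourier_coef => x; rewrite eval_quintic_increment -iterateS.
apply: addr_sub_eq; rewrite (eq_duhamel _ _ _ gE); apply: (duhamelB (T := T)) => //.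
- exact: quintic_fourier_coef_contt.
- exact: quintic_fourier_coef_contt.
Qed.

Variable A : R.
Hypothesis u0A : lnorm u0 <= A.
Hypothesis smallA : 320 * T * A ^+ 4 <= 1.

Local Notation d := (2 * T * A ^+ 5).

Lemma A_ge0 : 0 <= A. Proof. exact: le_trans (lnorm_ge0 T0 _) u0A. Qed.

Lemma d_ge0 : 0 <= d.
Proof.
apply: mulr_ge0; first exact: mulr_ge0.
by apply: exprn_ge0; exact: A_ge0.
Qed.

Lemma d_small : 160 * d <= A.
Proof.
rewrite (_ : 160 * d = 320 * T * A ^+ 4 * A); last by ring.
by rewrite ler_piMl// A_ge0.
Qed.

(** While the iterates stay below 2 A, one step multiplies the increment by
2 T * 5 (2 A)^4 = 160 T A^4, which is at most 1/2; the first increment is at most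
d = 2 T A^5, so the increments add up to at most 2 d. *)
Lemma picard_bound n : lnorm (iterate n) <= A + 2 * d - 2 * d / 2 ^+ n /\
  lnorm (increment n) <= d / 2 ^+ n.
Proof.
have d0 := d_ge0; have dA := d_small; have A0 := A_ge0.
have dn m : 0 <= d / 2 ^+ m by rewrite divr_ge0// exprn_ge0.
elim: n => [|n [h1 h2]].
  split; first by rewrite expr0 divr1 addrK.
  rewrite expr0 divr1 /increment /= lnorm_duh ler_wpM2l ?mulr_ge0//.
  by rewrite lnorm_mul5 exprSr; exact: lnorm_mul5_le.
have e1 : d / 2 ^+ n.+1 = d / 2 ^+ n / 2 by rewrite [2 ^+ n.+1]exprS invfM mulrA mulrAC.
have e2 m : 2 * d / 2 ^+ m = 2 * (d / 2 ^+ m) by rewrite -[LHS]mulrA.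
have h : lnorm (iterate n) + lnorm (increment n) <= 2 * A.
  by have := dn n; rewrite e2 in h1 *; lra.
split; first by rewrite iterateS lnorm_cat !e2 e1 in h1 *; lra.
rewrite incrementS lnorm_duh e1; have q := lnorm_quintic_increment h.
apply: (le_trans (ler_wpM2l _ q)); first by rewrite mulr_ge0.
rewrite [leLHS](_ : _ = 320 * T * A ^+ 4 * (lnorm (increment n) / 2)); last by field.
apply: (@le_trans _ _ (1 * (lnorm (increment n) / 2))); last by rewrite mul1r ler_pM2r.
by rewrite ler_wpM2r// divr_ge0// lnorm_ge0.
Qed.

Definition solution w t x : C := climit (fun n => eval (iterate n) w t x).

Lemma solution_approx n w t x : cont_path T w -> 0 <= t <= T ->
  `|(solution w t x - eval (iterate n) w t x : C)| <= 4 * d / 2 ^+ n.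
Proof.
move=> cw tT; apply: (climitP d_ge0) => m.
rewrite iterateS eval_cat addrAC subrr add0r.
by apply: le_trans (eval_bnd _ _ cw tT) _; have [] := picard_bound m.
Qed.

(** The nonlinear correction is of fifth order in the size A of the datum. *)
Lemma solution_near_linear w t x : cont_path T w -> 0 <= t <= T ->
  `|(solution w t x - eval u0 w t x : C)| <= 4 * d.
Proof. by move=> cw tT; have := solution_approx 0 x cw tT; rewrite expr0 divr1. Qed.

Lemma solution_bnd w t x : cont_path T w -> 0 <= t <= T -> `|solution w t x| <= 2 * A.
Proof.
move=> cw tT; have h := solution_near_linear x cw tT.
have e : `|eval u0 w t x| <= A by exact: le_trans (eval_bnd _ _ cw tT) u0A.
rewrite -[solution w t x](subrK (eval u0 w t x)) (le_trans (ler_normD _ _))//.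
by have := d_small; have := d_ge0; lra.
Qed.

Lemma iterate_bnd n w t x : cont_path T w -> 0 <= t <= T ->
  `|eval (iterate n) w t x| <= 2 * A.
Proof.
move=> cw tT; apply: (le_trans (eval_bnd _ _ cw tT)).
have [h _] := picard_bound n; apply: (le_trans h).
have : 0 <= d / 2 ^+ n by rewrite divr_ge0 ?exprn_ge0 ?d_ge0.
by have := d_small; have := d_ge0; rewrite -mulrA; lra.
Qed.

Lemma approx_small (K e : R) : 0 <= K -> 0 < e -> exists n, K / 2 ^+ n < e.
Proof.
move=> K0 e0; have := @cvg_geometric R K (2^-1).
have -> : `|2^-1 : R| < 1 by rewrite ger0_norm ?invr_ge0// invf_lt1// ltr1n.
move=> /(_ isT) /cvgrPdist_lt /(_ e e0) [n _ /(_ n (leqnn n))] /=.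
rewrite sub0r normrN ger0_norm; last first.
  by rewrite !mulr_ge0// exprn_ge0// invr_ge0.
by rewrite exprVn; exists n.
Qed.

Lemma lt_via_approx (e : R) (z z' y y' : C) : `|(z - y : C)| < e / 3 ->
  `|(y - y' : C)| <= e / 3 -> `|(z' - y' : C)| < e / 3 -> `|(z - z' : C)| < e.
Proof.
move=> h1 h2 h3; rewrite (_ : z - z' = (z - y) + (y - y') - (z' - y')); last by ring.
apply: (le_lt_trans (ler_normB _ _)); have := ler_normD (z - y) (y - y'); lra.
Qed.

Lemma solution_periodic w t x : solution w t (x + 2 * pi) = solution w t x.
Proof. by rewrite /solution; congr climit; apply/funext => n; exact: eval_periodic. Qed.

Lemma solution_contx (B : set R) w t : cont_path T w -> 0 <= t <= T ->
  ccont B (solution w t).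
Proof.
move=> cw tT; apply: ccontP => x e Bx e0.
have [n hn] := @approx_small (4 * d) (e / 3) (mulr_ge0 (ler0n _ 4) d_ge0) (divr_gt0 e0 (ltr0n _ 3)).
have e3 : 0 < e / 3 by rewrite divr_gt0.
have [r r0 hr] := ccont_dist (eval_contx B (iterate n) w t) Bx e3.
exists r => // y By xy.
apply: lt_via_approx (ltW (hr y By xy)) _; apply: le_lt_trans hn; exact: solution_approx.
Qed.

Lemma solution_contt w t e : cont_path T w -> 0 <= t <= T -> 0 < e ->
  exists2 r : R, 0 < r & forall s x : R, 0 <= s <= T -> `|t - s| < r ->
    `|(solution w t x - solution w s x : C)| <= e.
Proof.
move=> cw tT e0.
have e3 : 0 < e / 3 by rewrite divr_gt0.
have [n hn] := @approx_small (4 * d) (e / 3) (mulr_ge0 (ler0n _ 4) d_ge0) e3.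
have [r r0 hr] := eval_contt (iterate n) cw tT e3.
exists r => // s x sT ts.
apply/ltW/lt_via_approx; [|exact: hr s x sT ts|]; apply: le_lt_trans hn; exact: solution_approx.
Qed.

(** Each iterate is Lipschitz in the path, and the iterates converge uniformly over
all continuous paths. *)
Lemma solution_contw e : 0 < e -> exists2 r : R, 0 < r & forall w w',
  cont_path T w -> cont_path T w' -> close_path T r w w' ->
  forall t x : R, 0 <= t <= T -> `|(solution w t x - solution w' t x : C)| <= e.
Proof.
move=> e0.
have e3 : 0 < e / 3 by rewrite divr_gt0.
have [n hn] := @approx_small (4 * d) (e / 3) (mulr_ge0 (ler0n _ 4) d_ge0) e3.
have [L L0 hL] := eval_lip (iterate n).
have L1 : 0 < L + 1 by lra.
exists (e / 3 / (L + 1)); first by rewrite divr_gt0.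
move=> w w' cw cw' ww' t x tT.
have h : `|(eval (iterate n) w t x - eval (iterate n) w' t x : C)| <= e / 3.
  apply: (le_trans (hL _ _ _ cw cw' ww' t x tT)).
  rewrite mulrA ler_pdivrMr// mulrC ler_pM2l//; lra.
by apply/ltW/(lt_via_approx _ h); apply: le_lt_trans hn; exact: solution_approx.
Qed.

Lemma quintic_solution_coef_cont w (k : int) : cont_path T w ->
  ccont (seg T) (fun s => fourier_coef (fun x => quintic (solution w s x)) k).
Proof.
move=> cw; have A0 := A_ge0.
apply: ccont_fourier_coef => [s e sT e0|s sT]; last exact/ccont_quintic/solution_contx.
have K0 : 0 < 5 * (2 * A) ^+ 4 + 1.
  by rewrite ltr_wpDl// mulr_ge0// exprn_ge0// mulr_ge0.
have [r r0 hr] := solution_contt cw sT (divr_gt0 e0 K0).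
exists r => // s' x s'T ss'.
apply: (le_trans (quintic_lip (solution_bnd x cw sT) (solution_bnd x cw s'T))).
apply: (le_trans (ler_wpM2l _ (hr s' x s'T ss'))); first by rewrite mulr_ge0// exprn_ge0// mulr_ge0.
by rewrite mulrA ler_pdivrMr// [leLHS]mulrC ler_pM2l// lerDl.
Qed.

(** Limit of the recursion satisfied by the iterates, uniformly in time and space. *)
Lemma solution_mild w t k : cont_path T w -> 0 <= t <= T ->
  fourier_coef (solution w t) k = fourier_coef (eval u0 w t) k +
    duhamel w k (fun s => fourier_coef (fun x => quintic (solution w s x)) k) t.
Proof.
move=> cw tT; have d0 := d_ge0; have A0 := A_ge0.
have cq s : 0 <= s <= T -> ccont (seg (2 * pi)) (fun x => quintic (solution w s x)).
  by move=> sT; apply: ccont_quintic; exact: solution_contx.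
have qlip s n x : 0 <= s <= T -> `|(quintic (solution w s x) - quintic (eval (iterate n) w s x) : C)| <=
    5 * (2 * A) ^+ 4 * (4 * d / 2 ^+ n).
  move=> sT; apply: (le_trans (quintic_lip (solution_bnd x cw sT) (iterate_bnd n x cw sT))).
  by rewrite ler_wpM2l ?solution_approx// mulr_ge0// exprn_ge0// mulr_ge0.
have cft := quintic_solution_coef_cont k cw.
set K := 8 * d + 2 * T * (2 * (5 * (2 * A) ^+ 4 * (4 * d))).
have K0 : 0 <= K by rewrite addr_ge0 ?mulr_ge0// ?exprn_ge0// ?mulr_ge0.
apply/eqP; rewrite -subr_eq0 -normr_le0; apply/ler_addgt0Pr => e e0; rewrite add0r.
have [n hn] := approx_small K0 e0.
apply: le_trans (ltW hn).
have cqn s : ccont (seg (2 * pi)) (fun x => quintic (eval (iterate n) w s x)).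
  by rewrite quintic_eval_list; exact: eval_contx.
have cfn : ccont (seg T) (fun s => fourier_coef (fun x => quintic (eval (iterate n) w s x)) k).
  exact: quintic_fourier_coef_contt.
set X := fourier_coef (solution w t) k; set Y := duhamel w k _ t.
set Xn := fourier_coef (eval (iterate n.+1) w t) k.
have hX : `|(X - Xn : C)| <= 2 * (4 * d / 2 ^+ n).
  rewrite /X /Xn -fourier_coefB; [|exact: solution_contx|exact: eval_contx].
  apply: norm_fourier_coef.
    by apply: ccontD; [exact: solution_contx|apply: ccontN; exact: eval_contx].
  move=> x _; apply: (le_trans (solution_approx n.+1 x cw tT)).
  rewrite ler_wpM2l ?mulr_ge0// lef_pV2 ?posrE ?exprn_gt0//.
  by rewrite ler_eXn2l ?ltr1n.
pose Yn := duhamel w k (fun s => fourier_coef (fun x => quintic (eval (iterate n) w s x)) k) t.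
have hY : `|(Y - Yn : C)| <= 2 * T * (2 * (5 * (2 * A) ^+ 4 * (4 * d / 2 ^+ n))).
  rewrite /Y /Yn -(duhamelB (T := T))//; last by case/andP: tT.
  apply: (duhamel_bnd (T := T)) => //.
    by apply: ccontD => //; exact: ccontN.
  move=> s sT; rewrite -fourier_coefB//; last exact: cq.
  apply: norm_fourier_coef; last by move=> x _; exact: qlip.
  by apply: ccontD; [exact: cq|exact: ccontN].
have E : Xn = fourier_coef (eval u0 w t) k + Yn by exact: iterate_mild.
have -> : X - (fourier_coef (eval u0 w t) k + Y) = (X - Xn) - (Y - Yn).
  by rewrite E; ring.
apply: (le_trans (ler_normB _ _)); apply: (le_trans (lerD hX hY)).
by apply: ler_eq; rewrite /K; ring.
Qed.

End picard.

(** * Classes modulo null vectors *)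

Section separated_quotient.
Context (R : realType) (V : lmodType R) (E : seminormed V).
Implicit Types (x y : V).

Lemma to_sep_add x y (dx : dom E x) (dy : dom E y) :
  to_sep dx + to_sep dy = to_sep (domD dx dy).
Proof. exact: to_sepD. Qed.

Lemma to_sep_scale a x (dx : dom E x) : a *: to_sep dx = to_sep (domZ a dx).
Proof. exact: to_sepZ. Qed.

Lemma to_sep_sub x y (dx : dom E x) (dy : dom E y) :
  to_sep dx - to_sep dy = to_sep (domB dx dy).
Proof.
by rewrite -[- to_sep dy]scaleN1r to_sep_scale to_sep_add; apply: to_sep_ext; rewrite scaleN1r.
Qed.

Lemma norm_to_sep x (dx : dom E x) : `|to_sep dx| = semi E x.
Proof. by rewrite sep_normE semi_rep. Qed.

(** The class of x, made total by the value 0 outside the domain. *)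
Definition cls x : sep E := if pselect (dom E x) is left dx then to_sep dx else 0.

Lemma clsE x (dx : dom E x) : cls x = to_sep dx.
Proof. by rewrite /cls; case: pselect => // dx'; exact: to_sep_ext. Qed.

Lemma norm_cls_sub x y : dom E x -> dom E y -> `|cls x - cls y| = semi E (x - y).
Proof. by move=> dx dy; rewrite (clsE dx) (clsE dy) to_sep_sub norm_to_sep. Qed.

Lemma norm_cls x : dom E x -> `|cls x| = semi E x.
Proof. by move=> dx; rewrite (clsE dx) norm_to_sep. Qed.

Lemma rep_cls x : dom E x -> semi E (rep (cls x) - x) = 0.
Proof. by move=> dx; rewrite (clsE dx) to_sepK. Qed.

Lemma clsZ a x : dom E x -> cls (a *: x) = a *: cls x.
Proof. by move=> dx; rewrite (clsE dx) to_sep_scale -clsE. Qed.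

End separated_quotient.

Section null_sets.
Context {R : realType}.
Local Notation mu := (@lebesgue_measure R).

Lemma lebesgue_shift (c : R) (A : set (measurableTypeR R)) : measurable A ->
  mu [set x | A (x + c)] = mu A.
Proof.
move=> mA.
pose f (x : measurableTypeR R) : measurableTypeR R := x + c.
have mf : measurable_fun setT f by exact: measurable_funD.
pose m : {measure set (measurableTypeR R) -> \bar R} :=
  measure_function_pushforward__canonical__measure_function_Measure mu mf.
have -> : mu [set x | A (x + c)] = m A by [].
apply/esym/(@lebesgue_measure_unique R m) => // _ [[a b] _ <-].
rewrite /m /= /pushforward (_ : f @^-1` _ = `]a - c, b - c]%classic).
  by rewrite !lebesgue_measure_itv/= !lte_fin ltrD2r -EFinB; case: ifP => // _; congr _%:E; ring.
by apply/seteqP; split => x /=; rewrite !in_itv/= ltrBlDr lerBrDr.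
Qed.

Lemma negligible_shift (c : R) (N : set (measurableTypeR R)) :
  mu.-negligible N -> mu.-negligible [set x | N (x + c)].
Proof.
move=> [A [mA A0 NA]]; exists [set x | A (x + c)]; split.
- have mf : measurable_fun setT (fun x : measurableTypeR R => (x + c : measurableTypeR R)).
    exact: measurable_funD.
  by have := mf measurableT A mA; rewrite setTI.
- by rewrite lebesgue_shift.
- by move=> x /=; exact: NA.
Qed.

(** The exceptional set is covered by countably many translates of its part over one
period. *)
Lemma ae_periodic (p : R) (Q : R -> Prop) : 0 < p -> (forall x, Q x <-> Q (x + p)) ->
  {ae mu, forall x, `[0, p]%classic x -> Q x} -> {ae mu, forall x, Q x}.
Proof.
move=> p0 perQ; rewrite /almost_everywhere /= => h.
pose N := ~` [set x : measurableTypeR R | `[0, p]%classic x -> Q x].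
have hN n : mu.-negligible ([set x | N (x + n%:R * p)] `|` [set x | N (x + - (n%:R * p))]).
  by apply: negligibleU; exact: negligible_shift.
apply: negligibleS (negligible_bigcup hN) => x /= nQ.
have Qn (n : nat) y : Q y <-> Q (y + n%:R * p).
  elim: n => [|n IH]; first by rewrite mul0r addr0.
  by rewrite IH perQ -natr1 mulrDl mul1r addrA.
have p0' : p != 0 by rewrite gt_eqF.
(* the translate of x into the period is x - k p *)
pose k := Num.floor (x / p).
have /andP[k1 k2] : k%:~R <= x / p < (k + 1)%:~R by rewrite floor_le floorD1_gt.
have xk : `[0, p]%classic (x - k%:~R * p).
  rewrite /= in_itv/= subr_ge0 -ler_pdivlMr// k1/= lerBlDr.
  rewrite -[X in X + _]mul1r -mulrDl -ler_pdivrMr// ltW//.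
  by move: k2; rewrite intrD addrC.
move: xk; case: k {k1 k2} => n xk.
  exists n => //; right; apply/not_implyP; split => //.
  by rewrite (Qn n) subrK.
exists n.+1 => //; left; move: xk; rewrite NegzE mulrNz mulNr opprK => xk.
by apply/not_implyP; split=> //; rewrite -(Qn n.+1).
Qed.

End null_sets.

(** * Square integrable periodic functions *)

Section square_integrable.
Context {R : realType}.
Local Notation C := (Rcomplex R).
Local Notation mu := (@lebesgue_measure R).
Local Notation period := (`[0 : R, 2 * pi]%classic).
Implicit Types (f g : R -> C).

Lemma ae_imp (P Q : R -> Prop) : {ae mu, forall x, P x} -> (forall x, P x -> Q x) ->
  {ae mu, forall x, Q x}.
Proof.
move=> hP PQ; apply: (@negligibleS _ _ _ mu) hP => x /= nQ Px; exact/nQ/PQ.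
Qed.

Lemma measurable_period : measurable (period : set (measurableTypeR R)).
Proof. exact: measurable_itv. Qed.

Lemma ccont_cmeasurable f : ccont setT f -> cmeasurable f.
Proof.
have aux (h : R -> R) : {within setT, continuous h} -> measurable_fun setT h.
  by move=> ch; apply: subspace_continuous_measurable_fun.
by move=> [/aux cr /aux ci].
Qed.

Lemma L2_dom_cont f : (forall x, f (x + 2 * pi) = f x) -> ccont setT f -> L2_dom f.
Proof.
move=> pf cf; split=> //; first exact: ccont_cmeasurable.
apply: within_integrable.
have := ccont_norm (ccont_sub (@subsetT _ period) cf).
by move=> cn x; apply: cvgM; exact: cn.
Qed.

Lemma L2_semi_bnd f (M : R) : 0 <= M -> L2_dom f ->
  (forall x, `|f x| <= M) -> L2_semi f <= M * Num.sqrt (2 * pi).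
Proof.
move=> M0 [_ _ If] fM; rewrite /L2_semi -[M]ger0_norm// -sqrtr_sqr -sqrtrM ?sqr_ge0//.
apply: ler_wsqrtr; rewrite -(Rintegral_seg_cst (M ^+ 2) (ltW twopi_gt0)).
apply: (le_Rintegral measurable_period If).
  by apply: within_integrable => x; exact: cvg_cst.
by move=> x _; rewrite ler_pXn2r// nnegrE.
Qed.

(** This turns equality of classes into equality almost everywhere, hence lets the
mild equation, which speaks of chosen representatives, be checked on continuous
functions. *)
Lemma L2_semi_eq0 f : L2_dom f -> L2_semi f = 0 ->
  {ae mu, forall x, period x -> f x = 0}.
Proof.
move=> [_ mf If] f0.
have i0 : 0 <= \int[mu]_(x in period) (`|f x| ^+ 2).
  by apply: Rintegral_ge0 => x _; exact: sqr_ge0.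
have : \int[mu]_(x in period) (`|f x| ^+ 2) = 0.
  by move: f0; rewrite /L2_semi => /eqP; rewrite sqrtr_eq0 => h; apply/eqP; rewrite eq_le h.
move=> I0.
have mn : measurable_fun period (fun x => (`|f x| ^+ 2)%:E).
  apply/measurable_EFinP; apply: measurable_funTS; apply: measurable_funX.
  exact: cmeasurable_norm.
have : (\int[mu]_(x in period) `|(`|f x| ^+ 2)%:E| = 0)%E.
  under eq_integral do rewrite abse_EFin ger0_norm ?sqr_ge0//.
  have fin := integrable_fin_num measurable_period If.
  by rewrite -(fineK fin); congr EFin; exact: I0.
move=> /(ae_eq_integral_abs mu measurable_period mn); apply: filterS => x h px.
have /eqP := h px; rewrite eqe sqrf_eq0 normr_eq0 => /eqP.
by [].
Qed.

Lemma rep_cls_ae f : L2_dom f ->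
  {ae mu, forall x, period x -> rep (cls (L2_seminormed R) f) x = f x}.
Proof.
move=> df; have dr := rep_dom (cls (L2_seminormed R) f).
have := L2_semi_eq0 (domB dr df) (rep_cls (E := L2_seminormed R) df).
by move=> /ae_imp; apply => x h px; apply/eqP; rewrite -subr_eq0; apply/eqP/h.
Qed.

Lemma cmeasurable_quintic f : cmeasurable f -> cmeasurable (fun x => quintic (f x)).
Proof.
move=> mf; have [fr fi] := mf; have mn := cmeasurable_norm mf; split.
  under eq_fun do rewrite ReZ.
  by apply: measurable_funM => //; exact: measurable_funX.
under eq_fun do rewrite ImZ.
by apply: measurable_funM => //; exact: measurable_funX.
Qed.

Lemma cmeasurableM f g : cmeasurable f -> cmeasurable g -> cmeasurable (fun x => f x * g x).
Proof.
move=> [fr fi] [gr gi]; split.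
  by under eq_fun do rewrite ReM; apply: measurable_funB; exact: measurable_funM.
by under eq_fun do rewrite ImM; apply: measurable_funD; exact: measurable_funM.
Qed.

Lemma cmeasurable_cis (a : R) : cmeasurable (fun x => cis (- (a * x))).
Proof.
apply: ccont_cmeasurable; apply: ccont_cis; apply: continuous_subspaceT => x.
by apply: cvgN; apply: cvgM; [exact: cvg_cst|exact: cvg_id].
Qed.

Lemma ae_eq_cintegral f g : cmeasurable f -> cmeasurable g ->
  {ae mu, forall x, period x -> f x = g x} -> cintegral period f = cintegral period g.
Proof.
move=> [fr fi] [gr gi] fg; apply: complex_eq => /=; congr fine;
  apply: ae_eq_integral => //; try exact: measurable_period;
  try by apply/measurable_EFinP; exact: measurable_funTS.
- by apply: (ae_imp fg) => x h px; rewrite h.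
- by apply: (ae_imp fg) => x h px; rewrite h.
Qed.

Lemma ae_eq_fourier_coef f g k : cmeasurable f -> cmeasurable g ->
  {ae mu, forall x, period x -> f x = g x} -> fourier_coef f k = fourier_coef g k.
Proof.
move=> mf mg fg; rewrite /fourier_coef; congr (_ *: _).
apply: ae_eq_cintegral.
- by apply: cmeasurableM => //; exact: cmeasurable_cis.
- by apply: cmeasurableM => //; exact: cmeasurable_cis.
- by apply: (ae_imp fg) => x h px; rewrite h.
Qed.

Lemma rep_cmeasurable (c : L2_torus R) : cmeasurable (rep c).
Proof. by have [_ mr _] := rep_dom c. Qed.

Lemma fourier_coef_cls f k : L2_dom f ->
  fourier_coef (rep (cls (L2_seminormed R) f)) k = fourier_coef f k.
Proof.
move=> df; apply: ae_eq_fourier_coef; first exact: rep_cmeasurable.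
  by case: df.
exact: rep_cls_ae.
Qed.

Lemma quintic_fourier_coef_cls f k : L2_dom f ->
  fourier_coef (fun x => quintic (rep (cls (L2_seminormed R) f) x)) k =
  fourier_coef (fun x => quintic (f x)) k.
Proof.
move=> df; apply: ae_eq_fourier_coef.
- exact/cmeasurable_quintic/rep_cmeasurable.
- by apply: cmeasurable_quintic; case: df.
- by apply: (ae_imp (rep_cls_ae df)) => x h px; rewrite h.
Qed.

Lemma rep_cls_bnd f M : L2_dom f -> (forall x, `|f x| <= M) ->
  {ae mu, forall x, `|rep (cls (L2_seminormed R) f) x| <= M}.
Proof.
move=> df fM; have [pr _ _] := rep_dom (cls (L2_seminormed R) f).
apply: (ae_periodic twopi_gt0).
  by move=> x; rewrite pr.
by apply: (ae_imp (rep_cls_ae df)) => x h px; rewrite h.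
Qed.

Lemma quintic_integral_cls f : L2_dom f ->
  (\int[mu]_(x in period) (`|quintic (rep (cls (L2_seminormed R) f) x)|)%:E =
   \int[mu]_(x in period) (`|quintic (f x)|)%:E)%E.
Proof.
move=> df; apply: ae_eq_integral; first exact: measurable_period.
- apply/measurable_EFinP; apply: measurable_funTS; apply: cmeasurable_norm.
  exact/cmeasurable_quintic/rep_cmeasurable.
- apply/measurable_EFinP; apply: measurable_funTS; apply: cmeasurable_norm.
  by apply: cmeasurable_quintic; case: df.
- by apply: (ae_imp (rep_cls_ae df)) => x h px; rewrite h.
Qed.

End square_integrable.

(** * Approximation of paths by simple maps *)

Section path_approximation.
Context {R : realType}.
Variable T : R.
Local Notation seg a := (`[0%R, a%R]%classic).

(** Heine's theorem on [0, T]. *)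
Lemma cont_path_unif (w : R -> R) (e : R) : cont_path T w -> 0 < e ->
  exists2 r : R, 0 < r & forall s t : R, 0 <= s <= T -> 0 <= t <= T ->
    `|s - t| < r -> `|w s - w t| <= e.
Proof.
move=> cw e0; have e2 : 0 < e / 2 by rewrite divr_gt0.
have /compact_near_coveringP ncov := @segment_compact R 0 T.
have [|r /= r0 hr] := ncov R (0^'+) (fun r x => seg T x -> forall y, seg T y ->
    `|x - y| < r -> `|w x - w y| <= e) _.
  move=> x xT.
  move/subspace_continuousP: cw => /(_ x xT) /cvgrPdist_lt /(_ _ e2).
  rewrite /= near_withinE => /nbhs_normP[r /= r0 hr].
  have r2 : 0 < r / 2 by rewrite divr_gt0.
  exists ([set y | `|x - y| < r / 2], [set i | i < r / 2]).
    split; first by apply/nbhs_normP; exists (r / 2).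
    exact: nbhs_right_lt.
  move=> [x' i] /= [xx' ir] x'T y yT x'y.
  have xy : `|x - y| < r.
    rewrite (_ : x - y = (x - x') + (x' - y)); last by ring.
    rewrite (le_lt_trans (ler_normD _ _))// [r]splitr ltrD//.
    exact: lt_trans ir.
  have h1 : `|w x - w x'| < e / 2.
    by apply: hr => //; apply: lt_le_trans xx' _; lra.
  have h2 := hr y xy yT.
  rewrite (_ : w x' - w y = - (w x - w x') + (w x - w y)); last by ring.
  rewrite (le_trans (ler_normD _ _))// normrN [e]splitr lerD//; exact: ltW.
exists (r / 2); first by rewrite divr_gt0.
move=> s t sT tT st.
have r2 : 0 < r / 2 by rewrite divr_gt0.
have r2r : `|0 - r / 2| < r by rewrite sub0r normrN gtr0_norm//; lra.
by apply: (hr (r / 2) r2r r2 s) => //=; rewrite in_itv.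
Qed.

Lemma cont_path_bounded (w : R -> R) : cont_path T w ->
  exists M : R, forall t : R, 0 <= t <= T -> `|w t| <= M.
Proof.
move=> cw; have cn : {within seg T, continuous (fun t => `|w t|)}.
  by move=> x; apply: cvg_norm; exact: cw.
have /compact_bounded[M [Mr MP]] := continuous_compact cn (@segment_compact R 0 T).
exists (M + 1) => t tT.
have := MP (M + 1); rewrite ltrDl ltr01 => /(_ isT `|w t|).
by rewrite /globally /= normr_id; apply; exists t => //=; rewrite in_itv.
Qed.

Definition ramp (y : R) : R := Num.min 1 (Num.max 0 y).

Lemma ramp_cont : continuous ramp.
Proof.
move=> y; apply: continuous_min; first exact: cvg_cst.
by apply: continuous_max; [exact: cvg_cst|exact: cvg_id].
Qed.

(** The continuous function with value a j at j for j = 0, ..., N, affine in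
between and constant outside [0, N]. *)
Fixpoint interp (a : nat -> R) (N : nat) (y : R) : R :=
  if N is N'.+1 then interp a N' y + (a N - a N') * ramp (y - N'%:R) else a 0.

Lemma interp_cont a N : continuous (interp a N).
Proof.
elim: N => [|N IH] y /=; first exact: cvg_cst.
have cr : continuous (fun x : R => ramp (x - N%:R)).
  move=> z; apply: (@continuous_comp _ _ _ (fun x : R => x - N%:R) ramp).
    by apply: cvgB; [exact: cvg_id|exact: cvg_cst].
  exact: ramp_cont.
apply: cvgD; first exact: IH.
by apply: cvgM; [exact: cvg_cst|exact: cr].
Qed.

Lemma interp_ge a N y : N%:R <= y -> interp a N y = a N.
Proof.
elim: N y => [//|N IH] y /=; rewrite -natr1 => Ny.
rewrite IH; last by lra.
have -> : ramp (y - N%:R) = 1.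
  by rewrite /ramp min_l// le_max; apply/orP; right; lra.
by rewrite mulr1 addrC subrK.
Qed.

Lemma interp_close a N y c (e : R) : 0 <= y <= N%:R ->
  (forall j, (j <= N)%N -> `|j%:R - y| <= 1 -> `|a j - c| <= e) ->
  `|interp a N y - c| <= e.
Proof.
elim: N => [|N IH] /andP[y0 yN] h.
  by apply: h => //; rewrite (_ : y = 0) ?subrr ?normr0//; apply/eqP; rewrite eq_le y0 andbT.
move=> /=; have [yN'|Ny] := leP y N%:R.
  have -> : ramp (y - N%:R) = 0.
    by rewrite /ramp max_l ?min_r//; lra.
  rewrite mulr0 addr0; apply: IH; first by rewrite y0.
  by move=> j jN; apply: h; exact: leqW.
rewrite interp_ge; last exact: ltW.
rewrite -natr1 in yN.
have -> : ramp (y - N%:R) = y - N%:R.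
  by rewrite /ramp max_r ?min_r//; lra.
set s := y - N%:R.
have h1 : `|a N - c| <= e by apply: h => //; rewrite ler_norml; apply/andP; split; lra.
have h2 : `|a N.+1 - c| <= e by apply: h => //; rewrite -natr1 ler_norml; apply/andP; split; lra.
rewrite (_ : _ - c = (1 - s) * (a N - c) + s * (a N.+1 - c)); last by ring.
rewrite (le_trans (ler_normD _ _))// !normrM.
have s0 : 0 <= s by rewrite /s; lra.
have s1 : 0 <= 1 - s by rewrite /s; lra.
rewrite (ger0_norm s0) (ger0_norm s1); nra.
Qed.

(** Rounding down to the grid b, b + h, ..., b + K h, written as a sum of indicators
so that rounding a random variable is visibly a simple map. *)
Definition grid_round (b h : R) (K : nat) (x : R) : R :=
  b + h * \sum_(j < K) (b + j.+1%:R * h <= x)%R%:R.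

Lemma grid_round_close b h K x : 0 < h -> b <= x <= b + K%:R * h ->
  `|grid_round b h K x - x| <= h.
Proof.
move=> h0; rewrite /grid_round; elim: K => [|K IH] /andP[bx xK].
  rewrite big_ord0 mulr0 addr0 (_ : x = b); first by rewrite subrr normr0 ltW.
  by apply/eqP; rewrite eq_le bx andbT; move: xK; rewrite mul0r addr0.
rewrite big_ord_recr /=; have [xK'|Kx] := leP x (b + K%:R * h).
  have -> : (b + K.+1%:R * h <= x) = false.
    by apply/negbTE; rewrite -ltNge; apply: le_lt_trans xK' _; rewrite -natr1; nra.
  by rewrite addr0; apply: IH; rewrite bx.
have -> : \sum_(j < K) (b + j.+1%:R * h <= x)%R%:R = K%:R :> R.
  rewrite -[RHS]mulr1 mulr_natl -[in RHS](card_ord K) -sumr_const.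
  apply: eq_bigr => j _; have -> // : b + j.+1%:R * h <= x.
  apply: le_trans (ltW Kx); rewrite lerD2l ler_pM2r// ler_nat.
  exact: ltn_ord.
rewrite -natr1 in xK *; rewrite ler_norml; case: (leP (b + (K%:R + 1) * h) x) => /= hx.
  by apply/andP; split; nra.
by rewrite addr0; apply/andP; split; nra.
Qed.

End path_approximation.

Section random_paths.
Context {R : realType} {d : measure_display} {Omega : measurableType d}.
Variable T : R.
Hypothesis T_gt0 : 0 < T.
Variable X : R -> Omega -> R.
Hypothesis Xcont : forall w, cont_path T (X ^~ w).
Hypothesis Xmeas : forall t : R, 0 <= t <= T -> measurable_fun setT (X t).

Lemma simple_map_cst (E : Type) (e : E) : simple_map (fun _ : Omega => e).
Proof.
split=> [|e'].
  by apply: (@sub_finite_set _ _ [set e]) => // _ [w _ <-].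
have [->|ne] := pselect (e = e').
  by rewrite (_ : _ @^-1` _ = setT) //; apply/seteqP.
by rewrite (_ : _ @^-1` _ = set0) //; apply/seteqP; split.
Qed.

Lemma simple_map_comp (E F : Type) (g : E -> F) (s : Omega -> E) :
  simple_map s -> simple_map (fun w => g (s w)).
Proof. by move=> ss; exact: (simple_map2 (fun x _ => g x) ss ss). Qed.

Lemma simple_map_ge (Z : Omega -> R) (c : R) : measurable_fun setT Z ->
  simple_map (fun w => c <= Z w).
Proof.
move=> mZ.
have mT : measurable [set w | c <= Z w].
  have := mZ measurableT `[c, +oo[%classic (measurable_itv _).
  by rewrite setTI; congr measurable; apply/seteqP; split => w /=; rewrite in_itv/= andbT.
split=> [|[]]; first exact: finite_finset.
- by rewrite (_ : _ @^-1` _ = [set w | c <= Z w]).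
- rewrite (_ : _ @^-1` _ = ~` [set w | c <= Z w]); first exact: measurableC.
  by apply/seteqP; split => w /= => [->|/negP/negbTE].
Qed.

Lemma simple_map_round (Z : Omega -> R) b h K : measurable_fun setT Z ->
  simple_map (fun w => grid_round b h K (Z w)).
Proof.
move=> mZ; rewrite /grid_round.
apply: (@simple_map_comp _ _ (fun s : R => b + h * s)).
elim: K => [|K IH].
  by under eq_fun do rewrite big_ord0; exact: simple_map_cst.
under eq_fun do rewrite big_ord_recr.
apply: (simple_map2 (fun (s : R) (q : bool) => s + q%:R)) => //.
exact: simple_map_ge.
Qed.

Lemma simple_map_interp (a : nat -> Omega -> R) N :
  (forall j, (j <= N)%N -> simple_map (a j)) ->
  simple_map (fun w => interp (fun j => a j w) N).
Proof.
elim: N => [|N IH] h /=.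
  apply: (@simple_map_comp _ _ (fun (c : R) (_ : R) => c)); exact: h.
apply: (simple_map2 (fun (f : R -> R) (p : R) => fun y => f y + p * ramp (y - N%:R))).
  by apply: IH => j jN; apply: h; exact: leqW.
by apply: (simple_map2 (fun x y : R => x - y)); apply: h.
Qed.

(** The path sampled at the times j T / (n + 1), the samples being rounded to a grid
of mesh 1 / (n + 1) in [- n, n], then interpolated linearly. As a function of
omega it takes finitely many values, and each of them is a continuous path. *)
Definition approx_path (n : nat) (w : Omega) (t : R) : R :=
  interp (fun j => grid_round (- n%:R) (n.+1%:R^-1) (2 * n * n.+1)
            (X (j%:R * T / n.+1%:R) w)) n.+1 (t * n.+1%:R / T).

Lemma grid_time (n j : nat) : (j <= n.+1)%N -> 0 <= j%:R * T / n.+1%:R <= T.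
Proof.
move=> jn; have T0 := ltW T_gt0; rewrite divr_ge0 ?mulr_ge0//=.
by rewrite ler_pdivrMr// mulrC ler_pM2l// ler_nat.
Qed.

Lemma simple_map_approx n : simple_map (approx_path n).
Proof.
have h : simple_map (fun w => interp (fun j => grid_round (- n%:R) (n.+1%:R^-1)
    (2 * n * n.+1) (X (j%:R * T / n.+1%:R) w)) n.+1).
  apply: (@simple_map_interp (fun j w => grid_round _ _ _ (X _ w))) => j jn.
  by apply: simple_map_round; apply/Xmeas/grid_time.
exact: (simple_map_comp (fun (f : R -> R) t => f (t * n.+1%:R / T)) h).
Qed.

Lemma approx_path_cont n w : cont_path T (approx_path n w).
Proof.
apply: continuous_subspaceT => t; rewrite /approx_path.
apply: (@continuous_comp _ _ _ (fun t : R => t * n.+1%:R / T) (interp _ _)); last exact: interp_cont.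
by apply: cvgM; [apply: cvgM; [exact: cvg_id|exact: cvg_cst]|exact: cvg_cst].
Qed.

Lemma approx_path_close (e : R) w : 0 < e ->
  exists N, forall n, (N <= n)%N -> close_path T e (X ^~ w) (approx_path n w).
Proof.
move=> e0; have e2 : 0 < e / 2 by rewrite divr_gt0.
have [r r0 hr] := cont_path_unif (@Xcont w) e2.
have [M hM] := cont_path_bounded (@Xcont w).
(* for n >= m the time step is less than r, the path stays in [- n, n], and the
   mesh of the grid of values is less than e / 2 *)
pose m := maxn (Num.truncn (T / r)) (maxn (Num.truncn M).+1 (Num.truncn (2 / e))).
exists m => n mn t tT; rewrite distrC.
have n0 : 0 < n.+1%:R :> R by rewrite ltr0n.
have trn (x : R) : (Num.truncn x <= n)%N -> x < n.+1%:R.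
  move=> xn; apply: lt_le_trans (truncnS_gt x) _.
  by rewrite ler_nat ltnS.
have h1 : T / r < n.+1%:R by apply: trn; apply: leq_trans mn; rewrite leq_maxl.
have h2 : M <= n%:R.
  apply: le_trans (ltW (truncnS_gt M)) _; rewrite ler_nat; apply: leq_trans mn.
  by rewrite /m (leq_trans _ (leq_maxr _ _))// leq_maxl.
have h3 : 2 / e < n.+1%:R.
  by apply: trn; apply: leq_trans mn; rewrite /m (leq_trans _ (leq_maxr _ _))// leq_maxr.
have h4 : n.+1%:R^-1 < e / 2.
  by rewrite -[e / 2]invrK ltf_pV2 ?posrE ?invr_gt0// invf_div.
have h5 : T / n.+1%:R < r.
  by rewrite ltr_pdivrMr// mulrC -ltr_pdivrMr.
case/andP: (tT) => t0 tleT.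
apply: interp_close.
  rewrite divr_ge0 ?mulr_ge0//=; last exact: ltW.
  by rewrite ler_pdivrMr// mulrC ler_pM2l.
move=> j jn jy; set s := j%:R * T / n.+1%:R.
have sT : 0 <= s <= T by exact: grid_time.
have st : `|s - t| < r.
  apply: le_lt_trans h5.
  have -> : s - t = (j%:R - t * n.+1%:R / T) * (T / n.+1%:R).
    by rewrite /s; field; rewrite !gt_eqF.
  have p : 0 < T / n.+1%:R by rewrite divr_gt0.
  by rewrite normrM (gtr0_norm p) ler_piMl// ltW.
have g : `|grid_round (- n%:R) n.+1%:R^-1 (2 * n * n.+1) (X s w) - X s w| <= n.+1%:R^-1.
  apply: grid_round_close; first by rewrite invr_gt0.
  have := le_trans (hM s sT) h2; rewrite ler_norml => /andP[-> h] /=.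
  by apply: le_trans h _; rewrite !natrM mulfK ?gt_eqF//; lra.
rewrite (_ : _ - X t w = (grid_round (- n%:R) n.+1%:R^-1 (2 * n * n.+1) (X s w) - X s w) +
  (X s w - X t w)); last by ring.
apply: (le_trans (ler_normD _ _)); rewrite [e]splitr lerD//; last exact: hr.
exact: le_trans g (ltW h4).
Qed.

(** Strong measurability asks for approximation by maps with finitely many values: Y
is uniformly continuous on continuous paths, and it is composed with the rounded
interpolations of X, which converge uniformly in time. *)
Lemma strongly_measurable_path (E : normedModType R) (Y : (R -> R) -> E) :
  (forall e : R, 0 < e -> exists2 r : R, 0 < r & forall w w',
     cont_path T w -> cont_path T w' -> close_path T r w w' -> `|Y w - Y w'| <= e) ->
  strongly_measurable (fun w => Y (X ^~ w)).
Proof.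
move=> hY; exists (fun n w => Y (approx_path n w)); split=> [n|w].
  exact: (simple_map_comp _ (simple_map_approx n)).
apply/cvgrPdist_le => e e0; have [r r0 hr] := hY e e0.
have [N hN] := approx_path_close w r0.
exists N => // n /= Nn; apply: hr; [exact: Xcont|exact: approx_path_cont|exact: hN].
Qed.

End random_paths.

(** * The solution as a random path *)

Section solution_process.
Context {R : realType} {d : measure_display} {Omega : measurableType d}.
Variable P : probability Omega R.
Variable T : R.
Hypothesis T_gt0 : 0 < T.
Local Notation C := (Rcomplex R).
Local Notation mu := (@lebesgue_measure R).
Local Notation seg a := (`[0%R, a%R]%classic).
Local Notation T0 := (ltW T_gt0).
Local Notation poly := (seq (@term R T)).

(** The integral of a nonnegative function is a supremum over the simple functions
below it, so it is monotone for arbitrary functions. This matters because the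
representatives of the classes u(s) are chosen separately for each s, with no
regularity in s. *)
Lemma le_integral_ge0 (f g : R -> \bar R) (D : set R) :
  (forall x, (0 <= f x)%E) -> (forall x, D x -> (f x <= g x)%E) ->
  (\int[mu]_(x in D) f x <= \int[mu]_(x in D) g x)%E.
Proof.
move=> f0 fg; rewrite integral_mkcond [leRHS]integral_mkcond.
have h1 x : (0 <= (f \_ D) x)%E by rewrite patchE; case: ifP.
have h2 x : ((f \_ D) x <= (g \_ D) x)%E.
  by rewrite !patchE; case: ifP => // /set_mem; exact: fg.
rewrite !ge0_integralTE//; last by move=> x; exact: le_trans (h1 x) (h2 x).
apply: ereal_sup_le => _ [h hf <-]; exists h => // x.
exact: le_trans (hf x) (h2 x).
Qed.

Lemma integral_seg_cst (a M : R) : 0 <= a -> (\int[mu]_(s in seg a) M%:E = (M * a)%:E)%E.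
Proof.
move=> a0; rewrite integral_cst; last exact: measurable_seg.
by rewrite EFinM; congr (_ * _)%E; exact: mu_seg.
Qed.

Variable u0 : poly.
Variable A : R.
Hypothesis u0A : lnorm u0 <= A.
Hypothesis smallA : 320 * T * A ^+ 4 <= 1.

Local Notation sol w := (solution T0 u0 w).

Definition trajectory (w : R -> R) (t : R) : L2_torus R := cls (L2_seminormed R) (sol w t).

Lemma solution_L2 w t : cont_path T w -> 0 <= t <= T -> L2_dom (sol w t).
Proof.
move=> cw tT; apply: L2_dom_cont; first by move=> x; exact: solution_periodic.
exact: (solution_contx T0 u0A smallA).
Qed.

Lemma trajectory_close w w' t t' (e : R) : 0 <= e -> cont_path T w -> cont_path T w' ->
  0 <= t <= T -> 0 <= t' <= T ->
  (forall x : R, `|(sol w t x - sol w' t' x : C)| <= e) ->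
  `|trajectory w t - trajectory w' t'| <= e * Num.sqrt (2 * pi).
Proof.
move=> e0 cw cw' tT t'T h; have d1 := solution_L2 cw tT; have d2 := solution_L2 cw' t'T.
rewrite /trajectory (norm_cls_sub (E := L2_seminormed R) d1 d2).
by apply: L2_semi_bnd => //; exact: (domB (E := L2_seminormed R)).
Qed.

Lemma sqrt2pi_gt0 : 0 < Num.sqrt (2 * pi) :> R.
Proof. by rewrite sqrtr_gt0 twopi_gt0. Qed.

Lemma trajectory_dom w : cont_path T w -> cont_dom T (trajectory w).
Proof.
move=> cw; apply/subspace_continuousP => t tT; apply/cvgrPdist_le => e e0.
have e1 : 0 < e / Num.sqrt (2 * pi) by rewrite divr_gt0// sqrt2pi_gt0.
have tT' : 0 <= t <= T by move: tT; rewrite /= in_itv.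
have [r r0 hr] := solution_contt T0 u0A smallA cw tT' e1.
rewrite /= near_withinE; apply/nbhs_normP; exists r => //= s ts sT.
have sT' : 0 <= s <= T by move: sT; rewrite /= in_itv.
have -> : e = e / Num.sqrt (2 * pi) * Num.sqrt (2 * pi).
  by rewrite divfK// gt_eqF// sqrt2pi_gt0.
apply: trajectory_close => //; first exact: ltW.
by move=> x; exact: hr.
Qed.

Definition path_class (w : R -> R) : cont_space (L2_torus R) T :=
  cls (cont_seminormed (L2_torus R) T) (trajectory w).

(** Uniform closeness of the solutions in x and t bounds the distance in
C([0, T]; L^2), the period having finite length. *)
Lemma path_class_close (e : R) : 0 < e -> exists2 r : R, 0 < r & forall w w',
  cont_path T w -> cont_path T w' -> close_path T r w w' ->
  `|path_class w - path_class w'| <= e.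
Proof.
move=> e0; have e1 : 0 < e / Num.sqrt (2 * pi) by rewrite divr_gt0// sqrt2pi_gt0.
have [r r0 hr] := solution_contw T0 u0A smallA e1.
exists r => // w w' cw cw' ww'.
have d1 := trajectory_dom cw; have d2 := trajectory_dom cw'.
rewrite /path_class (norm_cls_sub (E := cont_seminormed _ _) d1 d2).
apply: cont_semi_le; first exact: ltW.
move=> t tT; have -> : e = e / Num.sqrt (2 * pi) * Num.sqrt (2 * pi).
  by rewrite divfK// gt_eqF// sqrt2pi_gt0.
apply: trajectory_close => //; first exact: ltW.
by move=> x; exact: hr.
Qed.

Lemma path_class_bnd w : cont_path T w -> `|path_class w| <= 2 * A * Num.sqrt (2 * pi).
Proof.
move=> cw; have A0 := A_ge0 T0 u0A.
rewrite /path_class (norm_cls (E := cont_seminormed _ _) (trajectory_dom cw)).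
apply: cont_semi_le; first by rewrite mulr_ge0 ?mulr_ge0.
move=> t tT; have dt := solution_L2 cw tT.
rewrite /trajectory (norm_cls (E := L2_seminormed R) dt).
apply: L2_semi_bnd => //; first by rewrite mulr_ge0.
by move=> x; exact: (solution_bnd T0 u0A smallA).
Qed.

Lemma path_class_rep w t : cont_path T w -> 0 <= t <= T ->
  rep (path_class w) t = trajectory w t.
Proof.
move=> cw tT; have dw := trajectory_dom cw.
have dr := rep_dom (path_class w).
have := rep_cls (E := cont_seminormed (L2_torus R) T) dw.
have := cont_semi_ub (domB (E := cont_seminormed (L2_torus R) T) dr dw) tT.
rewrite -/(path_class w) => h /= e; apply/eqP; rewrite -subr_eq0 -normr_le0.
by move: h; rewrite e.
Qed.

Variable X : R -> Omega -> R.
Hypothesis Xcont : forall w, cont_path T (X ^~ w).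
Hypothesis Xmeas : forall t : R, 0 <= t <= T -> measurable_fun setT (X t).

Definition random_path (w : Omega) := path_class (X ^~ w).

Lemma random_path_dom : L1_dom P random_path.
Proof.
have sm : strongly_measurable random_path.
  exact: (strongly_measurable_path T_gt0 Xcont Xmeas path_class_close).
split=> //; apply: (@le_integrable _ _ _ P setT _ _ (cst (2 * A * Num.sqrt (2 * pi))%:E)) => //.
- by apply/measurable_EFinP; exact: strongly_measurable_norm.
- move=> w _; rewrite /= normr_id lee_fin (le_trans (path_class_bnd (@Xcont w)))//.
  exact: ler_norm.
- exact: finite_measure_integrable_cst.
Qed.

Definition solution_process : solution_space P T :=
  cls (L1_seminormed (cont_space (L2_torus R) T) P) random_path.

Lemma ae_and (Q Q' : Omega -> Prop) : {ae P, forall w, Q w} -> {ae P, forall w, Q' w} ->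
  {ae P, forall w, Q w /\ Q' w}.
Proof. by move=> h h'; near=> w; split; near: w. Unshelve. all: by end_near. Qed.

Lemma ae_mono (Q Q' : Omega -> Prop) : {ae P, forall w, Q w} -> (forall w, Q w -> Q' w) ->
  {ae P, forall w, Q' w}.
Proof. by move=> h QQ'; apply: filterS h. Qed.

Lemma L1_semi_eq0 (E : normedModType R) (f : Omega -> E) : L1_dom P f -> L1_semi P f = 0 ->
  {ae P, forall w, f w = 0}.
Proof.
move=> [mf If] f0.
have mn : measurable_fun setT (fun w => (`|f w|)%:E).
  by apply/measurable_EFinP; exact: strongly_measurable_norm.
have : (\int[P]_w `|(`|f w|)%:E| = 0)%E.
  under eq_integral do rewrite abse_EFin normr_id.
  have fin := integrable_fin_num measurableT If.
  by rewrite -(fineK fin); congr EFin; exact: f0.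
move=> /(ae_eq_integral_abs P measurableT mn); apply: filterS => w /(_ I) /eqP.
by rewrite eqe normr_eq0 => /eqP.
Qed.

Lemma rep_cls_L1 (E : normedModType R) (f : Omega -> E) : L1_dom P f ->
  {ae P, forall w, rep (cls (L1_seminormed E P) f) w = f w}.
Proof.
move=> df; have dr := rep_dom (cls (L1_seminormed E P) f).
have := L1_semi_eq0 (domB dr df) (rep_cls (E := L1_seminormed E P) df).
by apply: filterS => w /eqP; rewrite subr_eq0 => /eqP.
Qed.

(** Equality of two classes in C([0, T]; L^2) is equality at every time, so the
exceptional null set of the Bochner class serves all times at once. *)
Lemma sample_path_solution : {ae P, forall w, forall t : R, 0 <= t <= T ->
  sample_path solution_process w t = trajectory (X ^~ w) t}.
Proof.
apply: (ae_mono (rep_cls_L1 random_path_dom)) => w h t tT.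
by rewrite /sample_path h path_class_rep.
Qed.

Lemma solution_process_bounded : bounded_process solution_process.
Proof.
exists (2 * A); apply: (ae_mono sample_path_solution) => w h t tT.
rewrite (h t tT); apply: rep_cls_bnd; first exact: solution_L2.
by move=> x; exact: (solution_bnd T0 u0A smallA).
Qed.

Variable W : R -> Omega -> R.
Hypothesis WX : {ae P, forall w, forall t : R, 0 <= t <= T -> W t w = X t w}.
Variable v0 : L2_torus R.
Hypothesis v0u0 : forall w t k, cont_path T w -> 0 <= t <= T ->
  fourier_coef (eval u0 w t) k = propagator (w t) k * fourier_coef (rep v0) k.

Lemma solution_process_mild : mild_solution W v0 solution_process.
Proof.
apply: (ae_mono (ae_and WX sample_path_solution)) => w [hW hS].
have cw := @Xcont w; split.
  pose M := ((2 * A) ^+ 5 * (2 * pi)).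
  have A0 := A_ge0 T0 u0A.
  apply: (@le_lt_trans _ _ (\int[mu]_(s in seg T) M%:E)%E); last first.
    by rewrite integral_seg_cst ?ltry//; exact: T0.
  apply: le_integral_ge0 => [s|s sT].
    by apply: integral_ge0 => x _; rewrite lee_fin.
  have sT' : 0 <= s <= T by move: sT; rewrite /= in_itv.
  rewrite (hS s sT') quintic_integral_cls; last exact: solution_L2.
  apply: (@le_trans _ _ (\int[mu]_(x in seg (2 * pi)) ((2 * A) ^+ 5)%:E)%E).
    apply: le_integral_ge0 => x; first by rewrite lee_fin.
    move=> _; rewrite lee_fin norm_quintic ler_pXn2r ?nnegrE ?mulr_ge0//.
    exact: (solution_bnd T0 u0A smallA).
  by rewrite integral_seg_cst//; exact/ltW/twopi_gt0.
move=> t k tT; rewrite (hS t tT) fourier_coef_cls; last exact: solution_L2.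
rewrite (solution_mild T0 u0A smallA k cw tT) v0u0// hW//.
rewrite /duhamel mulNr.
set a := cintegral _ _; set b := cintegral _ _; suff -> : a = b by [].
rewrite /a /b {a b}; apply: eq_cintegral => s; rewrite inE/= in_itv/= => /andP[s0 st].
have sT : 0 <= s <= T by rewrite s0 (le_trans st)//; case/andP: tT.
rewrite (hS s sT) hW//; congr (_ * _).
rewrite -(quintic_fourier_coef_cls k (solution_L2 cw sT)).
by [].
Qed.

End solution_process.

(** * Pairing with the linear evolution *)

Section trigonometric_pairing.
Context {R : realType}.
Local Notation C := (Rcomplex R).
Local Notation mu := (@lebesgue_measure R).
Local Notation period := (`[0 : R, 2 * pi]%classic).
Implicit Types (f g : R -> C).

Lemma Rintegral_Re (f : R -> R) :
  \int[mu]_(x in period) f x = complex.Re (cintegral period (fun x => f x *: (1 : C))).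
Proof. by rewrite /=; apply: eq_Rintegral => x _; rewrite mulr1. Qed.

Lemma mulC_scale1 (z : C) (x : R) : z * (x *: 1) = x *: z.
Proof.
apply: complex_eq; rewrite ?ReM ?ImM ?ReZ ?ImZ /= mulr1 !mulr0 mulrC.
  by rewrite subr0.
by rewrite add0r.
Qed.

(** Parseval's identity for a trigonometric polynomial whose frequencies may be
repeated. *)
Lemma trig_sq_integral (I : finType) (q : I -> int) (a : I -> C) :
  \int[mu]_(x in period) (`|(\sum_i a i * cis ((q i)%:~R * x) : C)| ^+ 2) =
  2 * pi * complex.Re (\sum_i \sum_(j | q i == q j) a i * conjC (a j)).
Proof.
rewrite Rintegral_Re.
have -> : (fun x => `|(\sum_i a i * cis ((q i)%:~R * x) : C)| ^+ 2 *: (1 : C)) =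
    fun x => \sum_i \sum_j (a i * conjC (a j)) * cis ((q i - q j)%:~R * x).
  apply/funext => x; rewrite -mul_conjC conjC_sum big_distrlr/=.
  apply: eq_bigr => i _; apply: eq_bigr => j _.
  rewrite conjCM conj_cis rmorphB mulrBl cisD; ring.
have ii i j : cintegrable period (fun x => (a i * conjC (a j)) * cis ((q i - q j)%:~R * x)).
  apply: ccont_integrable; apply: ccontM; first exact: ccont_cst.
  exact: ccont_cisl.
rewrite cintegral_sum; first last.
- by move=> i; apply: cintegrable_sum => //; exact: measurable_seg.
- exact: measurable_seg.
rewrite -ReZ scaler_sumr; congr complex.Re; apply: eq_bigr => i _.
rewrite (cintegral_sum (measurable_seg _)) //.
rewrite [in RHS]big_mkcond scaler_sumr; apply: eq_bigr => j _.
rewrite cintegralMl; first last.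
- by apply: ccont_integrable; exact: ccont_cisl.
- exact: measurable_seg.
rewrite cintegral_cis subr_eq0; case: eqVneq => _; last first.
  by rewrite mulr0n scale0r mulr0 scaler0.
by rewrite mulr1n mulC_scale1.
Qed.

Lemma L2_cintegrable f : L2_dom f -> cintegrable period f.
Proof.
move=> [_ mf If]; have [mr mi] := mf.
have I1 : mu.-integrable period (fun x => (cst 1%:E x + (`|f x| ^+ 2)%:E)%E).
  apply: (integrableD measurable_period _ If).
  by apply: within_integrable => x; exact: cvg_cst.
have b (g : C -> R) x : (forall z, `|g z| <= `|z|) -> (`|(g (f x))%:E| <= `|cst 1%:E x + (`|f x| ^+ 2)%:E|)%E.
  move=> gz; rewrite /= lee_fin [leRHS]ger0_norm ?addr_ge0// (le_trans (gz _))//.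
  by have := sqr_ge0 (`|f x| - 1); have := normr_ge0 (f x); nra.
split; apply: (le_integrable measurable_period _ _ I1).
- by apply/measurable_EFinP; exact: measurable_funTS.
- by move=> x _; apply: b; exact: norm_Re.
- by apply/measurable_EFinP; exact: measurable_funTS.
- by move=> x _; apply: b; exact: norm_Im.
Qed.

Lemma L2_dom_cis f k : L2_dom f -> L2_dom (fun x => cis (- (k%:~R * x)) * f x).
Proof.
move=> [pf mf If]; split.
- by move=> x; rewrite pf -!mulNr -rmorphN cis_periodic.
- by apply: cmeasurableM => //; exact: cmeasurable_cis.
- rewrite (_ : (fun x => _) = fun x => (`|f x| ^+ 2)%:E)//; apply/funext => x.
  congr ((_ ^+ 2)%:E); apply: etrans (normM (cis (- (k%:~R * x))) (f x)) _.
  by rewrite norm_cis mul1r.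
Qed.

Lemma fourier_coef_linear (a : R) f g k : L2_dom f -> L2_dom g ->
  fourier_coef (a *: f + g) k = a *: fourier_coef f k + fourier_coef g k.
Proof.
move=> df dg; rewrite /fourier_coef.
have i1 := L2_cintegrable (L2_dom_cis k df); have i2 := L2_cintegrable (L2_dom_cis k dg).
have -> : (fun x => cis (- (k%:~R * x)) * (a *: f + g) x) =
  fun x => Complex a 0 * (cis (- (k%:~R * x)) * f x) + cis (- (k%:~R * x)) * g x.
  apply/funext => x; apply: complex_eq;
  by rewrite !(ReD, ImD, ReM, ImM) /= !(ReD, ImD, ReZ, ImZ); ring.
have mp := @measurable_seg R (2 * pi).
rewrite (cintegralD mp _ i2); last exact: cintegrableM.
rewrite (cintegralMl mp _ i1); apply: complex_eq;
by rewrite !(ReZ, ImZ, ReD, ImD, ReM, ImM) /=; ring.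
Qed.

Variable n : nat.

(** The linear evolution, at position y of the driving path, of the datum with unit
Fourier coefficients at 0, ..., n - 1. *)
Definition dirichlet (y x : R) : C := \sum_(k < n) cis (k%:R ^+ 2 * y) * cis (k%:R * x).

(** (2 pi)^-1 times the scalar product of f with dirichlet y. *)
Definition pairing (y : R) (f : R -> C) : C :=
  \sum_(k < n) cis (- (k%:R ^+ 2 * y)) * fourier_coef f (k : nat).

Lemma pairingE y f : L2_dom f ->
  pairing y f = (2 * pi)^-1 *: cintegral period (fun x => conjC (dirichlet y x) * f x).
Proof.
move=> df; rewrite /pairing.
have -> : (fun x => conjC (dirichlet y x) * f x) =
    fun x => \sum_(k < n) cis (- (k%:R ^+ 2 * y)) * (cis (- ((k : nat)%:~R * x)) * f x).
  apply/funext => x; rewrite conjC_sum mulr_suml; apply: eq_bigr => k _.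
  by rewrite conjCM !conj_cis mulrA.
rewrite cintegral_sum; first last.
- move=> k; apply: cintegrableM; first exact: measurable_seg.
  exact: (L2_cintegrable (L2_dom_cis (k : nat) df)).
- exact: measurable_seg.
rewrite scaler_sumr; apply: eq_bigr => k _.
rewrite cintegralMl; first last.
- exact: (L2_cintegrable (L2_dom_cis (k : nat) df)).
- exact: measurable_seg.
by rewrite /fourier_coef; apply: complex_eq; rewrite !(ReM, ImM, ReZ, ImZ); ring.
Qed.

Lemma dirichlet_sq_integral y : \int[mu]_(x in period) (`|dirichlet y x| ^+ 2) = 2 * pi * n%:R.
Proof.
have -> : (fun x => `|dirichlet y x| ^+ 2) = fun x =>
   `|(\sum_(k < n) cis (k%:R ^+ 2 * y) * cis (((k : nat) : int)%:~R * x) : C)| ^+ 2 by [].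
rewrite trig_sq_integral; congr (_ * _).
rewrite (eq_bigr (fun=> (1 : C))); last first.
  move=> i _; rewrite (big_pred1 i); first by rewrite mul_conjC norm_cis expr1n scale1r.
  by move=> j; rewrite /= eqz_nat eq_sym.
by rewrite Re_sum /= sumr_const card_ord.
Qed.

Lemma ccont_dirichlet (B : set R) y : ccont B (dirichlet y).
Proof.
apply: ccont_sum => k; apply: ccontM; first exact: ccont_cst.
exact: ccont_cisl.
Qed.

Lemma L2_dom_dirichlet y : L2_dom (dirichlet y).
Proof.
apply: L2_dom_cont; last exact: ccont_dirichlet.
by move=> x; apply: eq_bigr => k _; rewrite (cis_periodic k).
Qed.

(** With this sign the factor - i of Duhamel's formula turns into a real part. *)
Definition imag_pairing (y : R) (f : R -> C) : R := - complex.Im (pairing y f).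

Lemma imag_pairingE y f : imag_pairing y f =
  \sum_(k < n) (sin (k%:R ^+ 2 * y) * complex.Re (fourier_coef f (k : nat)) -
                cos (k%:R ^+ 2 * y) * complex.Im (fourier_coef f (k : nat))).
Proof.
rewrite /imag_pairing /pairing Im_sum -sumrN; apply: eq_bigr => k _.
by rewrite ImM /= cosN sinN; ring.
Qed.

Lemma imag_pairing_linear y (a : R) f g : L2_dom f -> L2_dom g ->
  imag_pairing y (a *: f + g) = a * imag_pairing y f + imag_pairing y g.
Proof.
move=> df dg; rewrite !imag_pairingE mulr_sumr -big_split; apply: eq_bigr => k _.
by rewrite -[RHS]/(_ + _) (fourier_coef_linear _ _ df dg) !(ReD, ImD, ReZ, ImZ); ring.
Qed.

Definition pairing_const : R := Num.sqrt (2 * pi * n%:R) / (2 * pi).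

Lemma pairing_const_ge0 : 0 <= pairing_const.
Proof. by rewrite divr_ge0 ?sqrtr_ge0// ltW// twopi_gt0. Qed.

(** Cauchy-Schwarz, through 2 a b <= l a^2 + b^2 / l. The optimal l is the quotient
of the two norms; adding e to both avoids a division by zero, and e tends to 0. *)
Lemma imag_pairing_bnd y f : L2_dom f -> `|imag_pairing y f| <= pairing_const * L2_semi f.
Proof.
move=> df; have p0 := @twopi_gt0 R.
have [_ mf If] := df; have [_ mh Ih] := L2_dom_dirichlet y.
pose N := \int[mu]_(x in period) (`|f x| ^+ 2).
have N0 : 0 <= N by apply: Rintegral_ge0 => x _; exact: sqr_ge0.
have key (l : R) : 0 < l ->
    `|imag_pairing y f| <= (2 * pi)^-1 * (l * (2 * pi * n%:R) + l^-1 * N) / 2.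
  move=> l0; rewrite /imag_pairing pairingE// ImZ normrN normrM gtr0_norm ?invr_gt0//.
  rewrite -mulrA; apply: ler_wpM2l; first by rewrite invr_ge0 ltW.
  rewrite ler_pdivlMr// /=.
  have mc : cmeasurable (fun x => conjC (dirichlet y x) * f x).
    apply: cmeasurableM => //; apply: ccont_cmeasurable; apply: ccont_conj.
    exact: ccont_dirichlet.
  have Ib : mu.-integrable period (EFin \o (fun x => l * `|dirichlet y x| ^+ 2 + l^-1 * `|f x| ^+ 2)).
    have := integrableD measurable_period
      (Rintegrable_scale measurable_period l Ih) (Rintegrable_scale measurable_period l^-1 If).
    by [].
  have pw x : `|complex.Im (conjC (dirichlet y x) * f x)| * 2 <=
      l * `|dirichlet y x| ^+ 2 + l^-1 * `|f x| ^+ 2.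
    apply: (@le_trans _ _ (`|dirichlet y x| * `|f x| * 2)).
      by rewrite ler_pM2r// (le_trans (norm_Im _))// normM norm_conjC.
    rewrite -subr_ge0; set p := `|dirichlet y x|; set r := `|f x|.
    rewrite (_ : _ - _ = l^-1 * (l * p - r) ^+ 2); last by field; rewrite gt_eqF.
    by rewrite mulr_ge0 ?sqr_ge0// invr_ge0 ltW.
  have Ii : mu.-integrable period (EFin \o (fun x => complex.Im (conjC (dirichlet y x) * f x))).
    apply: (le_integrable measurable_period _ _ Ib).
      by apply/measurable_EFinP; apply: measurable_funTS; case: mc.
    move=> x _; rewrite /= lee_fin; apply: le_trans (ler_norm _).
    by apply: le_trans (pw x); rewrite ler_peMr// ler1n.
  apply: (@le_trans _ _ (\int[mu]_(x in period) `|complex.Im (conjC (dirichlet y x) * f x)| * 2)).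
    by rewrite ler_pM2r//; exact: (le_normr_Rintegral measurable_period Ii).
  have In := integrable_norm Ii.
  rewrite -(RintegralZr 2 measurable_period In).
  apply: (@le_trans _ _ (\int[mu]_(x in period) (l * `|dirichlet y x| ^+ 2 + l^-1 * `|f x| ^+ 2))).
    apply: (le_Rintegral measurable_period) => //.
    have := Rintegrable_scale measurable_period 2 In.
      by congr (_.-integrable _ _); apply/funext => x /=; rewrite mulrC.
    by move=> x _; exact: pw.
  rewrite RintegralD; first last.
  - exact: (Rintegrable_scale measurable_period).
  - exact: (Rintegrable_scale measurable_period).
  - exact: measurable_period.
  rewrite (RintegralZl l measurable_period Ih) (RintegralZl l^-1 measurable_period If).
  by rewrite dirichlet_sq_integral.
pose a : R := Num.sqrt (2 * pi * n%:R); pose b := L2_semi f.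
have a2 : a ^+ 2 = 2 * pi * n%:R by rewrite sqr_sqrtr// mulr_ge0// ltW.
have b2 : b ^+ 2 = N by rewrite sqr_sqrtr.
have a0 : 0 <= a := sqrtr_ge0 _.
have b0 : 0 <= b := sqrtr_ge0 _.
rewrite /pairing_const -/a -/b.
have key' (e : R) : 0 < e -> `|imag_pairing y f| <= (2 * pi)^-1 * ((a + e) * (b + e)).
  move=> e0; have l0 : 0 < (b + e) / (a + e) by rewrite divr_gt0// ltr_wpDl.
  apply: (le_trans (key _ l0)); rewrite -mulrA; apply: ler_wpM2l.
    by rewrite invr_ge0 ltW.
  rewrite -a2 -b2 ler_pdivrMr// invf_div.
  have ae : 0 < a + e by rewrite ltr_wpDl.
  have be : 0 < b + e by rewrite ltr_wpDl.
  have h (x z : R) : 0 <= x -> 0 <= z -> z / (x + e) * x ^+ 2 <= (x + e) * z.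
    move=> x0 z0; rewrite mulrAC ler_pdivrMr ?ltr_wpDl// [(x + e) * z]mulrC -mulrA -expr2.
    by apply: ler_wpM2l => //; apply: lerXn2r; rewrite ?nnegrE; lra.
  have h1 : (b + e) / (a + e) * a ^+ 2 <= (a + e) * (b + e) by apply: h => //; exact: ltW.
  have h2 : (a + e) / (b + e) * b ^+ 2 <= (a + e) * (b + e).
    by rewrite [leRHS]mulrC; apply: h => //; exact: ltW.
  by rewrite mulr_natr mulr2n lerD.
apply/ler_addgt0Pr => e e0.
pose D := (2 * pi)^-1 * (a + b + 1).
have D0 : 0 < D by rewrite mulr_gt0 ?invr_gt0//; lra.
pose t := Num.min 1 (e / D).
have t0 : 0 < t by rewrite lt_min ltr01 divr_gt0.
have t1 : t <= 1 by rewrite ge_min lexx.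
have tD : t * D <= e by rewrite -ler_pdivlMr// ge_min lexx orbT.
apply: (le_trans (key' t t0)).
have -> : (2 * pi)^-1 * ((a + t) * (b + t)) = a / (2 * pi) * b + t * ((2 * pi)^-1 * (a + b + t)) by ring.
rewrite lerD2l; apply: le_trans tD; rewrite ler_pM2l// /D ler_pM2l ?invr_gt0//.
by rewrite lerD2l.
Qed.

End trigonometric_pairing.

(** * Fifth order expansion along a path *)

Section linear_datum.
Context {R : realType}.
Variable T : R.
Hypothesis T_gt0 : 0 < T.
Local Notation C := (Rcomplex R).
Local Notation mu := (@lebesgue_measure R).
Local Notation seg a := (`[0%R, a%R]%classic).
Local Notation period := (`[0 : R, 2 * pi]%classic).
Local Notation T0 := (ltW T_gt0).
Implicit Types (w : R -> R) (eps : R).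

Lemma norm_real (a : R) : `|(Complex a 0 : C)| = `|a|.
Proof. by rewrite Rcomplex_normE /= expr0n /= addr0 sqrtr_sqr. Qed.

Lemma datum_cont eps (k : nat) w : cont_path T w ->
  ccont (seg T) (fun t => (Complex eps 0 : C) * cis (k%:R ^+ 2 * w t)).
Proof. by move=> cw; apply: ccontM; [exact: ccont_cst|exact: ccont_path_cis]. Qed.

Lemma datum_bnd eps (k : nat) w t : cont_path T w -> 0 <= t <= T ->
  `|((Complex eps 0 : C) * cis (k%:R ^+ 2 * w t) : C)| <= `|eps|.
Proof. by move=> _ _; rewrite normM norm_cis mulr1 norm_real. Qed.

Lemma datum_lip eps (k : nat) : exists2 L : R, 0 <= L & forall w w' e,
  cont_path T w -> cont_path T w' ->
  close_path T e w w' -> forall t : R, 0 <= t <= T ->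
  `|((Complex eps 0 : C) * cis (k%:R ^+ 2 * w t) -
     (Complex eps 0 : C) * cis (k%:R ^+ 2 * w' t) : C)| <= L * e.
Proof.
exists (`|eps| * (2 * k%:R ^+ 2)).
  by apply: mulr_ge0 => //; apply: mulr_ge0 => //; exact: sqr_ge0.
move=> w w' e _ _ ww' t tT; rewrite -mulrBr normM norm_real -[leRHS]mulrA.
apply: ler_wpM2l => //; apply: (le_trans (propagator_lip (w t) (w' t) k)).
apply: ler_wpM2l; last exact: ww'.
by apply: mulr_ge0 => //; exact: sqr_ge0.
Qed.

Definition datum_term eps (k : nat) : @term R T :=
  Term (k : int) (datum_cont eps k) (datum_bnd eps k) (datum_lip eps k).

Variable n : nat.

Definition datum eps := [seq datum_term eps k | k <- index_iota 0 n].

Lemma lnorm_datum eps : lnorm (datum eps) = n%:R * `|eps|.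
Proof. by rewrite /lnorm big_map /= big_mkord sumr_const card_ord mulr_natl. Qed.

Lemma eval_datum eps w t x : eval (datum eps) w t x = Complex eps 0 * dirichlet n (w t) x.
Proof.
rewrite /eval big_map big_mkord /dirichlet mulr_sumr; apply: eq_bigr => k _ /=.
by rewrite mulrA.
Qed.

Lemma fourier_coef_datum eps w t (k : int) : fourier_coef (eval (datum eps) w t) k =
  propagator (w t) k * fourier_coef (eval (datum eps) (fun=> 0) 0) k.
Proof.
rewrite !fourier_coef_eval !big_map mulr_sumr; apply: eq_bigr => j _ /=.
case: (eqVneq (j : int) k) => [<-|_]; last by rewrite mulr0.
by rewrite mulr0 cis0 mulr1 mulrC.
Qed.

Lemma fourier_coef_datum_lt eps w t (k : nat) : (k < n)%N ->
  fourier_coef (eval (datum eps) w t) k = Complex eps 0 * cis (k%:R ^+ 2 * w t).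
Proof.
move=> kn; rewrite fourier_coef_eval big_map big_mkord (bigD1 (Ordinal kn))//= eqxx.
by rewrite big1 ?addr0// => j; rewrite -val_eqE /= eqz_nat => /negbTE ->.
Qed.

(** The mean over a period of the sixth power of the linear evolution, that is, the
pairing of the linear evolution with its own quintic nonlinearity. *)
Definition sextic (y : R) : R := (2 * pi)^-1 * \int[mu]_(x in period) (`|dirichlet n y x| ^+ 6).

Lemma realM (a : R) (z : C) : Complex a 0 * z = a *: z.
Proof.
by apply: complex_eq; rewrite ?ReM ?ImM ?ReZ ?ImZ /= mul0r ?subr0 ?addr0.
Qed.

Lemma conj_quintic (z : C) : conjC z * quintic z = `|z| ^+ 6 *: (1 : C).
Proof.
have h : `|z| ^+ 6 = (`|z| ^+ 2) ^+ 3 by rewrite -exprM.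
rewrite quinticE h normsq.
by apply: complex_eq; rewrite ?ReZ ?ImZ !(ReM, ImM) /=; ring.
Qed.

Lemma L2_dom_periodic_cont (f : R -> C) : (forall x, f (x + 2 * pi) = f x) ->
  ccont setT f -> L2_dom (fun x => quintic (f x)).
Proof.
move=> pf cf; apply: L2_dom_cont; first by move=> x; rewrite pf.
exact: ccont_quintic.
Qed.

Lemma pairing_quintic_datum eps w s :
  complex.Re (pairing n (w s) (fun x => quintic (eval (datum eps) w s x))) =
  eps ^+ 5 * sextic (w s).
Proof.
have d : L2_dom (fun x => quintic (eval (datum eps) w s x)).
  by apply: L2_dom_periodic_cont; [move=> x; exact: eval_periodic|exact: eval_contx].
rewrite pairingE// ReZ /sextic mulrCA; congr (_ * _).
have I : mu.-integrable period (EFin \o (fun x => `|dirichlet n (w s) x| ^+ 6)).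
  apply: within_integrable.
  have ch := ccont_dirichlet n period (w s).
  have [cr _] := ccontM (ccont_conj ch) (ccont_quintic ch).
  rewrite (_ : (fun x => `|dirichlet n (w s) x| ^+ 6) = fun x =>
    complex.Re (conjC (dirichlet n (w s) x) * quintic (dirichlet n (w s) x)))//.
  by apply/funext => x; rewrite conj_quintic ReZ /= mulr1.
rewrite -(RintegralZl _ (measurable_seg _) I) /=; apply: eq_Rintegral => x _.
rewrite eval_datum realM quinticZ -[RHS]mulr1 -[X in _ = _ * X]/(complex.Re (1 : C)) -ReZ.
congr complex.Re; rewrite -scalerA -conj_quintic.
by apply: complex_eq; rewrite !(ReM, ImM, ReZ, ImZ); ring.
Qed.

Lemma pairingB y (f g : R -> C) : ccont period f -> ccont period g ->
  pairing n y f - pairing n y g = pairing n y (fun x => f x - g x).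
Proof.
move=> cf cg; rewrite /pairing -sumrB; apply: eq_bigr => k _.
by rewrite fourier_coefB// mulrBr.
Qed.

Lemma norm_pairing y (f : R -> C) (M : R) : ccont period f ->
  (forall x : R, 0 <= x <= 2 * pi -> `|f x| <= M) -> `|pairing n y f| <= n%:R * (2 * M).
Proof.
move=> cf fM; apply: (@le_trans _ _ (\sum_(k < n) 2 * M)); last first.
  by rewrite sumr_const card_ord [leRHS]mulr_natl.
rewrite /pairing; elim/big_ind2 : _ => [|a b c e ab ce|k _]; first by rewrite normr0.
  by rewrite (le_trans (ler_normD _ _))// lerD.
by rewrite normM norm_cis mul1r norm_fourier_coef.
Qed.

Variable eps : R.
Local Notation A := (n%:R * `|eps|).
Hypothesis small : 320 * T * A ^+ 4 <= 1.
Local Notation u0 := (datum eps).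
Local Notation sol w := (solution T0 u0 w).
Local Notation d := (2 * T * A ^+ 5).

Lemma datumA : lnorm u0 <= A.
Proof. by rewrite lnorm_datum. Qed.

Lemma ccont_pairing w (f : R -> R -> C) : cont_path T w ->
  (forall k : int, ccont (seg T) (fun s => fourier_coef (f s) k)) ->
  ccont (seg T) (fun s => pairing n (w s) (f s)).
Proof.
move=> cw cf; apply: ccont_sum => k; apply: ccontM; last exact: cf.
exact: ccont_path_cisN.
Qed.

(** The phases of the final pairing undo the propagator in Duhamel's formula, which
leaves a pairing at time s; the linear part contributes the real number eps for
each frequency. *)
Lemma imag_pairing_solution w : cont_path T w ->
  imag_pairing n (w T) (sol w T) =
  \int[mu]_(s in seg T) complex.Re (pairing n (w s) (fun x => quintic (sol w s x))).
Proof.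
move=> cw; have TT : 0 <= T <= T by rewrite lexx ltW.
pose f (k : nat) s := fourier_coef (fun x => quintic (sol w s x)) k.
have cf k : ccont (seg T) (f k) := quintic_solution_coef_cont T0 datumA small k cw.
have E : pairing n (w T) (sol w T) = \sum_(k < n) (Complex eps 0 -
    'i%C * cintegral (seg T) (fun s => cis (- (k%:R ^+ 2 * w s)) * f k s)).
  apply: eq_bigr => k _; rewrite (solution_mild T0 datumA small k cw TT).
  rewrite fourier_coef_datum_lt// mulrDr mulrCA -cisD addNr cis0 mulr1.
  rewrite /duhamel -/(f k) mulNr mulrN mulrCA -cintegralMl; first last.
  - exact: (duhamel_integrable k cw (cf k) (lexx T)).
  - exact: measurable_seg.
  set a := cintegral _ _; set b := cintegral _ _; suff -> : a = b by [].
  rewrite /a /b {a b}; apply: eq_cintegral => s _; rewrite mulrA.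
  have -> // : cis (- (k%:R ^+ 2 * w T)) * propagator (w T - w s) k =
      cis (- (k%:R ^+ 2 * w s)) :> C.
  by rewrite propagatorB mulrA -cisD addNr cis0 mul1r.
rewrite /imag_pairing E Im_sum.
have -> : - (\sum_(k < n) complex.Im (Complex eps 0 -
    'i%C * cintegral (seg T) (fun s => cis (- (k%:R ^+ 2 * w s)) * f k s))) =
    complex.Re (\sum_(k < n) cintegral (seg T) (fun s => cis (- (k%:R ^+ 2 * w s)) * f k s)).
  rewrite -sumrN Re_sum; apply: eq_bigr => k _.
  by rewrite ImD ImN ImM /=; ring.
rewrite -cintegral_sum; first by [].
- exact: measurable_seg.
- move=> k; apply: ccont_integrable; apply: ccontM; last exact: cf.
  exact: ccont_path_cisN.
Qed.

Lemma sextic_integrable w : cont_path T w ->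
  mu.-integrable (seg T) (EFin \o (fun s => eps ^+ 5 * sextic (w s))).
Proof.
move=> cw; have [h _] : cintegrable (seg T) (fun s =>
    pairing n (w s) (fun x => quintic (eval u0 w s x))).
  apply: ccont_integrable; apply: ccont_pairing => // k.
  exact: (quintic_fourier_coef_contt T0).
by move: h; congr (_.-integrable _ _); apply/funext => s /=; rewrite pairing_quintic_datum.
Qed.

(** Replacing the solution by its linear evolution inside the nonlinearity costs at
most 5 (2 A)^4 times their distance 4 d = 8 T A^5, hence an error of order A^9. *)
Lemma imag_pairing_expansion w : cont_path T w ->
  `|imag_pairing n (w T) (sol w T) - \int[mu]_(s in seg T) (eps ^+ 5 * sextic (w s))|
    <= 1280 * T ^+ 2 * n%:R * A ^+ 9.
Proof.
move=> cw; rewrite imag_pairing_solution//.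
have A0 : 0 <= A by rewrite mulr_ge0.
have [I1 _] : cintegrable (seg T) (fun s => pairing n (w s) (fun x => quintic (sol w s x))).
  by apply: ccont_integrable; apply: ccont_pairing => // k; exact: (quintic_solution_coef_cont T0 datumA small).
rewrite -(RintegralB (measurable_seg T) I1 (sextic_integrable cw)).
rewrite (_ : 1280 * T ^+ 2 * n%:R * A ^+ 9 =
   n%:R * (2 * (5 * (2 * A) ^+ 4 * (4 * d))) * T); last by ring.
apply: norm_Rintegral_seg; first exact: ltW.
  have := integrableB (measurable_seg T) I1 (sextic_integrable cw).
  by [].
move=> s sT; rewrite -pairing_quintic_datum -ReN -ReD.
apply: (le_trans (norm_Re _)).
have cs : ccont period (fun x => quintic (sol w s x)).
  by apply: ccont_quintic; exact: (solution_contx T0 datumA small).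
have ce : ccont period (fun x => quintic (eval u0 w s x)).
  by apply: ccont_quintic; exact: eval_contx.
rewrite pairingB//; apply: norm_pairing; first by apply: ccontD => //; exact: ccontN.
move=> x _.
have b1 := solution_bnd T0 datumA small x cw sT.
have b2 : `|eval u0 w s x| <= 2 * A.
  apply: (le_trans (eval_bnd _ _ cw sT)); rewrite lnorm_datum; lra.
apply: (le_trans (quintic_lip b1 b2)); apply: ler_wpM2l.
  by rewrite mulr_ge0// exprn_ge0// mulr_ge0.
exact: (solution_near_linear T0 datumA small).
Qed.

End linear_datum.

(** * The expected pairing as a bounded functional *)

Section functional_descent.
Context (R : realType) (V : lmodType R) (E : seminormed V) (F : V -> R) (K : R).
Hypothesis lin : forall a x y, dom E x -> dom E y -> F (a *: x + y) = a * F x + F y.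
Hypothesis bnd : forall x, dom E x -> `|F x| <= K * semi E x.

(** A functional dominated by the seminorm is constant on classes. *)
Lemma descend_eq x y : dom E x -> dom E y -> semi E (x - y) = 0 -> F x = F y.
Proof.
move=> dx dy xy; apply/eqP; rewrite -subr_eq0 -normr_le0.
have -> : F x - F y = F (x - y).
  by rewrite [x - y]addrC -[- y]scaleN1r lin// mulN1r addrC.
by apply: (le_trans (bnd (domB dx dy))); rewrite xy mulr0.
Qed.

Lemma descend_linear : linear_for *%R (fun c : sep E => F (rep c)).
Proof.
move=> a c c'; have dc := rep_dom c; have dc' := rep_dom c'.
rewrite -(lin a dc dc'); apply: descend_eq; first exact: rep_dom.
  exact: domP.
have e : a *: c + c' = to_sep (domP a dc dc').
  rewrite -{1}(repK c) -{1}(repK c') to_sep_scale to_sep_add.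
  exact: to_sep_ext.
by rewrite e to_sepK.
Qed.

Lemma descend_bnd (c : sep E) : `|F (rep c)| <= K * `|c|.
Proof. by rewrite sep_normE; apply: bnd; exact: rep_dom. Qed.

Lemma descend_cls x : dom E x -> F (rep (cls E x)) = F x.
Proof.
by move=> dx; apply: descend_eq => //; [exact: rep_dom|exact: rep_cls].
Qed.

End functional_descent.

Section observable.
Context {R : realType} {d : measure_display} {Omega : measurableType d}.
Variable P : probability Omega R.
Variable T : R.
Hypothesis T_gt0 : 0 < T.
Variable n : nat.
Local Notation K := (@pairing_const R n).
Local Notation E2 := (cont_space (L2_torus R) T).

Definition observe (y : R) (c : L2_torus R) : R := imag_pairing n y (rep c).

Lemma observe_linear y : linear_for *%R (observe y).
Proof.
apply: (descend_linear (E := L2_seminormed R) (K := K)).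
- by move=> a f g; exact: imag_pairing_linear.
- by move=> f; exact: imag_pairing_bnd.
Qed.

Lemma observe_bnd y c : `|observe y c| <= K * `|c|.
Proof.
apply: (descend_bnd (E := L2_seminormed R)).
by move=> f; exact: imag_pairing_bnd.
Qed.

Lemma observe_cls y f : L2_dom f -> observe y (cls (L2_seminormed R) f) = imag_pairing n y f.
Proof.
apply: (descend_cls (E := L2_seminormed R) (K := K)).
- by move=> a g h; exact: imag_pairing_linear.
- by move=> g; exact: imag_pairing_bnd.
Qed.

Definition observe_final (y : R) (s : E2) : R := observe y (rep s T).

Lemma final_linear y a (f g : R -> L2_torus R) :
  observe y ((a *: f + g) T) = a * observe y (f T) + observe y (g T).
Proof. exact: observe_linear. Qed.

Lemma final_bnd y (f : R -> L2_torus R) : cont_dom T f ->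
  `|observe y (f T)| <= K * cont_semi T f.
Proof.
move=> cf; apply: (le_trans (observe_bnd _ _)); apply: ler_wpM2l.
  exact: pairing_const_ge0.
by apply: cont_semi_ub => //; rewrite lexx ltW.
Qed.

Lemma observe_final_linear y : linear_for *%R (observe_final y).
Proof.
apply: (descend_linear (E := cont_seminormed (L2_torus R) T)
  (F := fun f => observe y (f T)) (K := K)).
- by move=> a f g _ _; exact: final_linear.
- by move=> f; exact: final_bnd.
Qed.

Lemma observe_final_bnd y s : `|observe_final y s| <= K * `|s|.
Proof.
apply: (descend_bnd (E := cont_seminormed (L2_torus R) T) (F := fun f => observe y (f T))).
by move=> f; exact: final_bnd.
Qed.

Lemma observe_final_cls y f : cont_dom T f ->
  observe_final y (cls (cont_seminormed (L2_torus R) T) f) = observe y (f T).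
Proof.
apply: (descend_cls (E := cont_seminormed (L2_torus R) T)
  (F := fun f => observe y (f T)) (K := K)).
- by move=> a g h _ _; exact: final_linear.
- by move=> g; exact: final_bnd.
Qed.

Lemma observe_finalB y s s' : observe_final y s - observe_final y s' = observe_final y (s - s').
Proof.
have -> : s - s' = (-1) *: s' + s by rewrite scaleN1r addrC.
rewrite (observe_final_linear y (-1) s' s) mulN1r; exact: addrC.
Qed.

Variable Y : Omega -> R.
Hypothesis mY : measurable_fun setT Y.

(** For a simple map the pairing is a trigonometric polynomial in Y with simple
coefficients; the general case is a pointwise limit, the pairing being bounded
uniformly in Y. *)
Lemma observe_final_measurable (f : Omega -> E2) : strongly_measurable f ->
  measurable_fun setT (fun w => observe_final (Y w) (f w)).
Proof.
move=> [s [ss sf]].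
apply: (@measurable_fun_cvg _ _ _ _ (fun m w => observe_final (Y w) (s m w))).
  move=> m.
  have ms (h : E2 -> R) : measurable_fun setT (fun w => h (s m w)).
    by apply: simple_map_measurable; exact: (simple_map_comp h (ss m)).
  have -> : (fun w => observe_final (Y w) (s m w)) = fun w => \sum_(k < n)
     (sin (k%:R ^+ 2 * Y w) * complex.Re (fourier_coef (rep (rep (s m w) T)) (k : nat)) -
      cos (k%:R ^+ 2 * Y w) * complex.Im (fourier_coef (rep (rep (s m w) T)) (k : nat))).
    by apply/funext => w; rewrite /observe_final /observe imag_pairingE.
  apply: measurable_sum => k; apply: measurable_funB; apply: measurable_funM.
  - apply: (measurableT_comp (f := @sin R)).
      by apply: continuous_measurable_fun; exact: continuous_sin.
    exact: measurable_funM.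
  - exact: (ms (fun c => complex.Re (fourier_coef (rep (rep c T)) (k : nat)))).
  - apply: (measurableT_comp (f := @cos R)).
      by apply: continuous_measurable_fun; exact: continuous_cos.
    exact: measurable_funM.
  - exact: (ms (fun c => complex.Im (fourier_coef (rep (rep c T)) (k : nat)))).
move=> w _; apply/cvgrPdist_le => e e0.
have K1 : 0 < K + 1 by rewrite ltr_wpDl// pairing_const_ge0.
have := sf w => /cvgrPdist_le /(_ (e / (K + 1))); rewrite divr_gt0// => /(_ isT).
apply: filterS => m h; rewrite observe_finalB; apply: (le_trans (observe_final_bnd _ _)).
apply: (le_trans (ler_wpM2l (pairing_const_ge0 n) h)).
by rewrite [leLHS]mulrA ler_pdivrMr// [leLHS]mulrC ler_pM2l// lerDl.
Qed.

Lemma observe_final_integrable (f : Omega -> E2) : L1_dom P f ->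
  P.-integrable setT (EFin \o (fun w => observe_final (Y w) (f w))).
Proof.
move=> [mf If].
apply: (le_integrable measurableT _ _ (integrableZl measurableT K If)).
  by apply/measurable_EFinP; exact: observe_final_measurable.
move=> w _; rewrite /= lee_fin [leRHS]ger0_norm; first exact: observe_final_bnd.
by rewrite mulr_ge0// pairing_const_ge0.
Qed.

Definition expected_observation (f : Omega -> E2) : R := \int[P]_w observe_final (Y w) (f w).

Lemma expected_linear a f g : L1_dom P f -> L1_dom P g ->
  expected_observation (a *: f + g) = a * expected_observation f + expected_observation g.
Proof.
move=> df dg; have If := observe_final_integrable df; have Ig := observe_final_integrable dg.
rewrite /expected_observation -(RintegralZl _ measurableT If) -RintegralD//.
  by apply: eq_Rintegral => w _; exact: observe_final_linear.
rewrite (_ : EFin \o _ = fun w => (a%:E * (observe_final (Y w) (f w))%:E)%E).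
  exact: (integrableZl measurableT).
by apply/funext => w /=; rewrite EFinM.
Qed.

Lemma expected_bnd f : L1_dom P f -> `|expected_observation f| <= K * L1_semi P f.
Proof.
move=> df; have If := observe_final_integrable df; have [_ In] := df.
apply: (le_trans (le_normr_Rintegral measurableT If)).
rewrite /L1_semi -(RintegralZl _ measurableT In).
apply: (le_Rintegral measurableT).
- exact: (integrable_norm If).
- exact: (integrableZl measurableT K In).
- by move=> w _; exact: observe_final_bnd.
Qed.

(** The functional against which the fifth difference of the solution map is tested;
Y stands for the final position of the Brownian path. *)
Definition observation (u : solution_space P T) : R := expected_observation (rep u).

Lemma observation_linear : linear_for *%R observation.
Proof.
apply: (descend_linear (E := L1_seminormed E2 P) (F := expected_observation) (K := K)).
- by move=> a f g; exact: expected_linear.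
- by move=> f; exact: expected_bnd.
Qed.

Lemma observation_bnd u : `|observation u| <= K * `|u|.
Proof.
apply: (descend_bnd (E := L1_seminormed E2 P) (F := expected_observation)).
by move=> f; exact: expected_bnd.
Qed.

Lemma observation_cls f : L1_dom P f ->
  observation (cls (L1_seminormed E2 P) f) = expected_observation f.
Proof.
apply: (descend_cls (E := L1_seminormed E2 P) (F := expected_observation) (K := K)).
- by move=> a g h; exact: expected_linear.
- by move=> g; exact: expected_bnd.
Qed.

End observable.

(** * Sixth moments and resonances *)

Section sextic_moment.
Context {R : realType}.
Local Notation C := (Rcomplex R).
Local Notation mu := (@lebesgue_measure R).
Local Notation period := (`[0 : R, 2 * pi]%classic).
Variable n : nat.
Local Notation I3 := ('I_n * 'I_n * 'I_n)%type.

Lemma dirichlet_cube (y x : R) : dirichlet n y x ^+ 3 =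
  \sum_(a : I3) cis ((sqsum3 a)%:R * y) * cis (((sum3 a : nat) : int)%:~R * x) :> C.
Proof.
rewrite /dirichlet exprSr expr2 big_distrlr /=.
rewrite (pair_bigA _ (fun i j => _)) /= big_distrlr /= (pair_bigA _ (fun p k => _)) /=.
apply: eq_bigr => -[[i j] k] _ /=; rewrite /sqsum3 /sum3 /= !natrD !natrX.
by rewrite -!pmulrn !natrD !mulrDl !cisD; ring.
Qed.

(** Expansion of the cube of the linear evolution into modes indexed by triples:
orthogonality in x selects the pairs of triples with equal sums. *)
Lemma sexticE (y : R) : sextic n y =
  \sum_(a : I3) \sum_(b : I3 | sum3 a == sum3 b) cos (((sqsum3 a : int) - (sqsum3 b : int))%:~R * y).
Proof.
rewrite /sextic.
have -> : (fun x => `|dirichlet n y x| ^+ 6) = fun x => `|(\sum_(a : I3)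
    cis ((sqsum3 a)%:R * y) * cis (((sum3 a : nat) : int)%:~R * x) : C)| ^+ 2.
  apply/funext => x; rewrite -dirichlet_cube.
  have -> : `|(dirichlet n y x ^+ 3 : C)| = `|dirichlet n y x| ^+ 3.
    by rewrite !exprS expr0 !mulr1 !normM.
  by rewrite -exprM.
rewrite trig_sq_integral mulrA mulVf ?mul1r; last by rewrite gt_eqF// twopi_gt0.
rewrite Re_sum; apply: eq_bigr => a _; rewrite Re_sum.
apply: eq_bigr => b _; rewrite conj_cis -cisD /=; congr cos.
by rewrite rmorphB /= mulrBl !pmulrn.
Qed.

Lemma sextic_ge0 (y : R) : 0 <= sextic n y.
Proof.
apply: mulr_ge0; first by rewrite invr_ge0; exact/ltW/twopi_gt0.
by apply: Rintegral_ge0 => x _; rewrite exprn_ge0.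
Qed.

Lemma sextic_cont : continuous (sextic n : R -> R).
Proof.
rewrite (_ : sextic n = fun y => \sum_(a : I3) \sum_(b : I3 | sum3 a == sum3 b)
   cos (((sqsum3 a : int) - (sqsum3 b : int))%:~R * y)); last exact/funext/sexticE.
have cc (k : int) : continuous (fun y : R => cos (k%:~R * y)).
  move=> y; apply: (@continuous_comp _ _ _ (fun y : R => k%:~R * y) (@cos R)).
    by apply: cvgM; [exact: cvg_cst|exact: cvg_id].
  exact: continuous_cos.
have cs (I : finType) (Q : pred I) (F : I -> R -> R) : (forall i, continuous (F i)) ->
    continuous (fun y => \sum_(i | Q i) F i y).
  move=> cF; rewrite /index_enum; elim: (locked_with _ _) => [|i r IH] y.
    by under eq_fun do rewrite big_nil; exact: cvg_cst.
  under eq_fun do rewrite big_cons; case: (Q i); last exact: IH.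
  by apply: cvgD; [exact: cF|exact: IH].
by apply: (cs) => a; apply: (cs) => b.
Qed.

Lemma sextic_bnd : exists2 M : R, 0 <= M & forall y : R, sextic n y <= M.
Proof.
exists (\sum_(a : I3) \sum_(b : I3 | sum3 a == sum3 b) 1).
  by apply: sumr_ge0 => a _; apply: sumr_ge0.
move=> y; rewrite sexticE; apply: ler_sum => a _; apply: ler_sum => b _.
exact: cos_le1.
Qed.

(** Orthogonality in y then selects equal sums of squares. *)
Lemma sextic_integral : \int[mu]_(y in period) (sextic n y : R) = 2 * pi * #|resonances n|%:R.
Proof.
have ii (k : int) : cintegrable period (fun y => cis (k%:~R * y)).
  by apply: ccont_integrable; exact: ccont_cisl.
have -> : \int[mu]_(y in period) (sextic n y : R) = complex.Re (cintegral period (fun y =>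
   \sum_(a : I3) \sum_(b : I3) (if sum3 a == sum3 b then
      cis (((sqsum3 a : int) - (sqsum3 b : int))%:~R * y) else 0))).
  rewrite /=; apply: eq_Rintegral => y _; rewrite sexticE Re_sum; apply: eq_bigr => a _.
  by rewrite Re_sum big_mkcond; apply: eq_bigr => b _; case: ifP.
have i2 (a b : I3) : cintegrable period (fun y => if sum3 a == sum3 b then
      cis (((sqsum3 a : int) - (sqsum3 b : int))%:~R * y) else 0).
  by case: (sum3 a == sum3 b) => //; exact: cintegrable0.
rewrite (cintegral_sum (measurable_seg _)); last first.
  by move=> a; apply: cintegrable_sum => //; exact: measurable_seg.
rewrite Re_sum.
have -> : #|resonances n|%:R = \sum_(a : I3) \sum_(b : I3)
    ((sum3 a == sum3 b) && (sqsum3 a == sqsum3 b))%:R :> R.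
  rewrite pair_bigA /= -sum1_card natr_sum big_mkcond /=.
  by apply: eq_bigr => -[a b] _; rewrite inE /=; case: (_ && _).
rewrite mulr_sumr; apply: eq_bigr => a _.
rewrite (cintegral_sum (measurable_seg _))// Re_sum mulr_sumr; apply: eq_bigr => b _.
case: (sum3 a == sum3 b) => /=; last first.
  by rewrite mulr0 (Rintegral_cst _ (measurable_seg _)) mul0r.
have := congr1 (@complex.Re R) (@cintegral_cis R ((sqsum3 a : int) - (sqsum3 b : int))).
rewrite /= => ->; rewrite subr_eq0 eqz_nat mulr1 mulr_natr.
by case: eqP.
Qed.

End sextic_moment.

(** * Riemann sums *)

Section riemann_sums.
Context {R : realType}.
Local Notation mu := (@lebesgue_measure R).
Local Notation seg a := (`[0%R, a%R]%classic).
Variables (T : R) (g : R -> R).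
Hypothesis T_gt0 : 0 < T.
Hypothesis cg : {within seg T, continuous g}.

Definition riemann (m : nat) : R := T / m.+1%:R * \sum_(j < m.+1) g (j%:R * T / m.+1%:R).

(** On each cell the fundamental theorem of calculus and the mean value theorem
compare the integral with the value at the left end point. *)
Lemma riemann_close (e r : R) m : 0 < e -> T / m.+1%:R < r ->
  (forall s t : R, 0 <= s <= T -> 0 <= t <= T -> `|s - t| < r -> `|g s - g t| <= e) ->
  `|\int[mu]_(s in seg T) g s - riemann m| <= T * e.
Proof.
move=> e0 mr hg; set h := T / m.+1%:R.
have m0 : 0 < m.+1%:R :> R by rewrite ltr0n.
have h0 : 0 < h by rewrite divr_gt0.
have Ig : mu.-integrable (seg T) (EFin \o g) by exact: within_integrable.
pose F t := \int[mu]_(s in seg t) g s.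
have cF : {within seg T, continuous F}.
  exact: (parameterized_integral_continuous (ltW T_gt0) Ig).
have F0 : F 0 = 0.
  by rewrite /F (_ : seg 0 = [set 0]) ?Rintegral_set1// set_itv1.
have jT j : (j <= m.+1)%N -> 0 <= j%:R * h <= T.
  move=> jm; rewrite mulr_ge0 ?(ltW h0)//= /h mulrA ler_pdivrMr// mulrC ler_pM2l//.
  by rewrite ler_nat.
have step j : (j < m.+1)%N -> `|F (j.+1%:R * h) - F (j%:R * h) - h * g (j%:R * h)| <= h * e.
  move=> jm.
  have /andP[a0 aT] := jT j (ltnW jm); have /andP[b0 bT] := jT j.+1 jm.
  have ab : j%:R * h < j.+1%:R * h by rewrite ltr_pM2r// ltr_nat.
  have dF (x : R) : x \in `]j%:R * h, j.+1%:R * h[ -> is_derive x (1 : R) F (g x).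
    rewrite in_itv/= => /andP[ax xb].
    have x0 : 0 < x by exact: le_lt_trans ax.
    have xT : x < T by exact: lt_le_trans bT.
    have cgx : {for x, continuous g}.
      have /(continuous_within_itvP _ T_gt0) [ci _ _] := cg.
      by apply: ci; rewrite in_itv/= x0.
    have [dFx eFx] := continuous_FTC1_closed xT Ig x0 cgx.
    apply: DeriveDef; first exact: dFx.
    by rewrite -derive1E; exact: eFx.
  have cFab : {within `[j%:R * h, j.+1%:R * h], continuous F}.
    apply: continuous_subspaceW cF => x /=; rewrite !in_itv/= => /andP[ax xb].
    by rewrite (le_trans a0 ax) (le_trans xb bT).
  have [c cab ->] := MVT ab dF cFab.
  move: cab; rewrite in_itv/= => /andP[ac cb].
  have -> : j.+1%:R * h - j%:R * h = h by rewrite -mulrBl -natrB// subSnn mul1r.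
  rewrite [g c * h]mulrC -mulrBr normrM (gtr0_norm h0) ler_pM2l//.
  apply: hg; rewrite ?a0 ?aT//.
    by rewrite (le_trans a0 (ltW ac)) (le_trans (ltW cb) bT).
  rewrite gtr0_norm ?subr_gt0//; apply: lt_trans mr; rewrite -/h ltrBlDr.
  by apply: lt_le_trans cb _; rewrite -natr1 mulrDl mul1r addrC.
have FT : F T = \sum_(j < m.+1) (F (j.+1%:R * h) - F (j%:R * h)).
  rewrite -(big_mkord xpredT (fun j => F (j.+1%:R * h) - F (j%:R * h))).
  rewrite telescope_sumr// mul0r F0 subr0; congr F.
  by rewrite /h mulrC divfK// gt_eqF.
rewrite -/(F T) FT /riemann -/h mulr_sumr -sumrB.
apply: (@le_trans _ _ (\sum_(j < m.+1) h * e)).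
  apply: (le_trans (ler_norm_sum _ _ _)); apply: ler_sum => j _.
  by rewrite -[_ * T / _]mulrA -/h; exact: step.
rewrite sumr_const card_ord -[leLHS]mulr_natr mulrAC /h divfK ?gt_eqF//.
Qed.

Lemma riemann_cvg : riemann m @[m --> \oo] --> \int[mu]_(s in seg T) g s.
Proof.
apply/cvgrPdist_le => e e0; have e1 : 0 < e / T by rewrite divr_gt0.
have [r r0 hr] := cont_path_unif cg e1.
exists (Num.truncn (T / r)) => // m /= Nm.
rewrite (_ : e = T * (e / T)); last by rewrite mulrC divfK// gt_eqF.
apply: (riemann_close e1 _ hr).
rewrite ltr_pdivrMr// mulrC -ltr_pdivrMr//.
by apply: lt_le_trans (truncnS_gt _) _; rewrite ler_nat ltnS.
Qed.

End riemann_sums.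

(** * Lower bound for the expected sixth moment *)

Section expected_sextic.
Context {R : realType} {d : measure_display} {Omega : measurableType d}.
Variable P : probability Omega R.
Variable T : R.
Hypothesis T_gt0 : 0 < T.
Local Notation mu := (@lebesgue_measure R).
Local Notation seg a := (`[0%R, a%R]%classic).
Local Notation period := (`[0 : R, 2 * pi]%classic).
Variable n : nat.

(** A lower bound on [0, 2 pi] for the centered Gaussian densities with variance in
[T / 2, T]. *)
Definition gaussian_floor : R := (Num.sqrt (T * pi *+ 2))^-1 * expR (- ((2 * pi) ^+ 2 / T)).

Lemma gaussian_floor_gt0 : 0 < gaussian_floor.
Proof.
by rewrite mulr_gt0 ?expR_gt0// invr_gt0 sqrtr_gt0 mulrn_wgt0// mulr_gt0// pi_gt0.
Qed.

Lemma normal_pdf_ge (s y : R) : T / 2 <= s <= T -> 0 <= y <= 2 * pi ->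
  gaussian_floor <= normal_pdf 0 (Num.sqrt s) y.
Proof.
have Tp := T_gt0.
move=> /andP[s1 s2] /andP[y0 y1]; have s0 : 0 < s by lra.
have ss : Num.sqrt s ^+ 2 = s by rewrite sqr_sqrtr// ltW.
rewrite normal_pdfE ?gt_eqF ?sqrtr_gt0// /gaussian_floor /normal_peak /normal_fun ss subr0.
have p0 : 0 < s * pi *+ 2 by rewrite mulrn_wgt0// mulr_gt0// pi_gt0.
have q0 : 0 < T * pi *+ 2 by rewrite mulrn_wgt0// mulr_gt0// pi_gt0.
apply: ler_pM; rewrite ?invr_ge0 ?sqrtr_ge0 ?expR_ge0//.
  rewrite lef_pV2 ?posrE ?sqrtr_gt0//; apply: ler_wsqrtr; apply: ler_wMn2r.
  by apply: ler_wpM2r => //; exact/ltW/pi_gt0.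
rewrite ler_expR mulNr lerN2.
have y2 : y ^+ 2 <= (2 * pi) ^+ 2.
  by rewrite ler_pXn2r// nnegrE//; lra.
have e1 : 0 <= y ^+ 2 by exact: sqr_ge0.
apply: ler_pM => //; first by rewrite invr_ge0 mulrn_wge0//; exact: ltW.
by rewrite lef_pV2 ?posrE ?mulrn_wgt0// -[s *+ 2]mulr_natr; lra.
Qed.

Lemma within_comp (B : set R) (f g : R -> R) : {within B, continuous f} -> continuous g ->
  {within B, continuous (fun s => g (f s))}.
Proof. by move=> cf cg s; exact: (continuous_comp (cf s) (cg (f s))). Qed.

Lemma sextic_measurable : measurable_fun setT (sextic n : R -> R).
Proof. by apply: continuous_measurable_fun; exact: sextic_cont. Qed.

Lemma sextic_comp_integrable (Z : Omega -> R) : measurable_fun setT Z ->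
  P.-integrable setT (EFin \o (fun w => sextic n (Z w))).
Proof.
move=> mZ; have [M M0 hM] := @sextic_bnd R n.
apply: (@le_integrable _ _ _ P setT _ _ (cst M%:E)) => //.
- by apply/measurable_EFinP; apply: (measurableT_comp sextic_measurable mZ).
- by move=> w _; rewrite /= lee_fin !ger0_norm// sextic_ge0.
- exact: finite_measure_integrable_cst.
Qed.

(** The law of Z dominates the uniform law on [0, 2 pi] multiplied by
gaussian_floor * (2 pi), and the integral of the sextic is known over a full
period. *)
Lemma expected_sextic_ge (Z : Omega -> R) (s : R) : measurable_fun setT Z ->
  T / 2 <= s <= T ->
  (forall B : set (measurableTypeR R), measurable B ->
    P (Z @^-1` B) = normal_prob 0 (Num.sqrt s) B) ->
  gaussian_floor * (2 * pi * #|resonances n|%:R) <= \int[P]_w sextic n (Z w).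
Proof.
move=> mZ sT law.
have mQ : measurable_fun setT (fun y : measurableTypeR R => (sextic n y)%:E).
  by apply/measurable_EFinP; exact: sextic_measurable.
have Q0 (y : measurableTypeR R) : (0 <= (sextic n y)%:E)%E by rewrite lee_fin sextic_ge0.
have mZ' : measurable_fun setT (Z : Omega -> measurableTypeR R) by exact: mZ.
pose m2 : {measure set (measurableTypeR R) -> \bar R} :=
  measure_function_pushforward__canonical__measure_function_Measure P mZ'.
have k0 : 0 <= gaussian_floor * (2 * pi).
  by rewrite mulr_ge0// ltW ?gaussian_floor_gt0 ?twopi_gt0.
pose m1 := mscale (NngNum k0) (uniform_prob (@twopi_gt0 R)).
have le12 (B : set (measurableTypeR R)) : measurable B -> (m1 B <= m2 B)%E.
  move=> mB; rewrite [leRHS](law B mB) /m1 /mscale /=.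
  rewrite /uniform_prob /normal_prob -ge0_integralZl//; first last.
  - by move=> x _; rewrite lee_fin uniform_pdf_ge0// twopi_gt0.
  - by apply/measurable_EFinP; apply: measurable_funTS; exact: measurable_uniform_pdf.
  apply: ge0_le_integral => //.
  - by move=> x _; rewrite -EFinM lee_fin mulr_ge0// uniform_pdf_ge0// twopi_gt0.
  - apply: measurable_funeM; apply/measurable_EFinP; apply: measurable_funTS.
    exact: measurable_uniform_pdf.
  - apply/measurable_EFinP; apply: measurable_funTS; exact: measurable_normal_pdf.
  move=> x _; rewrite -EFinM lee_fin /uniform_pdf subr0; case: ifP => [xp|_].
    by rewrite mulfK ?gt_eqF ?twopi_gt0//; exact: normal_pdf_ge.
  by rewrite mulr0 normal_pdf_ge0.
have := ge0_le_measure_integral le12 measurableT Q0 mQ.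
rewrite (ge0_integral_mscale _ measurableT _ mQ)//= integral_uniform//.
rewrite (ge0_integral_pushforward mZ' P measurableT mQ); last by move=> y _.
have Ip : mu.-integrable period (EFin \o (sextic n : R -> R)).
  by apply: within_integrable; apply: continuous_subspaceT; exact: sextic_cont.
have fin1 := integrable_fin_num (measurable_seg _) Ip.
have fin2 := integrable_fin_num measurableT (sextic_comp_integrable mZ).
rewrite preimage_setT -(fineK fin1) -(fineK fin2) -!EFinM lee_fin.
rewrite -/(Rintegral _ _ _) -[fine (\int[P]_x _)]/(\int[P]_w sextic n (Z w)).
move=> h; apply: le_trans h.
have := @sextic_integral R n; rewrite /Rintegral => ->.
rewrite subr0 [X in _ <= _ * X]mulrA mulVf ?mul1r ?gt_eqF ?twopi_gt0//.
by rewrite mulrA.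
Qed.

Variable X : R -> Omega -> R.
Hypothesis Xcont : forall w, cont_path T (X ^~ w).
Hypothesis Xmeas : forall t : R, 0 <= t <= T -> measurable_fun setT (X t).
Hypothesis Xlaw : forall s : R, T / 2 <= s <= T -> forall B : set (measurableTypeR R),
  measurable B -> P (X s @^-1` B) = normal_prob 0 (Num.sqrt s) B.

Definition path_sextic (w : Omega) : R := \int[mu]_(s in seg T) sextic n (X s w).

Lemma path_sextic_cont w : {within seg T, continuous (fun s => sextic n (X s w))}.
Proof.
exact: (within_comp (@Xcont w) (@sextic_cont R n)).
Qed.

(** Riemann sums reduce the expectation of the time integral to the laws at single
times. There are 2 p + 2 cells, so that T / 2 is a grid point. *)
Definition path_riemann (p : nat) (w : Omega) : R :=
  riemann T (fun s => sextic n (X s w)) (2 * p).+1.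

Lemma path_riemann_cvg w : path_riemann p w @[p --> \oo] --> path_sextic w.
Proof.
have := riemann_cvg T_gt0 (@path_sextic_cont w); rewrite -/(path_sextic w) => h.
apply: (cvg_comp (fun p : nat => (2 * p).+1) _ _ h).
move=> A [N _ NA]; exists N => // p /= Np; apply: NA => /=.
by rewrite (leq_trans Np)// leqW// leq_pmull.
Qed.

Lemma path_riemann_measurable p : measurable_fun setT (path_riemann p).
Proof.
apply: measurable_funM => //; apply: measurable_sum => j.
apply: (measurableT_comp sextic_measurable); apply/Xmeas/grid_time => //.
exact/ltnW/ltn_ord.
Qed.

Lemma path_riemann_bnd : exists2 M : R, 0 <= M & forall p w, `|path_riemann p w| <= M.
Proof.
have [M M0 hM] := @sextic_bnd R n; exists (T * M) => [|p w]; first by rewrite mulr_ge0// ltW.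
have m0 : 0 < (2 * p).+2%:R :> R by rewrite ltr0n.
have h0 : 0 < T / (2 * p).+2%:R by rewrite divr_gt0.
rewrite /path_riemann /riemann normrM (gtr0_norm h0).
rewrite (_ : T * M = T / (2 * p).+2%:R * ((2 * p).+2%:R * M)); last first.
  by rewrite mulrA divfK// gt_eqF.
rewrite ler_pM2l// (le_trans (ler_norm_sum _ _ _))//.
rewrite (_ : (2 * p).+2%:R * M = \sum_(j < (2 * p).+2) M); last first.
  by rewrite sumr_const card_ord mulr_natl.
by apply: ler_sum => j _; rewrite ger0_norm// sextic_ge0.
Qed.

Lemma path_sextic_measurable : measurable_fun setT path_sextic.
Proof.
apply: (@measurable_fun_cvg _ _ _ _ path_riemann).
  exact: path_riemann_measurable.
by move=> w _; exact: path_riemann_cvg.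
Qed.

(** The p + 1 grid times in [T / 2, T] carry the lower bound, half of the total
weight; the other ones contribute nonnegative terms. *)
Lemma expected_path_riemann_ge p :
  T / 2 * (gaussian_floor * (2 * pi * #|resonances n|%:R)) <= \int[P]_w path_riemann p w.
Proof.
set k := gaussian_floor * _.
have m0 : 0 < (2 * p).+2%:R :> R by rewrite ltr0n.
have h0 : 0 < T / (2 * p).+2%:R by rewrite divr_gt0.
pose t (j : nat) : R := j%:R * T / (2 * p).+2%:R.
have It (j : 'I_(2 * p).+2) : P.-integrable setT (EFin \o (fun w => sextic n (X (t j) w))).
  by apply: sextic_comp_integrable; apply/Xmeas/grid_time => //; exact/ltnW/ltn_ord.
have -> : \int[P]_w path_riemann p w =
    T / (2 * p).+2%:R * \sum_(j < (2 * p).+2) \int[P]_w sextic n (X (t j) w).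
  have Is (r : seq 'I_(2 * p).+2) :
      P.-integrable setT (EFin \o (fun w => \sum_(j <- r) sextic n (X (t j) w))) /\
      \int[P]_w (\sum_(j <- r) sextic n (X (t j) w)) = \sum_(j <- r) \int[P]_w sextic n (X (t j) w).
    elim: r => [|j r [IH1 IH2]].
      under [X in EFin \o X]eq_fun do rewrite big_nil.
      under eq_Rintegral do rewrite big_nil.
      split; first exact: integrable0.
      by rewrite big_nil Rintegral_cst// mul0r.
    under [X in EFin \o X]eq_fun do rewrite big_cons.
    under eq_Rintegral do rewrite big_cons.
    split; last by rewrite big_cons RintegralD// IH2.
    exact: (integrableD measurableT (It j) IH1).
  have [I1 <-] := Is (index_enum _).
  by rewrite -(RintegralZl _ measurableT I1).
have ge j : (p.+1 <= j < (2 * p).+2)%N -> k <= \int[P]_w sextic n (X (t j) w).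
  move=> /andP[pj jp]; have tj : T / 2 <= t j <= T.
    have j1 : (2 * p).+2%:R <= 2 * j%:R :> R by rewrite -natrM ler_nat; lia.
    have j2 : j%:R <= (2 * p).+2%:R :> R by rewrite ler_nat ltnW.
    have Tp := T_gt0; rewrite /t ler_pdivlMr// ler_pdivrMr//.
    by apply/andP; split; nra.
  apply: (expected_sextic_ge _ tj); last exact: Xlaw.
  by apply/Xmeas/grid_time => //; exact: ltnW.
have ge0 j : 0 <= \int[P]_w sextic n (X (t j) w).
  by apply: Rintegral_ge0 => w _; exact: sextic_ge0.
have S : p.+1%:R * k <= \sum_(j < (2 * p).+2) \int[P]_w sextic n (X (t j) w).
  rewrite -(big_mkord xpredT (fun j => \int[P]_w sextic n (X (t j) w))).
  rewrite (big_cat_nat _ (n := p.+1))//=; last by lia.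
  rewrite -[leLHS]add0r; apply: lerD; first by apply: sumr_ge0.
  rewrite (_ : p.+1%:R * k = \sum_(p.+1 <= j < (2 * p).+2) k); last first.
    rewrite sumr_const_nat mulr_natl; congr (_ *+ _); lia.
  by apply: ler_sum_nat => j; exact: ge.
apply: le_trans (ler_wpM2l (ltW h0) S).
apply: ler_eq.
have -> : (2 * p).+2%:R = 2 * p.+1%:R :> R by rewrite -natrM; congr _%:R; lia.
have : p.+1%:R != 0 :> R by rewrite pnatr_eq0.
by move: p.+1%:R => q q0; field.
Qed.

(** Dominated convergence of the Riemann sums, which are uniformly bounded. *)
Lemma expected_path_sextic : P.-integrable setT (EFin \o path_sextic) /\
  T / 2 * (gaussian_floor * (2 * pi * #|resonances n|%:R)) <= \int[P]_w path_sextic w.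
Proof.
have [M M0 hM] := path_riemann_bnd.
have [] := @dominated_convergence _ _ _ P setT measurableT
  (fun p w => (path_riemann p w)%:E) (EFin \o path_sextic) (cst M%:E).
- by move=> p; apply/measurable_EFinP; exact: path_riemann_measurable.
- by apply/measurable_EFinP; exact: path_sextic_measurable.
- by apply: aeW => w _; apply: cvg_EFin; [exact: nearW|exact: path_riemann_cvg].
- exact: finite_measure_integrable_cst.
- by apply: aeW => w p _; rewrite /= lee_fin.
move=> If _ cv; split=> //.
have Ip p : P.-integrable setT (EFin \o path_riemann p).
  apply: (@le_integrable _ _ _ P setT _ _ (cst M%:E)) => //.
  - by apply/measurable_EFinP; exact: path_riemann_measurable.
  - by move=> w _; rewrite /= lee_fin [leRHS]ger0_norm.
  - exact: finite_measure_integrable_cst.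
have fin := integrable_fin_num measurableT If.
rewrite -lee_fin -[\int[P]_w path_sextic w]/(fine (\int[P]_w (path_sextic w)%:E)) (fineK fin).
apply: (cvge_ge _ cv); apply: nearW => p /=.
have finp := integrable_fin_num measurableT (Ip p).
rewrite -(fineK finp) lee_fin; exact: expected_path_riemann_ge.
Qed.

End expected_sextic.

(** * A version of Brownian motion with continuous paths *)

Section brownian_version.
Context {R : realType} {d : measure_display} {Omega : measurableType d}.
Variables (P : probability Omega R) (W : R -> Omega -> R) (T : R).

Lemma measure_le_null (S S' A : set Omega) : measurable S -> measurable S' -> measurable A ->
  P A = 0%E -> S `<=` S' `|` A -> (P S <= P S')%E.
Proof.
move=> mS mS' mA A0 SS'; apply: (@le_trans _ _ (P (S' `|` A))).
  by apply: le_measure; rewrite ?inE//; exact: measurableU.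
by rewrite -[leRHS]adde0 -A0; exact: measureU2.
Qed.

(** The paths are replaced by 0 on the null set where they do not start at 0 or are
not continuous. Elsewhere the initial position is subtracted, so that the law at
time s is that of the increment from 0 to s. *)
Lemma brownian_version : 0 < T -> brownian_motion P W -> exists X : R -> Omega -> R,
  [/\ forall w, cont_path T (X ^~ w),
      forall t : R, 0 <= t <= T -> measurable_fun setT (X t),
      forall s : R, T / 2 <= s <= T -> forall B : set (measurableTypeR R), measurable B ->
        P (X s @^-1` B) = normal_prob 0 (Num.sqrt s) B &
      {ae P, forall w, forall t : R, 0 <= t <= T -> W t w = X t w}].
Proof.
move=> T0 [mW W0 lawW _ contW].
have [A [mA A0 QA]] := ae_and W0 contW.
have good w : ~ A w -> W 0 w = 0 /\ {within `[0, +oo[, continuous (W ^~ w)}.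
  by move=> nA; apply: contrapT => nQ; exact: nA (QA w nQ).
pose X t w := (W t w - W 0 w) * \1_(~` A) w.
have mX (t : R) : 0 <= t -> measurable_fun setT (X t).
  move=> t0; apply: measurable_funM; first by apply: measurable_funB; exact: mW.
  by apply: measurable_indic; exact: measurableC.
have XA t w : ~ A w -> X t w = W t w - W 0 w.
  by move=> nA; rewrite /X indicE mem_set// mulr1.
exists X; split.
- move=> w; have [Aw|nA] := pselect (A w).
    rewrite /cont_path (_ : X ^~ w = cst 0); first by move=> t; exact: cvg_cst.
    by apply/funext => t; rewrite /X indicE memNset ?mulr0//= => /(_ Aw).
  have [_ cw] := good w nA.
  have cw' : {within `[0, T], continuous (W ^~ w)}.
    apply: continuous_subspaceW cw => t /=; rewrite !in_itv/= => /andP[-> _] //.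
  rewrite /cont_path (_ : X ^~ w = fun t => W t w - W 0 w); last by apply/funext => t; exact: XA.
  by move=> t; apply: cvgB; [exact: cw'|exact: cvg_cst].
- by move=> t /andP[t0 _]; exact: mX.
- move=> s /andP[s1 _] B mB; have s0 : 0 < s by lra.
  have mXB : measurable (X s @^-1` B).
    by have := mX s (ltW s0) measurableT B mB; rewrite setTI.
  have mWB : measurable [set w | B (W s w - W 0 w)].
    have mI : measurable_fun setT (fun w => W s w - W 0 w).
      by apply: measurable_funB; apply: mW => //; exact: ltW.
    by have := mI measurableT B mB; rewrite setTI.
  have := lawW 0 s (lexx 0) s0 B mB; rewrite subr0 => <-.
  apply/eqP; rewrite eq_le; apply/andP; split; apply: (measure_le_null _ _ mA A0) => // w /=.
    by have [Aw|nA] := pselect (A w); [right|left; rewrite -XA].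
  by have [Aw|nA] := pselect (A w); [right|left; rewrite XA].
- exists A; split=> // w /= nQ; apply: contrapT => nA; apply: nQ => t tT.
  by rewrite XA//; have [-> _] := good w nA; rewrite subr0.
Qed.

End brownian_version.

(** * The fifth difference of the solution map *)

Section differences_along_a_line.
Context {R : realType}.

Lemma fdiff_line (V W : lmodType R) m (f : V -> W) (v : V) (e a : R) :
  fdiff m (e *: v) f (a *: v) = fdiff m (e : R^o) (fun s : R^o => f (s *: v)) a.
Proof. by elim: m a => [//|m IH] a /=; rewrite -scalerDl !IH. Qed.

Lemma linear_fdiff (V W : lmodType R) m (f : V -> W) (l : W -> R) (h x : V) :
  linear_for *%R l -> l (fdiff m h f x) = fdiff m h (fun y => l (f y) : R^o) x.
Proof.
move=> lin; elim: m x => [//|m IH] x /=.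
by rewrite -!IH addrC -scaleN1r lin mulN1r addrC.
Qed.

Lemma fdiffB m (f g : R^o -> R^o) (h x : R^o) :
  fdiff m h f x - fdiff m h g x = fdiff m h (fun y => f y - g y) x.
Proof. by elim: m x => [//|m IH] x /=; rewrite -!IH opprB addrACA [in RHS]opprB; ring. Qed.

Lemma fdiff_norm_le m (f : R^o -> R^o) (e x M : R) : 0 <= e ->
  (forall y : R, x <= y <= x + m%:R * e -> `|f y| <= M) ->
  `|fdiff m (e : R^o) f x| <= 2 ^+ m * M.
Proof.
move=> e0; elim: m x => [|m IH] x hf /=.
  by rewrite expr0 mul1r; apply: hf; rewrite mul0r addr0 lexx.
rewrite exprS -mulrA mulr_natl mulr2n (le_trans (ler_normB _ _))// lerD//.
  apply: IH => y /andP[y1 y2]; apply: hf; rewrite (le_trans _ y1) ?lerDl//=.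
  by rewrite (le_trans y2)// -natr1 mulrDl mul1r [_ * e + e]addrC addrA.
apply: IH => y /andP[y1 y2]; apply: hf; rewrite y1/= (le_trans y2)// lerD2l.
by rewrite ler_wpM2r// ler_nat.
Qed.

Lemma fdiff_pow5 (e q : R) : fdiff 5 (e : R^o) (fun s : R^o => s ^+ 5 * q : R^o) 0 = 120 * e ^+ 5 * q.
Proof. by rewrite /=; ring. Qed.

End differences_along_a_line.

Section expansion_along_a_line.
Context {R : realType} {d : measure_display} {Omega : measurableType d}.
Variables (P : probability Omega R) (T : R).
Hypothesis T_gt0 : 0 < T.
Variable n : nat.

Definition profile : L2_torus R := cls (L2_seminormed R) (dirichlet n 0).

Lemma norm_profile : `|profile| = Num.sqrt (2 * pi * n%:R).
Proof.
rewrite (norm_cls (E := L2_seminormed R) (L2_dom_dirichlet n 0)) /= /L2_semi.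
by rewrite dirichlet_sq_integral.
Qed.

Lemma cls_datum (s : R) : cls (L2_seminormed R) (eval (datum T n s) (fun=> 0) 0) = s *: profile.
Proof.
rewrite -(clsZ (E := L2_seminormed R) s (L2_dom_dirichlet n 0)); congr cls.
by apply/funext => x; rewrite eval_datum realM.
Qed.

Lemma L2_dom_datum (s : R) : L2_dom (eval (datum T n s) (fun=> 0) 0).
Proof.
apply: L2_dom_cont; first by move=> x; exact: eval_periodic.
exact: eval_contx.
Qed.

Variable X : R -> Omega -> R.
Hypothesis Xcont : forall w, cont_path T (X ^~ w).
Hypothesis Xmeas : forall t : R, 0 <= t <= T -> measurable_fun setT (X t).

Lemma measurable_final : measurable_fun setT (X T).
Proof. by apply: Xmeas; rewrite lexx ltW. Qed.

Variable s : R.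
Local Notation A := (n%:R * `|s|).
Hypothesis small : 320 * T * A ^+ 4 <= 1.
Local Notation u0 := (datum T n s).

(** The constructed solution is mild and bounded, so the uniqueness class contains
it. *)
Lemma solution_map_profile (W : R -> Omega -> R) (U : set (L2_torus R)) S :
  {ae P, forall w, forall t : R, 0 <= t <= T -> W t w = X t w} ->
  solution_map W U S -> U (s *: profile) -> S (s *: profile) = solution_process P T_gt0 u0 X.
Proof.
move=> WX [K [KX KS]] Us; have [_ _ uniq] := KS _ Us.
have mild : mild_solution W (s *: profile) (solution_process P T_gt0 u0 X).
  apply: (solution_process_mild T_gt0 (datumA T n s) small Xcont Xmeas WX) => w t k cw tT.
  rewrite fourier_coef_datum -cls_datum fourier_coef_cls//; exact: L2_dom_datum.
apply/esym/uniq; last exact: mild.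
apply: (KX _ _ Us mild).
exact: (solution_process_bounded P T_gt0 (datumA T n s) small Xcont Xmeas).
Qed.

Lemma observe_random_path w : observe_final n (X T w) (random_path T_gt0 u0 X w) =
  imag_pairing n (X T w) (solution (ltW T_gt0) u0 (X ^~ w) T).
Proof.
have TT : 0 <= T <= T by rewrite lexx ltW.
have cw := @Xcont w; rewrite /random_path /path_class (observe_final_cls T_gt0).
  apply: observe_cls; exact: (solution_L2 T_gt0 (datumA T n s) small).
exact: (trajectory_dom (datumA T n s) small).
Qed.

Hypothesis Ipath : P.-integrable setT (EFin \o path_sextic T n X).

(** Expectation of the expansion along each path; its remainder is deterministic. *)
Lemma observation_expansion :
  `|observation n (X T) (solution_process P T_gt0 u0 X) - s ^+ 5 * \int[P]_w path_sextic T n X w|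
  <= 1280 * T ^+ 2 * n%:R * A ^+ 9.
Proof.
have dom := random_path_dom P T_gt0 (datumA T n s) small Xcont Xmeas.
have := observe_final_integrable T_gt0 n measurable_final dom.
rewrite (observation_cls T_gt0 n measurable_final dom) /expected_observation.
have -> : (fun w => observe_final n (X T w) (random_path T_gt0 u0 X w)) =
    fun w => imag_pairing n (X T w) (solution (ltW T_gt0) u0 (X ^~ w) T).
  by apply/funext => w; exact: observe_random_path.
move=> I1.
have I2 : P.-integrable setT (EFin \o (fun w => s ^+ 5 * path_sextic T n X w)).
  rewrite (_ : EFin \o _ = fun w => ((s ^+ 5)%:E * (path_sextic T n X w)%:E)%E).
    exact: (integrableZl measurableT).
  by apply/funext => w /=; rewrite EFinM.
rewrite -(RintegralZl _ measurableT Ipath) -(RintegralB measurableT I1 I2).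
have I3 := integrableB measurableT I1 I2.
have b w : `|imag_pairing n (X T w) (solution (ltW T_gt0) u0 (X ^~ w) T) -
    s ^+ 5 * path_sextic T n X w| <= 1280 * T ^+ 2 * n%:R * A ^+ 9.
  have cw := @Xcont w.
  rewrite -(RintegralZl _ (measurable_seg T) (within_integrable (@path_sextic_cont _ _ _ _ n _ Xcont w))).
  exact: (imag_pairing_expansion T_gt0 small cw).
apply: (le_trans (le_normr_Rintegral measurableT I3)).
apply: (@le_trans _ _ (\int[P]_w (1280 * T ^+ 2 * n%:R * A ^+ 9))).
  apply: (le_Rintegral measurableT).
  - exact: (integrable_norm I3).
  - exact: finite_measure_integrable_cst.
  - by move=> w _; exact: b.
rewrite Rintegral_cst// -[leRHS]mulr1.
by have -> : fine (P setT) = 1 by exact: (congr1 fine (@probability_setT _ _ _ P)).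
Qed.

End expansion_along_a_line.

Section growth.
Context {R : realType}.

Lemma pairing_const_norm (n : nat) :
  pairing_const n * Num.sqrt (2 * pi * n%:R) ^+ 5 = (2 * pi) ^+ 2 * n%:R ^+ 3 :> R.
Proof.
have p0 := @twopi_gt0 R.
rewrite /pairing_const mulrAC -exprS.
have -> : Num.sqrt (2 * pi * n%:R) ^+ 6 = (2 * pi * n%:R) ^+ 3 :> R.
  by rewrite (_ : 6 = (2 * 3))%N// exprM sqr_sqrtr// mulr_ge0// ltW.
by move: p0; move: (2 * pi) => x x0; field; rewrite gt_eqF.
Qed.

(** Division by e^5, then e tends to 0. *)
Lemma limit_le (a b M r : R) : 0 < r -> 0 <= M ->
  (forall e : R, 0 < e < r -> a * e ^+ 5 <= b * e ^+ 5 + M * e ^+ 9) -> a <= b.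
Proof.
move=> r0 M0 h; apply/ler_addgt0Pr => t t0.
pose e : R := Num.min (Num.min 1 (r / 2)) (t / (M + 1)).
have M1 : 0 < M + 1 by lra.
have e0 : 0 < e by rewrite !lt_min ltr01 !divr_gt0.
have e1 : e <= 1 by rewrite !ge_min lexx.
have er : e < r.
  by apply: (@le_lt_trans _ _ (r / 2)); [rewrite !ge_min lexx orbT|lra].
have et : e * (M + 1) <= t by rewrite -ler_pdivlMr// ge_min lexx orbT.
have := h e; rewrite e0 er => /(_ isT).
have -> : b * e ^+ 5 + M * e ^+ 9 = (b + M * e ^+ 4) * e ^+ 5 by ring.
rewrite ler_pM2r ?exprn_gt0// => /le_trans; apply; rewrite lerD2l.
have e4 : e ^+ 4 <= e by rewrite -[leRHS]expr1 ler_wiXn2l// ltW.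
apply: le_trans et; rewrite [leLHS]mulrC; apply: ler_pM => //.
- by rewrite exprn_ge0// ltW.
- by lra.
Qed.

Lemma mul_exp4_le1 (c y : R) : 0 <= c -> 0 <= y -> y <= (c + 1)^-1 -> c * y ^+ 4 <= 1.
Proof.
move=> c0 y0 yc; have c1 : 0 < c + 1 by lra.
have y1 : y <= 1 by apply: (le_trans yc); rewrite invf_le1//; lra.
have y4 : y ^+ 4 <= y by rewrite -[leRHS]expr1 ler_wiXn2l.
apply: (@le_trans _ _ ((c + 1) * (c + 1)^-1)); last by rewrite mulfV// gt_eqF.
by apply: ler_pM; [|rewrite exprn_ge0|lra|exact: le_trans y4 yc].
Qed.

End growth.

Section main_estimate.
Context {R : realType} {d : measure_display} {Omega : measurableType d}.
Variables (P : probability Omega R) (T : R).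
Hypothesis T_gt0 : 0 < T.
Variable n : nat.
Variables (X W : R -> Omega -> R).
Hypothesis Xcont : forall w, cont_path T (X ^~ w).
Hypothesis Xmeas : forall t : R, 0 <= t <= T -> measurable_fun setT (X t).
Hypothesis WX : {ae P, forall w, forall t : R, 0 <= t <= T -> W t w = X t w}.
Hypothesis Ipath : P.-integrable setT (EFin \o path_sextic T n X).
Variables (U V : set (L2_torus R)) (S : L2_torus R -> solution_space P T).
Hypothesis solS : solution_map W U S.
Hypotheses (oV : open V) (V0 : V 0) (VU : V `<=` U).
Variables (r C : R).
Hypotheses (r_gt0 : 0 < r) (C_ge0 : 0 <= C).
Hypothesis bound : forall (l : solution_space P T -> R) (L : R),
  linear_for *%R l -> 0 <= L -> (forall y, `|l y| <= L * `|y|) ->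
  forall x h, `|x| < r -> `|h| < r -> `|l (fdiff 5 h S x)| <= C * L * `|h| ^+ 5.
Local Notation v := (@profile R n).
Local Notation q := (\int[P]_w path_sextic T n X w).
Local Notation obs := (observation n (X T)).
Local Notation M := (1280 * T ^+ 2 * n%:R * n%:R ^+ 9).

Lemma remainder_const_ge0 : 0 <= M.
Proof.
have h (c x y z : R) : 0 <= c -> 0 <= x -> 0 <= y -> 0 <= z -> 0 <= c * x * y * z.
  by move=> *; rewrite !mulr_ge0.
apply: h; [exact: ler0n|exact: sqr_ge0|exact: ler0n|].
by apply: exprn_ge0; exact: ler0n.
Qed.

(** The range of steps for which the data are admissible and small enough for the
Picard iteration; it may depend on n, unlike r and C. *)
Lemma small_range : exists2 b : R, 0 < b & forall s : R, `|s| < b ->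
  [/\ U (s *: v), `|s *: v| < r & 320 * T * (n%:R * `|s|) ^+ 4 <= 1].
Proof.
have Tp := T_gt0.
have /nbhs_normP [a /= a0 aV] := open_nbhs_nbhs (conj oV V0).
have v1 : 0 < `|v| + 1 by rewrite ltr_wpDl.
have n1 : 0 < n%:R + 1 :> R by rewrite ltr_wpDl.
have T1 : 0 < 320 * T + 1 by lra.
exists (Num.min (Num.min a r / (`|v| + 1)) ((320 * T + 1)^-1 / (n%:R + 1))).
  by rewrite lt_min !divr_gt0 ?invr_gt0// lt_min a0 r_gt0.
move=> s; rewrite lt_min => /andP[s1 s2].
have sv : `|s *: v| < Num.min a r.
  rewrite normrZ; apply: (@le_lt_trans _ _ (`|s| * (`|v| + 1))).
    by apply: ler_wpM2l => //; rewrite lerDl.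
  by rewrite -ltr_pdivlMr.
move: sv; rewrite lt_min => /andP[sa sr]; split; [|exact: sr|].
  by apply/VU/aV; rewrite /= sub0r normrN.
have sn : n%:R * `|s| <= (320 * T + 1)^-1.
  apply: (@le_trans _ _ ((n%:R + 1) * `|s|)); first by rewrite ler_wpM2r// lerDl.
  by rewrite mulrC -ler_pdivlMr// ltW.
apply: mul_exp4_le1 sn; first by lra.
by rewrite mulr_ge0.
Qed.

(** Along the line spanned by the profile, the functional applied to S is
s |-> s^5 q up to a remainder of order s^9. Its fifth difference with step e is
120 e^5 q up to 2^5 times the remainder on [0, 5 e], whereas the C^5 bound is
C e^5 times the norm of the functional times |profile|^5. *)
Lemma expected_sextic_bound : 120 * q <= C * ((2 * pi) ^+ 2 * n%:R ^+ 3).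
Proof.
have Tp := T_gt0.
have [b b0 hb] := small_range.
have M0 := remainder_const_ge0.
have b6 : 0 < b / 6 by lra.
have mY := measurable_final T_gt0 Xmeas.
have N0 : 0 <= 2 ^+ 5 * (M * 5 ^+ 9).
  exact: (mulr_ge0 (exprn_ge0 _ (ler0n _ 2)) (mulr_ge0 M0 (exprn_ge0 _ (ler0n _ 5)))).
apply: (limit_le b6 N0).
move=> e /andP[e0 eb].
have [_ ev _] : [/\ U (e *: v), `|e *: v| < r & 320 * T * (n%:R * `|e|) ^+ 4 <= 1].
  by apply: hb; rewrite gtr0_norm//; lra.
have lin : linear_for *%R (obs : solution_space P T -> R) by exact: observation_linear.
have K0 := @pairing_const_ge0 R n.
have := bound lin K0 (observation_bnd T_gt0 n mY) (x := 0) (h := e *: v).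
rewrite normr0 => /(_ r_gt0 ev); rewrite (linear_fdiff _ _ _ _ lin).
rewrite -{1}(scale0r v) fdiff_line normrZ (gtr0_norm e0) norm_profile exprMn.
pose g (s : R^o) : R^o := obs (S (s *: v)).
pose p (s : R^o) : R^o := s ^+ 5 * q.
rewrite -/g => hg.
have := @fdiff_norm_le R 5 (fun s => p s - g s) e 0 (M * (5 * e) ^+ 9) (ltW e0).
rewrite -fdiffB fdiff_pow5 add0r => hd.
have rem : `|120 * e ^+ 5 * q - fdiff 5 (e : R^o) g 0| <= 2 ^+ 5 * (M * (5 * e) ^+ 9).
  apply: hd => s /andP[s0 s5]; rewrite distrC /g /p.
  have sb : `|s| < b by rewrite ger0_norm//; lra.
  have [Us _ small] := hb s sb.
  rewrite (solution_map_profile T_gt0 Xcont Xmeas small WX solS Us).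
  apply: (le_trans (observation_expansion T_gt0 Xcont Xmeas small Ipath)).
  rewrite exprMn [leLHS]mulrA (ger0_norm s0); apply: (ler_wpM2l M0).
  by apply: lerXn2r => //; rewrite nnegrE; lra.
have := ler_normD (120 * e ^+ 5 * q - fdiff 5 (e : R^o) g 0) (fdiff 5 (e : R^o) g 0).
rewrite subrK => /(le_trans (ler_norm _)) h.
have -> : 120 * q * e ^+ 5 = 120 * e ^+ 5 * q by ring.
apply: (le_trans h); rewrite addrC; apply: lerD; last first.
  by apply: (le_trans rem); rewrite exprMn -!mulrA.
apply: (le_trans hg); rewrite -pairing_const_norm; apply: ler_eq.
by ring.
Qed.

End main_estimate.

Theorem theorem3 (R : realType) (d : measure_display) (Omega : measurableType d)
    (P : probability Omega R) (W : R -> Omega -> R) (T : R)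
    (U : set (L2_torus R)) (S : L2_torus R -> solution_space P T) :
  brownian_motion P W ->
  0 < T ->
  open U -> U 0 ->
  solution_map W U S ->
  (forall u0, U u0 -> {for u0, continuous S}) ->
  forall V : set (L2_torus R), open V -> V 0 -> V `<=` U -> ~ class_C 5 V S.
Proof.
move=> bmW T_gt0 _ _ solS _ V oV V0 VU CS.
have [X [Xcont Xmeas Xlaw WX]] := brownian_version T_gt0 bmW.
have [r [C [r_gt0 C_ge0 bound]]] := fdiff_bound oV V0 CS.
have G0 := gaussian_floor_gt0 T_gt0; set G := gaussian_floor T in G0.
have p0 := @twopi_gt0 R.
have c60 : 0 < 60 :> R by rewrite ltr0n.
have c0 : 0 < 60 * T * G := mulr_gt0 (mulr_gt0 c60 T_gt0) G0.
(* 120 q_n is then at least 2 pi (C (2 pi) + 1) n^3 *)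
have [n n_gt0 resn] := @resonances_unbounded R ((C * (2 * pi) + 1) / (60 * T * G)).
have [Ipath lower] := expected_path_sextic T_gt0 n Xcont Xmeas Xlaw.
have := expected_sextic_bound T_gt0 Xcont Xmeas WX Ipath solS oV V0 VU r_gt0 bound.
apply/negP; rewrite -ltNge.
have n3 : 0 < n%:R ^+ 3 :> R by rewrite exprn_gt0// ltr0n.
apply: (@lt_le_trans _ _ (120 * (T / 2 * (G * (2 * pi * #|resonances n|%:R))))); last first.
  by rewrite ler_pM2l.
have -> : 120 * (T / 2 * (G * (2 * pi * #|resonances n|%:R))) =
    2 * pi * (60 * T * G * #|resonances n|%:R) by field.
rewrite (_ : C * _ = 2 * pi * (C * (2 * pi) * n%:R ^+ 3)); last by ring.
rewrite ltr_pM2l//; apply: (@lt_le_trans _ _ ((C * (2 * pi) + 1) * n%:R ^+ 3)).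
  by rewrite ltr_pM2r// ltrDl.
move: resn; rewrite mulrAC ler_pdivrMr// => /le_trans; apply.
by rewrite mulrC.
Qed.
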